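(* Let $\mathbf A,\mathbf b,\mathbf c$ describe an explicit $4$-stage Runge--Kutta scheme of order $4$ with $\sum_{j=1}^4a_{ij}=c_i$, and let $\mathbf f^{[\nu]}\in\mathcal C^5$ for $\nu=1,\dots,N$. Then the corresponding MPRK scheme (see context) is at least of order $p=s=4$ if and only if, for $\mu,\nu=1,\dots,N$ and $i=2,3,4$, as $\Delta t\to0$, $$\sigma_\mu=\Bigl(\mathbf y^n+\Delta t\,\mathbf f+\tfrac{\Delta t^2}{2}\mathbf D\mathbf f\,\mathbf f+\tfrac{\Delta t^3}{6}\bigl(\mathbf D^2\mathbf f(\mathbf f,\mathbf f)+\mathbf D\mathbf f\,\mathbf D\mathbf f\,\mathbf f\bigr)\Bigr)_\mu+\mathcal O(\Delta t^4)$$ (with $\mathbf f$, $\mathbf D\mathbf f$, $\mathbf D^2\mathbf f$ evaluated at $\mathbf y^n$), $$\sum_{i=2}^4 b_ic_i\,\frac{y_\nu^n+\Delta t\,c_if_\nu(\mathbf y^n)+\tfrac12\Delta t^2\sum_{k=1}^4a_{ik}c_k\bigl(\mathbf D\mathbf f(\mathbf y^n)\mathbf f(\mathbf y^n)\bigr)_\nu}{\pi_\nu^{(i)}}=\frac12+\mathcal O(\Delta t^3),$$ $$\pi_\nu^{(i)}=y_\nu^n+\Delta t\,c_if_\nu(\mathbf y^n)+\mathcal O(\Delta t^2).$$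
   Context: Conservative autonomous production-destruction system (PDS): $y_k'=\sum_{\nu=1}^N\bigl(p_{k\nu}(\mathbf y)-d_{k\nu}(\mathbf y)\bigr)$, $k=1,\dots,N$, with positive initial data, where $p_{k\nu},d_{k\nu}\ge0$ for $\mathbf y\ge\mathbf 0$, $p_{k\nu}=d_{\nu k}$ and $p_{kk}=d_{kk}=0$. It is written as $\mathbf y'=\mathbf f(\mathbf y)=\sum_{\nu=1}^N\mathbf f^{[\nu]}(\mathbf y)$ with $f^{[\nu]}_k=p_{k\nu}$ for $k\ne\nu$ and $f^{[k]}_k=-\sum_{\mu=1}^N d_{k\mu}$. $\mathbf D\mathbf f$ and $\mathbf D^2\mathbf f$ are the first and second derivatives of $\mathbf f$. Standing assumptions: each $\mathbf f^{[\nu]}$ is Lipschitz continuous; the Runge--Kutta coefficients satisfy $\mathbf A,\mathbf b\ge\mathbf 0$. MPRK (modified Patankar--Runge--Kutta) scheme: for $k=1,\dots,N$, $$y_k^{(i)}=y_k^n+\Delta t\sum_{j=1}^{i-1}a_{ij}\sum_{\nu=1}^N\Bigl(p_{k\nu}(\mathbf y^{(j)})\frac{y_\nu^{(i)}}{\pi_\nu^{(i)}}-d_{k\nu}(\mathbf y^{(j)})\frac{y_k^{(i)}}{\pi_k^{(i)}}\Bigr),\ i=1,\dots,s,$$ $$y_k^{n+1}=y_k^n+\Delta t\sum_{j=1}^{s}b_{j}\sum_{\nu=1}^N\Bigl(p_{k\nu}(\mathbf y^{(j)})\frac{y_\nu^{n+1}}{\sigma_\nu}-d_{k\nu}(\mathbf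 y^{(j)})\frac{y_k^{n+1}}{\sigma_k}\Bigr),$$ here with $s=4$. The Patankar-weight denominators $\pi_\nu^{(i)}=\pi_\nu^{(i)}(\mathbf y^n,\mathbf y^{(1)},\dots,\mathbf y^{(i-1)})$ and $\sigma_\nu=\sigma_\nu(\mathbf y^n,\mathbf y^{(1)},\dots,\mathbf y^{(s)})$ are positive for every $\Delta t\ge0$, continuous, and independent of $\mathbf y^{(i)}$ and $\mathbf y^{n+1}$, respectively. Here $\mathbf y^n>\mathbf 0$. The expression in the condition on $\sigma_\mu$ is the truncated NB-series $\mathrm{NB}_3(\tfrac1\gamma,\mathbf y^n)$ of the exact solution, i.e. its third-order Taylor polynomial. Order: the method is of order at least $p$ if, starting from exact data $\mathbf y^n=\mathbf y(t_n)$, one step satisfies $\mathbf y^{n+1}-\mathbf y(t_n+\Delta t)=\mathcal O(\Delta t^{p+1})$ as $\Delta t\to0$. As usual for order conditions, the equivalence is understood for arbitrary right-hand sides of the stated class (elementary differentials regarded as linearly independent).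
   Formalization: In the second condition the factor 1/2 before Δt² Σ a_ik c_k (Df f)_ν is removed: the stage expansion has coefficient 1, and with 1/2 the equivalence fails (e.g. classical RK4 on y1'=-y1, y2'=y1), the sum being off by Δt²/16 (Df f)_ν/y_ν. *)

(* Defs.v *)
(* The stages 1, ..., s of a Runge-Kutta scheme
   and the species 1, ..., N are indexed from 0, by 'I_s and 'I_N; state
   vectors are row vectors. *)
From HB Require Import structures.
From mathcomp Require Import all_boot all_order all_algebra.
From mathcomp Require Import all_classical all_reals all_analysis.
Import Order.TTheory GRing.Theory Num.Theory.
Import numFieldNormedType.Exports.

Set Implicit Arguments.
Unset Strict Implicit.
Unset Printing Implicit Defensive.

Local Open Scope classical_set_scope.
Local Open Scope ring_scope.

Notation "g '=O(dt^' k )" := (g =O_ (0^'+) (fun h => h ^+ k))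
  (at level 70, k at level 9, format "g  '=O(dt^' k )") : ring_scope.

Section Calculus.
Variable R : realType.

(* [A] is meant to be open; over a finite-dimensional space this is the usual
   class C^k, the partial derivatives being the [fun x => 'D_v f x] with [v]
   in the canonical basis. *)
Fixpoint classC (V W : normedModType R) (k : nat) (A : set V) (f : V -> W) :
    Prop :=
  match k with
  | 0 => forall x, A x -> {for x, continuous f}
  | k'.+1 => (forall x, A x -> differentiable f x) /\
             forall v : V, classC k' A (fun x => 'D_v f x)
  end.

(* [phi] is, near time 0, the solution of y' = f(y), y(0) = y0.  The problems
   considered are autonomous, hence the choice of 0 as initial time. *)
Definition ivp_solution (d : nat) (f : 'rV[R]_d -> 'rV[R]_d) (y0 : 'rV[R]_d)
    (phi : R -> 'rV[R]_d) : Prop :=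
  phi 0 = y0 /\ \forall t \near (0 : R), is_derive t (1 : R) phi (f (phi t)).

Definition explicit_rk (s : nat) (A : 'M[R]_s) : Prop :=
  forall i j : 'I_s, (i <= j)%N -> A i j = 0.

Definition rk_order_at_least (s p : nat) (A : 'M[R]_s) (b : 'rV[R]_s) : Prop :=
  forall (d : nat) (f : 'rV[R]_d -> 'rV[R]_d) (y0 : 'rV[R]_d)
    (phi : R -> 'rV[R]_d) (X : R -> 'I_s -> 'rV[R]_d),
    classC p.+1 setT f ->
    ivp_solution f y0 phi ->
    (forall h i, X h i = y0 + h *: \sum_(j < s) A i j *: f (X h j)) ->
    forall k : 'I_d,
      (fun h : R =>
         (y0 + h *: \sum_(j < s) b 0 j *: f (X h j)) 0 k - phi h 0 k)
      =O(dt^ p.+1).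

End Calculus.

Section PDS.
Variables (R : realType) (N : nat).

Definition pos_orthant : set 'rV[R]_N := [set y | forall k, 0 < y 0 k].
Definition nneg_orthant : set 'rV[R]_N := [set y | forall k, 0 <= y 0 k].

(* The column f^[nu] of the splitting f = \sum_nu f^[nu], for production terms
   [p y k nu] and destruction terms [d y k nu]. *)
Definition pd_split (p d : 'rV[R]_N -> 'M[R]_N) (nu : 'I_N) (y : 'rV[R]_N) :
    'rV[R]_N :=
  \row_k (if k == nu then - \sum_(mu < N) d y k mu else p y k nu).

(* Everything is required on the orthant only; the values of [production] and
   [destruction] elsewhere are irrelevant. *)
Record pds := PDS {
  production : 'rV[R]_N -> 'M[R]_N;
  destruction : 'rV[R]_N -> 'M[R]_N;
  production_ge0 : forall y k nu, nneg_orthant y -> 0 <= production y k nu;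
  destruction_ge0 : forall y k nu, nneg_orthant y -> 0 <= destruction y k nu;
  pds_conservative : forall y k nu, nneg_orthant y ->
    production y k nu = destruction y nu k;
  production_diag : forall y k, nneg_orthant y -> production y k k = 0;
  destruction_diag : forall y k, nneg_orthant y -> destruction y k k = 0;
  pds_lipschitz : forall nu,
    [lipschitz (pd_split production destruction nu y) | y in nneg_orthant];
  pds_C5 : forall nu,
    classC 5 pos_orthant (pd_split production destruction nu) }.

Definition fsplit (P : pds) (nu : 'I_N) : 'rV[R]_N -> 'rV[R]_N :=
  pd_split (production P) (destruction P) nu.

Definition rhs (P : pds) (y : 'rV[R]_N) : 'rV[R]_N :=
  \sum_(nu < N) fsplit P nu y.

(* Df(y) v and D^2f(y)(v, w) *)
Definition Drhs (P : pds) (y v : 'rV[R]_N) : 'rV[R]_N := 'D_v (rhs P) y.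
Definition D2rhs (P : pds) (y v w : 'rV[R]_N) : 'rV[R]_N :=
  'D_v (fun z => 'D_w (rhs P) z) y.

Section MPRK.
Variable s : nat.

(* The stages y^(1), ..., y^(s) are the rows of a matrix.  The arguments of a
   denominator are the step size, y^n and the stages. *)
Definition denominator := (R * 'rV[R]_N * 'M[R]_(s, N))%type -> 'rV[R]_N.

Definition denominator_domain : set (R * 'rV[R]_N * 'M[R]_(s, N)) :=
  [set x | [/\ 0 <= x.1.1, pos_orthant x.1.2
             & forall i, pos_orthant (row i x.2)]].

Definition admissible (w : denominator) : Prop :=
  (forall x, denominator_domain x -> pos_orthant (w x)) /\
  {within denominator_domain, continuous w}.

Definition uses_stages_below (i : 'I_s) (w : denominator) : Prop :=
  forall (h : R) (y : 'rV[R]_N) (Y Y' : 'M[R]_(s, N)),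
    (forall j : 'I_s, (j < i)%N -> row j Y = row j Y') ->
    w (h, y, Y) = w (h, y, Y').

(* The Patankar-weighted increment \sum_nu (p_{k nu}(z) y_nu / w_nu
   - d_{k nu}(z) y_k / w_k). *)
Definition patankar (P : pds) (z y w : 'rV[R]_N) (k : 'I_N) : R :=
  \sum_(nu < N) (production P z k nu * (y 0 nu / w 0 nu)
                 - destruction P z k nu * (y 0 k / w 0 k)).

(* [Y] and [y1] are the stage values and the result y^{n+1} of one step of
   size [h] from [yn]: the scheme is linearly implicit in each of them. *)
Definition mprk_step (A : 'M[R]_s) (b : 'rV[R]_s) (pi : 'I_s -> denominator)
    (sigma : denominator) (P : pds) (h : R) (yn : 'rV[R]_N)
    (Y : 'M[R]_(s, N)) (y1 : 'rV[R]_N) : Prop :=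
  (forall (i : 'I_s) k, Y i k = yn 0 k + h *
     \sum_(j < s | (j < i)%N)
        A i j * patankar P (row j Y) (row i Y) (pi i (h, yn, Y)) k) /\
  (forall k, y1 0 k = yn 0 k + h *
     \sum_(j < s) b 0 j * patankar P (row j Y) y1 (sigma (h, yn, Y)) k).

End MPRK.

(* [y1 P yn h] is the result of the step and [phi P yn] the exact solution. *)
Definition order_at_least (p : nat) (y1 phi : pds -> 'rV[R]_N -> R -> 'rV[R]_N) :
    Prop :=
  forall (P : pds) (yn : 'rV[R]_N), pos_orthant yn ->
  forall k : 'I_N,
    (fun h : R => y1 P yn h 0 k - phi P yn h 0 k) =O(dt^ p.+1).

End PDS.

Section Trees.
Variables (R : realType) (N : nat).

(* Planar rooted trees whose nodes carry one of the N colours. *)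
Inductive ntree : Type := Node of 'I_N & seq ntree.

Fixpoint tree_order (t : ntree) : nat :=
  let: Node _ ts := t in (sumn [seq tree_order u | u <- ts]).+1.

Fixpoint density (t : ntree) : nat :=
  let: Node _ ts := t in
  tree_order t * foldr muln 1%N [seq density u | u <- ts].

(* Product of the factorials of the numbers of children.  A non-planar tree
   with symmetry coefficient sigma has planar_weight / sigma planar
   representatives, so that summing over planar trees with the factor
   1 / planar_weight is summing over non-planar ones with the factor
   1 / sigma. *)
Fixpoint planar_weight (t : ntree) : nat :=
  let: Node _ ts := t in
  (size ts)`! * foldr muln 1%N [seq planar_weight u | u <- ts].

(* F([t_1, ..., t_k]_nu)(y) = D^k f^[nu](y) (F(t_1)(y), ..., F(t_k)(y)) *)
Fixpoint elementary_differential (P : pds R N) (y : 'rV[R]_N) (t : ntree) :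
    'rV[R]_N :=
  let: Node nu ts := t in
  foldr (fun v g => fun z => 'D_v g z) (fsplit P nu)
        [seq elementary_differential P y u | u <- ts] y.

Definition ntrees1 : seq ntree := [seq Node nu [::] | nu <- enum 'I_N].
Definition ntrees2 : seq ntree :=
  [seq Node nu [:: t] | nu <- enum 'I_N, t <- ntrees1].
Definition ntrees3 : seq ntree :=
  [seq Node nu [:: t] | nu <- enum 'I_N, t <- ntrees2] ++
  [seq Node nu ts | nu <- enum 'I_N,
     ts <- [seq [:: t; u] | t <- ntrees1, u <- ntrees1]].
Definition ntrees4 : seq ntree :=
  [seq Node nu [:: t] | nu <- enum 'I_N, t <- ntrees3] ++
  [seq Node nu ts | nu <- enum 'I_N,
     ts <- [seq [:: t; u] | t <- ntrees1, u <- ntrees2] ++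
           [seq [:: t; u] | t <- ntrees2, u <- ntrees1] ++
           [seq t :: ts | t <- ntrees1,
              ts <- [seq [:: u; v] | u <- ntrees1, v <- ntrees1]]].
Definition ntrees_upto4 : seq ntree :=
  ntrees1 ++ ntrees2 ++ ntrees3 ++ ntrees4.

(* The coefficients of the NB-series of the stages and of the result of one
   step of the Runge-Kutta-like scheme with solution-dependent coefficients
   a_ij^[nu] = a_ij y_nu^(i) / pi_nu^(i) and b_j^[nu] = b_j y_nu^{n+1} / sigma_nu;
   the arguments [wY i nu] and [w1 nu] are these quotients. *)
Fixpoint stage_coef (s : nat) (A : 'M[R]_s) (wY : 'I_s -> 'I_N -> R)
    (t : ntree) (i : 'I_s) : R :=
  let: Node nu ts := t in
  \sum_(j < s) A i j * wY i nu *
    foldr *%R 1 [seq stage_coef A wY u j | u <- ts].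

Definition step_coef (s : nat) (A : 'M[R]_s) (b : 'rV[R]_s)
    (wY : 'I_s -> 'I_N -> R) (w1 : 'I_N -> R) (t : ntree) : R :=
  let: Node nu ts := t in
  \sum_(j < s) b 0 j * w1 nu *
    foldr *%R 1 [seq stage_coef A wY u j | u <- ts].

(* "The elementary differentials are linearly independent", for the
   coefficients [e]: if the combination with coefficients [e P yn t h] of the
   elementary differentials of order at most 4 is O(h^5) for all right-hand
   sides of the class, then so is each of its coefficients.  For one right-hand
   side this would be false in general: the columns of a conservative system
   sum up to 0, whence a linear relation between the F(t)(yn) of order 1. *)
Definition independent_differentials
    (e : pds R N -> 'rV[R]_N -> ntree -> R -> R) : Prop :=
  (forall P yn, pos_orthant yn -> forall k : 'I_N,
     (fun h : R =>
        \sum_(t <- ntrees_upto4) h ^+ tree_order t / (planar_weight t)%:R *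
          e P yn t h * elementary_differential P yn t 0 k) =O(dt^ 5)) ->
  forall P yn, pos_orthant yn -> forall t, (tree_order t <= 4)%N ->
     (fun h : R => h ^+ tree_order t * e P yn t h) =O(dt^ 5).

(* Deviation of the coefficients of the numerical solution from the
   coefficients 1 / density of the exact one. *)
Definition coef_defect (s : nat) (A : 'M[R]_s) (b : 'rV[R]_s)
    (pi : pds R N -> 'I_s -> denominator R N s)
    (sigma : pds R N -> denominator R N s)
    (Y : pds R N -> 'rV[R]_N -> R -> 'M[R]_(s, N))
    (y1 : pds R N -> 'rV[R]_N -> R -> 'rV[R]_N)
    (P : pds R N) (yn : 'rV[R]_N) (t : ntree) (h : R) : R :=
  step_coef A b
    (fun i nu => Y P yn h i nu / pi P i (h, yn, Y P yn h) 0 nu)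
    (fun nu => y1 P yn h 0 nu / sigma P (h, yn, Y P yn h) 0 nu) t
  - (density t)%:R^-1.

End Trees.

(* Main.v *)
Require Import Defs.
From HB Require Import structures.
From mathcomp Require Import all_boot all_order all_algebra.
From mathcomp Require Import all_classical all_reals all_analysis.
From mathcomp Require Import ring lra zify.
Import Order.TTheory GRing.Theory Num.Theory.
Import numFieldNormedType.Exports.

Set Implicit Arguments.
Unset Strict Implicit.
Unset Printing Implicit Defensive.

Local Open Scope classical_set_scope.
Local Open Scope ring_scope.

(** The method is a Runge-Kutta scheme whose coefficients a_ij and b_j are
    multiplied, colour by colour, by the weights w_i = y^(i) / pi^(i) and
    w = y^(n+1) / sigma.  Comparing B-series over coloured trees, the error of
    a step is, up to O(h^5), the sum over the trees t of order at most 4 of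
    h^|t| (u(t) - 1/gamma(t)) F(t), up to symmetry factors
    ([step_exact_difference]); here u(t) is the elementary weight of t for the
    modified coefficients.  Three ingredients make this expansion rigorous.
    Positivity and conservation of mass ([patankar_row]) keep the stages in a
    compact simplex, so that the weights have limits as h tends to 0 and are
    bounded ([stage_cvg]).  Substituting a truncated B-series into the
    right-hand side again gives a B-series ([taylor_nb_series]), because the
    terms of the Taylor expansion are multilinear.  The exact solution is
    treated in the same way, each passage through the differential equation
    improving the remainder by one order ([exact_expansion]).

    Necessity.  By independence every u(t) - 1/gamma(t) is O(h^(5-|t|)).  The
    tree with one node gives w = 1 + O(h^4), that is, sigma agrees with
    y^(n+1), hence with the Taylor polynomial of the solution, up to O(h^4).
    On the trees with a single colour, u is the elementary weight of the
    Runge-Kutta scheme with rows a_ij w_i and the same b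
    ([step_coef_monochromatic]).  In the limit this scheme has order 4 as
    well.  But an explicit scheme of order 4 with four stages satisfies
    sum_i b_i a_ij = b_j (1 - c_j) ([kutta_D1], Butcher), and this determines
    the rows of A from b, the last row first: the limits of the weights are 1
    ([kutta_scale_eq1]).  The linearization of the conditions of order 2 and 3
    at w_i = 1 is invertible, by the same determinant, so that
    w_i = 1 + O(h^2) ([kutta_scale_rate]).  Then y^(i) is known up to O(h^3)
    ([stage_taylor]), and the conditions on pi^(i) = y^(i) / w_i follow.

    Sufficiency.  The condition on pi^(i) gives w_i = 1 + O(h), then, with the
    expansion of y^(i), w_i = 1 + O(h^2); the second condition becomes
    sum_i b_i c_i w_i = 1/2 + O(h^3).  If w = 1 + O(h^m), these estimates make
    every term of the error of the step O(h^(m+1)) ([step_error]), whence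
    w = 1 + O(h^(m+1)) as long as m < 4; the iteration ends with an error
    O(h^5).

    The order conditions of the underlying scheme are read off from its order
    by a polynomial system of dimension 8 ([order4_conditionsP]). *)

(** * Asymptotics at zero from the right *)

Section BigOh.
Variable R : realType.
Implicit Types (f g : R -> R) (k l : nat).

(** An explicit form of [f =O(dt^ k)], which composes without filters in the
    statements. *)
Definition bigOh k f : Prop :=
  exists C : R, \forall h \near 0^'+, `|f h| <= C * h ^+ k.

Lemma near0_gt0 : \forall h \near (0 : R)^'+, 0 < h.
Proof. exact: nbhs_right_gt. Qed.

Lemma near0_lt (e : R) : 0 < e -> \forall h \near (0 : R)^'+, h < e.
Proof. by move=> e0; exact: nbhs_right_lt. Qed.

Lemma bigOhP k f : f =O(dt^ k) <-> bigOh k f.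
Proof.
split=> [/eqOP Of|[C Of]].
- move: Of => [M [Mr HM]].
  exists (M + 1); have /= := HM (M + 1) (ltr_pwDr ltr01 (lexx _)).
  move=> H; near=> h; have h0 : 0 < h by near: h; exact: near0_gt0.
  by have := near H h; rewrite (ger0_norm (exprn_ge0 _ (ltW h0))); apply.
- apply/eqOP; exists C; split; first exact: num_real.
  move=> D CD; near=> h; have h0 : 0 < h by near: h; exact: near0_gt0.
  rewrite (ger0_norm (exprn_ge0 _ (ltW h0))).
  apply: le_trans (ler_wpM2r (exprn_ge0 _ (ltW h0)) (ltW CD)).
  by near: h.
Unshelve. all: by end_near. Qed.

Lemma bigOh_near k f g :
  (\forall h \near 0^'+, f h = g h) -> bigOh k f -> bigOh k g.
Proof.
move=> fg [C Of]; exists C; near=> h.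
have <- : f h = g h by near: h.
by near: h.
Unshelve. all: by end_near. Qed.

Lemma bigOh_eq k f g : f =1 g -> bigOh k f -> bigOh k g.
Proof. by move=> fg; apply: bigOh_near; near=> h. Unshelve. all: by end_near. Qed.

Lemma bigOhS k l f : (k <= l)%N -> bigOh l f -> bigOh k f.
Proof.
move=> kl [C Of]; exists `|C|; near=> h.
have h0 : 0 < h by near: h; exact: near0_gt0.
have h1 : h < 1 by near: h; exact: near0_lt.
have Ofh : `|f h| <= C * h ^+ l by near: h.
apply: le_trans Ofh _.
apply: le_trans (ler_wpM2r (exprn_ge0 _ (ltW h0)) (ler_norm C)) _.
apply: ler_wpM2l => //; apply: ler_wiXn2l => //; exact: ltW.
Unshelve. all: by end_near. Qed.

Lemma bigOhD k f g : bigOh k f -> bigOh k g -> bigOh k (fun h => f h + g h).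
Proof.
move=> [C Of] [D Og]; exists (C + D); near=> h.
rewrite mulrDl (le_trans (ler_normD _ _))// lerD//; near: h; assumption.
Unshelve. all: by end_near. Qed.

Lemma bigOhN k f : bigOh k f -> bigOh k (fun h => - f h).
Proof. by move=> [C Of]; exists C; near=> h; rewrite normrN; near: h. Unshelve. all: by end_near. Qed.

Lemma bigOhB k f g : bigOh k f -> bigOh k g -> bigOh k (fun h => f h - g h).
Proof. by move=> Of /bigOhN; exact: bigOhD. Qed.

Lemma bigOhM k l f g :
  bigOh k f -> bigOh l g -> bigOh (k + l) (fun h => f h * g h).
Proof.
move=> [C Of] [D Og]; exists (C * D); near=> h.
rewrite normrM exprD mulrACA ler_pM//; near: h; assumption.
Unshelve. all: by end_near. Qed.

Lemma bigOhMr k f g : bigOh k f -> bigOh 0 g -> bigOh k (fun h => f h * g h).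
Proof. by move=> Of Og; rewrite -[k]addn0; exact: bigOhM. Qed.

Lemma bigOhMl k f g : bigOh 0 f -> bigOh k g -> bigOh k (fun h => f h * g h).
Proof. by move=> Of Og; rewrite -[k]add0n; exact: bigOhM. Qed.

Lemma bigOh_exp k : bigOh k (fun h => h ^+ k).
Proof.
exists 1; near=> h; have h0 : 0 < h by near: h; exact: near0_gt0.
by rewrite mul1r ger0_norm// exprn_ge0// ltW.
Unshelve. all: by end_near. Qed.

Lemma bigOh_id : bigOh 1 (fun h => h).
Proof. exact: (bigOh_exp 1). Qed.

Lemma bigOh_cst c : bigOh 0 (fun=> c).
Proof. by exists `|c|; near=> h; rewrite expr0 mulr1. Unshelve. all: by end_near. Qed.

Lemma bigOh0 k : bigOh k (fun=> 0).
Proof. by exists 0; near=> h; rewrite mul0r normr0. Unshelve. all: by end_near. Qed.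

Lemma bigOh_sum k (I : Type) (r : seq I) (Q : pred I) (F : I -> R -> R) :
  (forall i, Q i -> bigOh k (F i)) ->
  bigOh k (fun h => \sum_(i <- r | Q i) F i h).
Proof.
move=> OF; elim: r => [|i r IH].
  by under eq_fun do rewrite big_nil; exact: bigOh0.
under eq_fun do rewrite big_cons.
case: (boolP (Q i)) => [Qi|//]; apply: bigOhD => //; exact: OF.
Qed.

Lemma bigOh_sum_all k (I : Type) (r : seq I) (Q : pred I) (F : I -> R -> R) :
  all Q r -> (forall i, Q i -> bigOh k (F i)) ->
  bigOh k (fun h => \sum_(i <- r) F i h).
Proof.
move=> + OF; elim: r => [_|i r IH /andP[Qi Qr]].
  by under eq_fun do rewrite big_nil; exact: bigOh0.
under eq_fun do rewrite big_cons.
by apply: bigOhD; [exact: OF|exact: IH].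
Qed.

Lemma bigOh_le k f g :
  (\forall h \near 0^'+, `|f h| <= `|g h|) -> bigOh k g -> bigOh k f.
Proof.
move=> fg [C Og]; exists C; near=> h.
have fgh : `|f h| <= `|g h| by near: h.
by apply: le_trans fgh _; near: h.
Unshelve. all: by end_near. Qed.

Lemma bigOh_norm k f : bigOh k f -> bigOh k (fun h => `|f h|).
Proof. by apply: bigOh_le; near=> h; rewrite normr_id. Unshelve. all: by end_near. Qed.

Lemma bigOh_expM k l f : bigOh k f -> bigOh (l + k) (fun h => h ^+ l * f h).
Proof. by move=> Of; apply: bigOhM => //; exact: bigOh_exp. Qed.

(** Cancellation of a power of the step, which is positive near 0. *)
Lemma bigOh_expM_inv k l f : bigOh (l + k) (fun h => h ^+ l * f h) -> bigOh k f.
Proof.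
move=> [C Of]; exists C; near=> h.
have h0 : 0 < h by near: h; exact: near0_gt0.
rewrite -(ler_pM2l (exprn_gt0 l h0)) mulrCA -exprD.
rewrite -[leLHS]ger0_norm ?mulr_ge0 ?exprn_ge0 ?(ltW h0)// normrM normr_id -normrM.
by near: h.
Unshelve. all: by end_near. Qed.

Lemma cvg_bigOh0 f (l : R) : f h @[h --> 0^'+] --> l -> bigOh 0 f.
Proof.
move=> fl; exists (`|l| + 1); near=> h; rewrite expr0 mulr1.
rewrite -lerBlDl; apply: le_trans (lerB_dist _ _) _.
by rewrite distrC ltW//; near: h; exact: cvgr_dist_lt.
Unshelve. all: by end_near. Qed.

Lemma bigOh_cvg0 k f : (0 < k)%N -> bigOh k f -> f h @[h --> 0^'+] --> (0 : R).
Proof.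
move=> k0 /(bigOhS k0) [C Of]; apply/cvgr0Pnorm_lt => e e0.
near=> h; have h0 : 0 < h by near: h; exact: near0_gt0.
have he : h < e / (`|C| + 1).
  by near: h; apply: near0_lt; rewrite divr_gt0// ltr_wpDl.
have Ofh : `|f h| <= C * h ^+ 1 by near: h.
apply: le_lt_trans Ofh _; rewrite expr1.
apply: le_lt_trans (ler_wpM2r (ltW h0) (ler_norm C)) _.
move: he; rewrite ltr_pdivlMr ?ltr_wpDl// mulrC; apply: le_lt_trans.
by rewrite ler_wpM2r ?(ltW h0)// lerDl.
Unshelve. all: by end_near. Qed.

Lemma bigOhB_cvg k f (l : R) :
  (0 < k)%N -> bigOh k (fun h => f h - l) -> f h @[h --> 0^'+] --> l.
Proof.
move=> k0 /(bigOh_cvg0 k0) H; by apply/subr_cvg0.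
Qed.

Lemma bigOh_cvg0B k f (l : R) :
  (0 < k)%N -> bigOh k (fun h => f h) -> f h @[h --> 0^'+] --> l -> l = 0.
Proof.
move=> k0 /(bigOh_cvg0 k0) f0 fl.
by apply: (cvg_unique _ fl f0) => //; exact: norm_hausdorff.
Qed.

(** As soon as [C * g] is below 1/2, the quadratic term is at most half of
    [g] and can be moved to the left-hand side. *)
Lemma bigOh_absorb k g (C : R) :
  (forall h, 0 <= g h) -> g h @[h --> 0^'+] --> (0 : R) ->
  (exists f, bigOh k f /\ \forall h \near 0^'+, g h <= f h + C * g h ^+ 2) ->
  bigOh k g.
Proof.
move=> g0 gcvg [f [[D Of] gf]]; exists (2 * D); near=> h.
have gh : g h <= f h + C * g h ^+ 2 by near: h.
have gs : g h < 1 / (2 * (`|C| + 1)).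
  have e0 : 0 < 1 / (2 * (`|C| + 1)) by rewrite divr_gt0// mulr_gt0// ltr_wpDl.
  apply: le_lt_trans (ler_norm _) _.
  by near: h; move/cvgr0Pnorm_lt : gcvg; exact.
have fh : `|f h| <= D * h ^+ k by near: h.
have := g0 h => gh0.
have C1 : 0 < `|C| + 1 by rewrite ltr_wpDl.
move: gs; rewrite ltr_pdivlMr ?mulr_gt0// => gs.
have Cg : C * g h ^+ 2 <= g h / 2.
  have := ler_norm C; nra.
rewrite ger0_norm//; have := ler_norm (f h); lra.
Unshelve. all: by end_near. Qed.

End BigOh.

(** * Iterated directional derivatives *)

Section IteratedDerivatives.
Variables (R : realType) (V W : normedModType R) (A : set V).
Hypothesis openA : open A.
Implicit Types (f g : V -> W) (v w y : V) (vs : seq V).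

(** Folded in the same way as [elementary_differential], which is therefore an
    iterated derivative by conversion. *)
Definition iter_derive vs g : V -> W := foldr (fun v f => fun z => 'D_v f z) g vs.

Lemma iter_derive_rcons vs v g :
  iter_derive (rcons vs v) g = iter_derive vs (fun z => 'D_v g z).
Proof. by rewrite /iter_derive foldr_rcons. Qed.

Lemma near_open y : A y -> \forall z \near y, A z.
Proof. by move=> Ay; apply: open_nbhs_nbhs; split. Qed.

Lemma eq_iter_derive f g vs :
  (forall x, A x -> f x = g x) -> forall x, A x ->
  iter_derive vs f x = iter_derive vs g x.
Proof.
move=> fg; elim: vs => [//|v vs IH] x Ax /=.
apply: near_eq_derive; near=> z; apply: IH.
by near: z; exact: near_open.
Unshelve. all: by end_near. Qed.

Lemma classC_iter_derive k vs g :
  classC (size vs + k) A g -> classC k A (iter_derive vs g).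
Proof.
elim/last_ind: vs g k => [//|vs v IH] g k.
rewrite size_rcons iter_derive_rcons => -[_ Dg].
by apply: IH; exact: Dg.
Qed.

Lemma differentiable_iter_derive vs g x :
  classC (size vs).+1 A g -> A x -> differentiable (iter_derive vs g) x.
Proof. by rewrite -addn1 => /classC_iter_derive[+ _]; exact. Qed.

Lemma classCS k g : classC k.+1 A g -> classC k A g.
Proof.
elim: k g => [|k IH] g [dg Dg].
  by move=> x Ax; exact/differentiable_continuous/dg.
by split=> // v; apply: IH; exact: Dg.
Qed.

Lemma classC_le k l g : (k <= l)%N -> classC l A g -> classC k A g.
Proof.
move=> /subnK <-; elim: (l - k)%N => [//|m IH]; rewrite addSn.
by move=> /classCS; exact: IH.
Qed.

Lemma iter_derive_linear_fun vs a f g x :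
  classC (size vs) A f -> classC (size vs) A g -> A x ->
  iter_derive vs (fun z => a *: f z + g z) x =
  a *: iter_derive vs f x + iter_derive vs g x.
Proof.
elim: vs x => [//|v vs IH] x Cf Cg Ax /=.
have df : differentiable (iter_derive vs f) x by exact: differentiable_iter_derive.
have dg : differentiable (iter_derive vs g) x by exact: differentiable_iter_derive.
transitivity ('D_v (a *: iter_derive vs f + iter_derive vs g) x).
  apply: near_eq_derive; near=> z; rewrite IH //.
  - exact: classCS.
  - exact: classCS.
  - by near: z; exact: near_open.
have dvf : derivable (iter_derive vs f) x v by exact: diff_derivable.
rewrite deriveD; last 2 first.
- exact: derivableZ.
- exact: diff_derivable.
by rewrite deriveZ.
Unshelve. all: by end_near. Qed.

Lemma derive_linear g a v w x :
  differentiable g x -> 'D_(a *: v + w) g x = a *: 'D_v g x + 'D_w g x.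
Proof. by move=> dg; rewrite !deriveE// linearP. Qed.

(** The differential is linear in its direction, and the outer derivatives are
    linear in the function that they apply to. *)
Lemma iter_derive_slot vs ws a u w g y :
  classC (size vs + size ws).+1 A g -> A y ->
  iter_derive (vs ++ (a *: u + w) :: ws) g y =
  a *: iter_derive (vs ++ u :: ws) g y + iter_derive (vs ++ w :: ws) g y.
Proof.
move=> Cg Ay.
have CG : classC (size vs).+1 A (iter_derive ws g).
  by apply: classC_iter_derive; rewrite addnS addnC.
have E x : iter_derive (vs ++ x :: ws) g =
    iter_derive vs (fun z => 'D_x (iter_derive ws g) z).
  by rewrite /iter_derive foldr_cat.
case: CG => dG DG; rewrite !E -iter_derive_linear_fun; [|exact: DG|exact: DG|by []].
by apply: eq_iter_derive => // z Az; rewrite derive_linear//; exact: dG.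
Qed.

Lemma iter_derive_slot_sum vs ws (I : Type) (r : seq I) (c : I -> R)
    (u : I -> V) g y :
  classC (size vs + size ws).+1 A g -> A y ->
  iter_derive (vs ++ (\sum_(i <- r) c i *: u i) :: ws) g y =
  \sum_(i <- r) c i *: iter_derive (vs ++ u i :: ws) g y.
Proof.
move=> Cg Ay; elim: r => [|i r IH]; last first.
  by rewrite !big_cons iter_derive_slot// IH.
rewrite !big_nil; have := iter_derive_slot 1 0 0 Cg Ay.
by rewrite scaler0 addr0 scale1r => /eqP; rewrite -subr_eq0 opprD addrA subrr
  sub0r oppr_eq0 => /eqP.
Qed.

(** Homogeneity in all the directions at once, for use along a segment. *)
Lemma iter_derive_nseqZ n a v g y : classC n A g -> A y ->
  iter_derive (nseq n (a *: v)) g y = a ^+ n *: iter_derive (nseq n v) g y.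
Proof.
elim: n y => [|n IH] y Cg Ay /=; first by rewrite expr0 scale1r.
have dg w : differentiable (iter_derive (nseq n w) g) y.
  by apply: differentiable_iter_derive; rewrite ?size_nseq.
have dvg : derivable (iter_derive (nseq n v) g) y (a *: v).
  exact: diff_derivable.
transitivity ('D_(a *: v) (a ^+ n *: iter_derive (nseq n v) g) y).
  apply: near_eq_derive; near=> z; rewrite IH//; first exact: classCS.
  by near: z; exact: near_open.
by rewrite deriveZ// !deriveE// linearZ/= scalerA exprSr.
Unshelve. all: by end_near. Qed.

Lemma iter_derive_sum (n : nat) (g : 'I_n -> V -> W) vs x :
  (forall i, classC (size vs) A (g i)) -> A x ->
  iter_derive vs (fun z => \sum_i g i z) x = \sum_i iter_derive vs (g i) x.
Proof.
elim: vs x => [//|v vs IH] x Cg Ax /=.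
transitivity ('D_v (\sum_i iter_derive vs (g i)) x).
  apply: near_eq_derive; near=> z; rewrite fct_sumE IH//.
    by move=> i; apply: classCS; exact: Cg.
  by near: z; exact: near_open.
rewrite derive_sum// => i; apply: diff_derivable.
exact: differentiable_iter_derive (Cg i) Ax.
Unshelve. all: by end_near. Qed.

End IteratedDerivatives.

(** * Taylor's formula *)

Lemma normr_coord (R : realType) (N : nat) (v : 'rV[R]_N) k : `|v 0 k| <= `|v|.
Proof.
rewrite [leRHS]/Num.Def.normr/= mx_normrE.
exact: (le_bigmax _ (fun ij => `|v ij.1 ij.2|) (0, k)).
Qed.

Lemma normr_le_sum_coord (R : realType) (N : nat) (v : 'rV[R]_N) :
  `|v| <= \sum_k `|v 0 k|.
Proof.
rewrite [leLHS]/Num.Def.normr/= mx_normrE; apply: bigmax_le; first exact: sumr_ge0.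
by move=> [i k] _ /=; rewrite ord1 (bigD1 k)//= lerDl sumr_ge0.
Qed.

Section Taylor.
Variables (R : realType) (N M : nat) (A : set 'rV[R]_N).
Hypothesis openA : open A.
Implicit Types (g : 'rV[R]_N -> 'rV[R]_M) (y v : 'rV[R]_N).

Lemma iter_derive_nseqSr n v g :
  iter_derive (nseq n.+1 v) g = iter_derive (nseq n v) (fun z => 'D_v g z).
Proof.
have -> : nseq n.+1 v = rcons (nseq n v) v by elim: n => //= n {1}->.
exact: iter_derive_rcons.
Qed.

Lemma is_derive_line g y v (t : R) : differentiable g (y + t *: v) ->
  is_derive t 1 (fun s : R => g (y + s *: v)) ('D_v g (y + t *: v)).
Proof.
move=> dg.
have dl : is_diff t (fun s : R => y + s *: v) (fun s => s *: v).
  have dv : is_diff t (fun s : R => s *: v) (fun s => s *: v).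
    exact: (is_diff_scalel t v).
  have dc : is_diff t (cst y : R -> 'rV[R]_N) 0 by exact: is_diff_cst.
  have := @is_diffD _ _ _ (cst y) (fun s : R => s *: v) 0 (fun s => s *: v) t dc dv.
  by rewrite add0r.
have [dl1 dl2] := dl.
have dc : differentiable (g \o (fun s : R => y + s *: v)) t.
  by apply: differentiable_comp; [exact: dl1|exact: dg].
apply: DeriveDef; first exact: diff_derivable.
rewrite deriveE// diff_comp//=.
by rewrite dl2 scale1r deriveE.
Qed.

Lemma is_derive_row_coord (f : R -> 'rV[R]_M) (t : R) (df : 'rV[R]_M) i :
  is_derive t 1 f df -> is_derive t 1 (fun s => f s 0 i : R) (df 0 i).
Proof.
move=> [ft <-]; apply: DeriveDef; first exact: (derivable_mxP _ _ _).1.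
by rewrite derive_mx// mxE.
Qed.

Lemma is_derive_taylor_poly n (c : nat -> R) (t : R) :
  is_derive t 1 (fun s => \sum_(j < n.+1) j`!%:R^-1 * s ^+ j * c j)
    (\sum_(j < n) j`!%:R^-1 * t ^+ j * c j.+1).
Proof.
elim: n => [|n IH].
  rewrite big_ord0; under eq_fun do rewrite big_ord1 expr0 fact0 invr1 !mul1r.
  exact: is_derive_cst.
under eq_fun do rewrite big_ord_recr/=.
rewrite big_ord_recr/=; apply: is_deriveD.
have -> : (fun s : R => (n.+1)`!%:R^-1 * s ^+ n.+1 * c n.+1) =
    ((n.+1)`!%:R^-1 * c n.+1) *: (fun s : R => s ^+ n.+1).
  by apply/funext => s; rewrite /GRing.scale/= mulrAC.
have dX : is_derive t 1 (fun s : R => s ^+ n.+1) (n.+1%:R * t ^+ n).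
  apply: DeriveDef; first exact: exprn_derivable.
  by rewrite exp_derive /GRing.scale/= mulr1.
apply: is_derive_eq.
have f0 : n`!%:R != 0 :> R by rewrite pnatr_eq0 -lt0n fact_gt0.
have n0 : 1 + n%:R != 0 :> R by rewrite nat1r pnatr_eq0.
by rewrite /GRing.scale/= factS natrM; field; rewrite f0.
Qed.

(** By induction on the order.  Along the segment from [y] to [y + v], the
    derivative of the remainder of [g] is the combination, with the
    coordinates of [v] as coefficients, of the remainders of its partial
    derivatives; the mean value theorem then gains one factor [`|v|]. *)
Lemma taylor n g y : classC n A g -> A y ->
  exists C : R, \forall v \near (0 : 'rV[R]_N),
    `|g (y + v) - \sum_(j < n) j`!%:R^-1 *: iter_derive (nseq j v) g y|
    <= C * `|v| ^+ n.
Proof.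
elim: n g => [|n IH] g Cg Ay.
  exists (`|g y| + 1).
  have := Cg y Ay => /cvgrPdist_lt /(_ 1 ltr01) /(nbhs0P _ _).1 gy.
  near=> v; rewrite big_ord0 subr0 expr0 mulr1 -lerBlDl.
  apply: le_trans (lerB_dist _ _) _; rewrite distrC ltW//; near: v.
  exact: gy.
have [dg Dg] := Cg.
pose e (a : 'I_N) := delta_mx 0 a : 'rV[R]_N.
have /boolp.choice[C HC] : forall a : 'I_N, exists C : R, \forall v \near (0 : 'rV[R]_N),
    `|'D_(e a) g (y + v)
      - \sum_(j < n) j`!%:R^-1 *: iter_derive (nseq j v) (fun z => 'D_(e a) g z) y|
    <= C * `|v| ^+ n.
  by move=> a; apply: IH => //; exact: Dg.
have nA := (nbhs0P _ _).1 (near_open openA Ay).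
have {}HC : \forall v \near (0 : 'rV[R]_N), A (y + v) /\ forall a : 'I_N,
    `|'D_(e a) g (y + v)
      - \sum_(j < n) j`!%:R^-1 *: iter_derive (nseq j v) (fun z => 'D_(e a) g z) y|
    <= C a * `|v| ^+ n.
  near=> v; split; first by near: v.
  near: v; apply: filter_forall => a; exact: HC.
move: HC => /nbhs_norm0P[r /= r0 HC].
exists (\sum_a `|C a|); apply/nbhs_norm0P; exists r => //= v vr.
have vt t : 0 <= t <= 1 -> `|t *: v| <= `|v|.
  by move=> /andP[t0 t1]; rewrite normrZ ger0_norm// ler_piMl.
have HCt t : 0 <= t <= 1 -> A (y + t *: v) /\ forall a : 'I_N,
    `|'D_(e a) g (y + t *: v)
      - \sum_(j < n) j`!%:R^-1 *: iter_derive (nseq j (t *: v)) (fun z => 'D_(e a) g z) y|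
    <= `|C a| * `|v| ^+ n.
  move=> t01; have [At HCa] := HC (t *: v) (le_lt_trans (vt t t01) vr).
  split=> // a; apply: le_trans (HCa a) _.
  apply: le_trans (ler_wpM2r (exprn_ge0 _ (normr_ge0 _)) (ler_norm (C a))) _.
  by rewrite ler_wpM2l// lerXn2r// ?nnegrE// vt.
rewrite [leLHS]/Num.Def.normr/= mx_normrE; apply: bigmax_le.
  by rewrite mulr_ge0 ?exprn_ge0// sumr_ge0.
move=> [i' i] _; rewrite /= ord1 {i'}.
pose c j := iter_derive (nseq j v) g y 0 i.
(* one coordinate of the remainder at [y + t *: v], and its derivative *)
pose psi (t : R) := g (y + t *: v) 0 i - \sum_(j < n.+1) j`!%:R^-1 * t ^+ j * c j.
pose dpsi (t : R) := 'D_v g (y + t *: v) 0 i - \sum_(j < n) j`!%:R^-1 * t ^+ j * c j.+1.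
have psi1 : psi 1 = (g (y + v)
    - \sum_(j < n.+1) j`!%:R^-1 *: iter_derive (nseq j v) g y) 0 i.
  rewrite /psi !mxE summxE scale1r; congr (_ - _).
  by apply: eq_bigr => j _; rewrite expr1n mulr1 mxE.
have psi0 : psi 0 = 0.
  rewrite /psi big_ord_recl big1 => [|j _].
    by rewrite scale0r addr0 fact0 invr1 expr0 !mul1r addr0 subrr.
  by rewrite /= expr0n/= mulr0 mul0r.
have dpsiP (t : R) : t \in `[0, 1]%R -> is_derive t 1 psi (dpsi t).
  rewrite in_itv/= => t01; have [At _] := HCt t t01.
  apply: is_deriveB; last exact: is_derive_taylor_poly.
  by apply: is_derive_row_coord; apply: is_derive_line; exact: dg.
have dpsi_oo (t : R) : t \in `]0, 1[%R -> is_derive t 1 psi (dpsi t).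
  by move=> t01; apply: dpsiP; apply: subset_itv_oo_cc.
have psi_cont : {within `[0, 1], continuous psi}.
  apply: derivable_within_continuous => t t01.
  by have [] := dpsiP t t01.
have [xi xi01] := @MVT_segment R psi dpsi 0 1 ler01 dpsi_oo psi_cont.
rewrite psi0 !subr0 mulr1 psi1 => ->.
have {}xi01 : 0 <= xi <= 1 by move: xi01; rewrite in_itv.
have [Axi HCxi] := HCt xi xi01.
have Ev z : A z -> 'D_v g z = \sum_a v 0 a *: 'D_(e a) g z.
  move=> Az; transitivity ('D_(\sum_a v 0 a *: e a) g z).
    by rewrite -row_sum_delta.
  by have := iter_derive_slot_sum openA (vs := [::]) (ws := [::])
    (index_enum 'I_N) (v 0) e (classC_le (_ : 1 <= n.+1)%N Cg) Az; apply.
have -> : dpsi xi = \sum_a v 0 a * ('D_(e a) g (y + xi *: v)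
      - \sum_(j < n) j`!%:R^-1 *: iter_derive (nseq j (xi *: v)) (fun z => 'D_(e a) g z) y) 0 i.
  rewrite /dpsi Ev// summxE.
  under [in RHS]eq_bigr do rewrite !mxE mulrBr.
  rewrite sumrB; congr (_ - _); first by apply: eq_bigr => a _; rewrite mxE.
  under [in RHS]eq_bigr do rewrite summxE mulr_sumr.
  rewrite exchange_big/=; apply: eq_bigr => j _.
  have -> : c j.+1 = \sum_a v 0 a * iter_derive (nseq j v) (fun z => 'D_(e a) g z) y 0 i.
    rewrite /c iter_derive_nseqSr.
    rewrite (eq_iter_derive openA (g := fun z => \sum_a v 0 a *: 'D_(e a) g z))//.
    have -> : \sum_a v 0 a * iter_derive (nseq j v) (fun z => 'D_(e a) g z) y 0 i =
      (\sum_a v 0 a *: iter_derive (nseq j v) (fun z => 'D_(e a) g z) y) 0 i.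
      by rewrite summxE; apply: eq_bigr => a _; rewrite mxE.
    congr (_ 0 i).
    have := iter_derive_slot_sum openA (vs := nseq j v) (ws := [::])
      (index_enum 'I_N) (v 0) e (g := g) (y := y).
    rewrite -row_sum_delta cats1 iter_derive_rcons size_nseq addn0.
    under eq_bigr do rewrite cats1 iter_derive_rcons.
    move=> <-//.
    - rewrite (eq_iter_derive openA (g := fun z => 'D_v g z))// => z Az.
      by rewrite Ev.
    - by apply: classC_le Cg; rewrite ltnS ltnW.
  rewrite mulr_sumr; apply: eq_bigr => a _.
  rewrite (iter_derive_nseqZ openA)//; last by apply: classC_le (Dg _); exact: ltnW.
  by rewrite !mxE; ring.
apply: le_trans (ler_norm_sum _ _ _) _; rewrite mulr_suml; apply: ler_sum => a _.
rewrite normrM exprS mulrCA ler_pM//.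
  rewrite [leRHS]/Num.Def.normr/= mx_normrE.
  exact: (le_bigmax _ (fun ij => `|v ij.1 ij.2|) (0, a)).
apply: le_trans (HCxi a).
rewrite [leRHS]/Num.Def.normr/= mx_normrE.
exact: (le_bigmax _ (fun ij => `|_ ij.1 ij.2|) (0, i)).
Unshelve. all: by end_near. Qed.

End Taylor.

(** * Coloured trees of small order *)

Section Trees.
Variable N : nat.
Implicit Types (t u : ntree N) (ts : seq (ntree N)).

Definition forest_order ts : nat := sumn [seq tree_order u | u <- ts].

(** [planar_weight] of any tree with these children. *)
Definition forest_weight ts : nat :=
  (size ts)`! * foldr muln 1%N [seq planar_weight u | u <- ts].

Definition ntrees_upto3 : seq (ntree N) :=
  ntrees1 N ++ ntrees2 N ++ ntrees3 N.

Definition forests_upto3 : seq (seq (ntree N)) :=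
  [:: [::]] ++ [seq [:: t] | t <- ntrees_upto3] ++
  ([seq [:: t; u] | t <- ntrees1 N, u <- ntrees1 N] ++
   [seq [:: t; u] | t <- ntrees1 N, u <- ntrees2 N] ++
   [seq [:: t; u] | t <- ntrees2 N, u <- ntrees1 N]) ++
  [seq t :: ts | t <- ntrees1 N, ts <- [seq [:: u; v] | u <- ntrees1 N, v <- ntrees1 N]].

Lemma big_enum_ord (V : nmodType) (G : 'I_N -> V) :
  \sum_(nu <- enum 'I_N) G nu = \sum_(nu < N) G nu.
Proof. by rewrite big_enum. Qed.

Lemma big_ntrees1 (V : nmodType) (G : ntree N -> V) :
  \sum_(t <- ntrees1 N) G t = \sum_(nu < N) G (Node nu [::]).
Proof. by rewrite big_map big_enum. Qed.

Lemma big_ntrees2 (V : nmodType) (G : ntree N -> V) :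
  \sum_(t <- ntrees2 N) G t =
  \sum_(nu < N) \sum_(t <- ntrees1 N) G (Node nu [:: t]).
Proof. by rewrite big_allpairs_dep big_enum. Qed.

Lemma big_ntrees3 (V : nmodType) (G : ntree N -> V) :
  \sum_(t <- ntrees3 N) G t =
  \sum_(nu < N) (\sum_(t <- ntrees2 N) G (Node nu [:: t]) +
    \sum_(t <- ntrees1 N) \sum_(u <- ntrees1 N) G (Node nu [:: t; u])).
Proof.
rewrite big_cat/= !big_allpairs_dep !big_enum_ord/=. rewrite -big_split/=.
by apply: eq_bigr => nu _; congr (_ + _); rewrite big_allpairs_dep.
Qed.

Lemma big_ntrees_upto3 (V : nmodType) (G : ntree N -> V) :
  \sum_(t <- ntrees_upto3) G t = \sum_(t <- ntrees1 N) G t +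
    \sum_(t <- ntrees2 N) G t + \sum_(t <- ntrees3 N) G t.
Proof. by rewrite !big_cat/= addrA. Qed.

Lemma big_forests_upto3 (V : nmodType) (G : seq (ntree N) -> V) :
  \sum_(ts <- forests_upto3) G ts =
  G [::] + \sum_(t <- ntrees_upto3) G [:: t] +
  (\sum_(t <- ntrees1 N) \sum_(u <- ntrees1 N) G [:: t; u] +
   \sum_(t <- ntrees1 N) \sum_(u <- ntrees2 N) G [:: t; u] +
   \sum_(t <- ntrees2 N) \sum_(u <- ntrees1 N) G [:: t; u]) +
  \sum_(t <- ntrees1 N) \sum_(u <- ntrees1 N) \sum_(v <- ntrees1 N) G [:: t; u; v].
Proof.
rewrite 4!big_cat/= big_seq1 big_cat/= big_map !big_allpairs_dep !addrA.
by congr (_ + _); apply: eq_bigr => t _; rewrite big_allpairs_dep.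
Qed.

(** Grouping the trees by their roots: the trees with root [nu] are the terms
    that a composition with the column [nu] of the splitting produces. *)
Lemma big_ntrees_upto4 (V : nmodType) (G : ntree N -> V) :
  \sum_(t <- ntrees_upto4 N) G t =
  \sum_(nu < N) \sum_(ts <- forests_upto3) G (Node nu ts).
Proof.
under [RHS]eq_bigr do rewrite big_forests_upto3 big_ntrees_upto3.
rewrite 3!big_cat/= big_ntrees1 big_ntrees2 big_ntrees3.
rewrite big_cat/= !big_allpairs_dep !big_enum_ord/= -!big_split/=.
apply: eq_bigr => nu _; set X := (X in _ + (_ + (_ + (_ + X)))).
have -> : X = \sum_(t <- ntrees1 N) \sum_(u <- ntrees2 N) G (Node nu [:: t; u]) +
    (\sum_(t <- ntrees2 N) \sum_(u <- ntrees1 N) G (Node nu [:: t; u]) +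
    \sum_(t <- ntrees1 N) \sum_(u <- ntrees1 N) \sum_(v <- ntrees1 N)
      G (Node nu [:: t; u; v])).
  rewrite /X 2!big_cat/= !big_allpairs_dep; congr (_ + (_ + _)).
  by apply: eq_bigr => t _; rewrite big_allpairs_dep.
rewrite -!addrA; do 3 congr (_ + _); exact: addrCA.
Qed.

Lemma all_allpairs_dep (S1 S2 S3 : Type) (P1 : pred S1) (P2 : pred S2)
    (P3 : pred S3) (f : S1 -> S2 -> S3) s1 s2 :
  all P1 s1 -> all P2 s2 -> (forall x y, P1 x -> P2 y -> P3 (f x y)) ->
  all P3 [seq f x y | x <- s1, y <- s2].
Proof.
move=> + P2s P12; elim: s1 => [//|x s1 IH] /= /andP[P1x P1s].
rewrite all_cat IH// andbT all_map.
by apply: sub_all P2s => y /=; exact: P12.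
Qed.

Lemma all_enumT (S : finType) (Q : pred S) : (forall x, Q x) -> all Q (enum S).
Proof. by move=> HQ; apply/allP => x _. Qed.

Lemma all_ntrees1 : all (fun t => tree_order t == 1%N) (ntrees1 N).
Proof. by rewrite all_map; apply: all_enumT. Qed.

Lemma all_ntrees2 : all (fun t => tree_order t == 2%N) (ntrees2 N).
Proof.
apply: (all_allpairs_dep (P1 := predT) _ all_ntrees1); first exact: all_enumT.
by move=> nu t _ /= /eqP ->.
Qed.

Lemma all_ntrees3 : all (fun t => tree_order t == 3%N) (ntrees3 N).
Proof.
rewrite all_cat; apply/andP; split.
  apply: (all_allpairs_dep (P1 := predT) _ all_ntrees2); first exact: all_enumT.
  by move=> nu t _ /= /eqP ->.
apply: (all_allpairs_dep (P1 := predT) (P2 := fun ts => forest_order ts == 2%N)).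
- exact: all_enumT.
- apply: (all_allpairs_dep all_ntrees1 all_ntrees1) => t u /eqP tE /eqP uE.
  by rewrite /forest_order/= tE uE.
- by move=> nu ts _ /= /eqP <-.
Qed.

Lemma all_ntrees4 : all (fun t => tree_order t == 4%N) (ntrees4 N).
Proof.
rewrite all_cat; apply/andP; split.
  apply: (all_allpairs_dep (P1 := predT) _ all_ntrees3); first exact: all_enumT.
  by move=> nu t _ /= /eqP ->.
apply: (all_allpairs_dep (P1 := predT) (P2 := fun ts => forest_order ts == 3%N)).
- exact: all_enumT.
- rewrite !all_cat; apply/and3P; split.
  + apply: (all_allpairs_dep all_ntrees1 all_ntrees2) => t u /eqP tE /eqP uE.
    by rewrite /forest_order/= tE uE.
  + apply: (all_allpairs_dep all_ntrees2 all_ntrees1) => t u /eqP tE /eqP uE.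
    by rewrite /forest_order/= tE uE.
  + apply: (all_allpairs_dep (P2 := fun ts => forest_order ts == 2%N) all_ntrees1).
      apply: (all_allpairs_dep all_ntrees1 all_ntrees1) => t u /eqP tE /eqP uE.
      by rewrite /forest_order/= tE uE.
    by move=> t ts /eqP tE /eqP tsE; rewrite /forest_order/= tE -[sumn _]/(forest_order ts) tsE.
- by move=> nu ts _ /= /eqP <-.
Qed.

Lemma big_ntrees_upto4_orders (V : nmodType) (G : ntree N -> V) :
  \sum_(t <- ntrees_upto4 N) G t = \sum_(t <- ntrees1 N) G t +
    \sum_(t <- ntrees2 N) G t + \sum_(t <- ntrees3 N) G t + \sum_(t <- ntrees4 N) G t.
Proof.
have -> : ntrees_upto4 N = ntrees_upto3 ++ ntrees4 N.
  by rewrite /ntrees_upto3 -(catA (ntrees1 N) _ (ntrees4 N)) -(catA (ntrees2 N)).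
by rewrite [LHS]big_cat/= big_ntrees_upto3.
Qed.

Lemma tree_order_gt0 t : (0 < tree_order t)%N. Proof. by case: t. Qed.

Lemma planar_weight_gt0 t : (0 < planar_weight t)%N.
Proof.
move: t; fix IH 1; case=> nu ts /=; rewrite muln_gt0 fact_gt0/=.
by elim: ts => [//|t ts IHts] /=; rewrite muln_gt0 IH.
Qed.

End Trees.

(** * Composition with truncated B-series *)

Section Composition.
Variables (R : realType) (N : nat).
Implicit Types (t u : ntree N) (ts : seq (ntree N)).

(** When the terms of a sum over trees are negligible from some order on, only
    their leading parts for the first orders remain. *)
Lemma bigOh_trunc k (G G1 G2 : ntree N -> R -> R) :
  (forall t, tree_order t = 1%N -> bigOh k (fun h => G t h - G1 t h)) ->
  (forall t, tree_order t = 2%N -> bigOh k (fun h => G t h - G2 t h)) ->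
  (forall t, tree_order t = 3%N -> bigOh k (G t)) ->
  bigOh k (fun h => \sum_(t <- ntrees_upto3 N) G t h -
    (\sum_(t <- ntrees1 N) G1 t h + \sum_(t <- ntrees2 N) G2 t h)).
Proof.
move=> O1 O2 O3.
apply: (@bigOh_eq _ _ (fun h => \sum_(t <- ntrees1 N) (G t h - G1 t h) +
    \sum_(t <- ntrees2 N) (G t h - G2 t h) + \sum_(t <- ntrees3 N) G t h)).
  by move=> h; rewrite big_ntrees_upto3 !sumrB; ring.
apply: bigOhD; first apply: bigOhD.
- by apply: bigOh_sum_all (all_ntrees1 N) _ => t /eqP; exact: O1.
- by apply: bigOh_sum_all (all_ntrees2 N) _ => t /eqP; exact: O2.
- by apply: bigOh_sum_all (all_ntrees3 N) _ => t /eqP; exact: O3.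
Qed.

Lemma bigOh_trunc1 k (G G1 : ntree N -> R -> R) :
  (forall t, tree_order t = 1%N -> bigOh k (fun h => G t h - G1 t h)) ->
  (forall t, (1 < tree_order t)%N -> bigOh k (G t)) ->
  bigOh k (fun h => \sum_(t <- ntrees_upto3 N) G t h -
    \sum_(t <- ntrees1 N) G1 t h).
Proof.
move=> O1 O2; have := @bigOh_trunc k G G1 (fun _ _ => 0).
under eq_fun do rewrite big1_eq addr0.
apply => // t tE; last by apply: O2; rewrite tE.
by under eq_fun do rewrite subr0; apply: O2; rewrite tE.
Qed.

(** The coefficient of [F t] in a B-series with elementary weights [alpha].
    The planar weight turns sums over planar trees into sums over non-planar
    ones. *)
Definition tree_coef (alpha : ntree N -> R -> R) t (h : R) : R :=
  h ^+ tree_order t * alpha t h / (planar_weight t)%:R.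

(** The same coefficient for a forest of children, without the power of the
    step and the factor that belong to the root. *)
Definition forest_coef (alpha : ntree N -> R -> R) ts (h : R) : R :=
  h ^+ forest_order ts * foldr *%R 1 [seq alpha t h | t <- ts] /
    (forest_weight ts)%:R.

Variables (F : ntree N -> 'rV[R]_N) (alpha : ntree N -> R -> R).
Hypothesis alpha_bounded : forall t, bigOh 0 (alpha t).

Lemma bigOh_tree_coef t : bigOh (tree_order t) (tree_coef alpha t).
Proof.
apply: bigOhMr; last exact: bigOh_cst.
by apply: bigOhMr => //; exact: bigOh_exp.
Qed.

Definition nb_series (l : seq (ntree N)) (h : R) : 'rV[R]_N :=
  \sum_(t <- l) tree_coef alpha t h *: F t.

Lemma bigOh_nb_series l : bigOh 1 (fun h => `|nb_series l h|).
Proof.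
apply: (@bigOh_le _ _ _ (fun h => \sum_(t <- l) `|tree_coef alpha t h| * `|F t|)).
  near=> h; rewrite normr_id; apply: le_trans (ler_norm _).
  by apply: le_trans (ler_norm_sum _ _ _) _; apply: ler_sum => t _; rewrite normrZ.
apply: bigOh_sum => t _; apply: bigOhMr; last exact: bigOh_cst.
apply: bigOh_norm; apply: bigOhS (bigOh_tree_coef t); exact: tree_order_gt0.
Unshelve. all: by end_near. Qed.

Lemma nb_series_cvg0 l : nb_series l h @[h --> 0^'+] --> (0 : 'rV[R]_N).
Proof.
apply/cvgr0Pnorm_lt => e e0.
have /cvgr0Pnorm_lt /(_ e e0) := bigOh_cvg0 (ltn0Sn 0) (bigOh_nb_series l).
by apply: filterS => h; rewrite normr_id.
Qed.

Variables (A : set 'rV[R]_N) (g : 'rV[R]_N -> 'rV[R]_N) (y : 'rV[R]_N) (k : 'I_N).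
Hypotheses (openA : open A) (Ay : A y) (Cg : classC 4 A g).

Let D ts : R := iter_derive [seq F t | t <- ts] g y 0 k.

(** Substituting a truncated B-series into g: the Taylor expansion of g is
    multilinear in the increment, and regrouping it by powers of the step
    yields one term for each forest. *)
Lemma taylor_nb_series :
  bigOh 4 (fun h => g (y + nb_series (ntrees_upto3 N) h) 0 k -
    \sum_(ts <- forests_upto3 N) forest_coef alpha ts h * D ts).
Proof.
set v := nb_series _.
pose T h := \sum_(j < 4) j`!%:R^-1 *: iter_derive (nseq j (v h)) g y.
have gT : bigOh 4 (fun h => g (y + v h) 0 k - T h 0 k).
  have [C HC] := taylor openA Cg Ay.
  apply: (@bigOh_le _ _ _ (fun h => C * `|v h| ^+ 4)).
    near=> h; have vh : `|g (y + v h) - T h| <= C * `|v h| ^+ 4.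
      near: h; have H := nb_series_cvg0 (ntrees_upto3 N) HC.
      exact: H.
    have -> : g (y + v h) 0 k - T h 0 k = (g (y + v h) - T h) 0 k by rewrite !mxE.
    exact: le_trans (le_trans (normr_coord _ k) vh) (ler_norm _).
  have Ov := bigOh_nb_series (ntrees_upto3 N).
  apply: bigOhMl; first exact: bigOh_cst.
  under eq_fun do rewrite exprS exprS expr2.
  exact: bigOhM Ov (bigOhM Ov (bigOhM Ov Ov)).
pose c := tree_coef alpha.
pose S1 h := \sum_(t <- ntrees_upto3 N) c t h * D [:: t].
pose S2 h := \sum_(t <- ntrees_upto3 N) \sum_(u <- ntrees_upto3 N)
   c t h * c u h * D [:: t; u].
pose S3 h := \sum_(t <- ntrees_upto3 N) \sum_(u <- ntrees_upto3 N)
  \sum_(w <- ntrees_upto3 N) c t h * c u h * c w h * D [:: t; u; w].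
pose B l1 l2 h := \sum_(t <- l1) \sum_(u <- l2) c t h * c u h * D [:: t; u].
pose B3 h := \sum_(t <- ntrees1 N) \sum_(u <- ntrees1 N) \sum_(w <- ntrees1 N)
   c t h * c u h * c w h * D [:: t; u; w].
have TE h : T h 0 k = g y 0 k + S1 h + 2^-1 * S2 h + 6^-1 * S3 h.
  have C1 vs ws : (size vs + size ws < 4)%N ->
      iter_derive (vs ++ v h :: ws) g y =
      \sum_(t <- ntrees_upto3 N) c t h *: iter_derive (vs ++ F t :: ws) g y.
    by move=> sz; apply: (iter_derive_slot_sum openA) => //; exact: classC_le Cg.
  pose d j := iter_derive (nseq j (v h)) g y 0 k.
  have -> : T h 0 k = \sum_(j < 4) j`!%:R^-1 * d j.
    by rewrite /T summxE; apply: eq_bigr => j _; rewrite mxE.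
  have -> : \sum_(j < 4) j`!%:R^-1 * d j = d 0%N + d 1%N + 2^-1 * d 2 + 6^-1 * d 3.
    move: d => d; rewrite !big_ord_recr big_ord0 /=.
    by rewrite add0r fact0 invr1 !mul1r.
  congr (_ + _ + _ * _ + _ * _).
  - rewrite /d [nseq _ _]/= (C1 [::] [::] isT : iter_derive [:: v h] g y = _).
    by rewrite summxE; apply: eq_bigr => t _; rewrite mxE.
  - rewrite /d [nseq _ _]/= (C1 [::] [:: v h] isT : iter_derive [:: v h; v h] g y = _).
    rewrite summxE; apply: eq_bigr => t _; rewrite mxE.
    rewrite (C1 [:: F t] [::] isT : iter_derive [:: F t; v h] g y = _).
    by rewrite summxE mulr_sumr; apply: eq_bigr => u _; rewrite mxE mulrA.
  - rewrite /d [nseq _ _]/=.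
    rewrite (C1 [::] [:: v h; v h] isT : iter_derive [:: v h; v h; v h] g y = _).
    rewrite summxE; apply: eq_bigr => t _; rewrite mxE.
    rewrite (C1 [:: F t] [:: v h] isT : iter_derive [:: F t; v h; v h] g y = _).
    rewrite summxE mulr_sumr; apply: eq_bigr => u _; rewrite mxE.
    rewrite (C1 [:: F t; F u] [::] isT : iter_derive [:: F t; F u; v h] g y = _).
    by rewrite summxE !mulr_sumr; apply: eq_bigr => w _; rewrite mxE !mulrA.
have Oc t n : (n <= tree_order t)%N -> bigOh n (c t).
  by move=> nt; apply: bigOhS nt _; exact: bigOh_tree_coef.
have Occ t u n : (n <= tree_order t + tree_order u)%N ->
    bigOh n (fun h => c t h * c u h * D [:: t; u]).
  move=> nt; apply: bigOhMr; last exact: bigOh_cst.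
  by apply: bigOhS nt _; apply: bigOhM; exact: bigOh_tree_coef.
have Occc t u w n : (n <= tree_order t + tree_order u + tree_order w)%N ->
    bigOh n (fun h => c t h * c u h * c w h * D [:: t; u; w]).
  move=> nt; apply: bigOhMr; last exact: bigOh_cst.
  by apply: bigOhS nt _; do 2 (apply: bigOhM; last exact: bigOh_tree_coef);
    exact: bigOh_tree_coef.
have tpos := @tree_order_gt0 N.
(* among the pairs and triples of trees, only those of total order at most 3
   are not O(h^4) *)
have O2 : bigOh 4 (fun h => S2 h -
  (B (ntrees1 N) (ntrees1 N) h + B (ntrees1 N) (ntrees2 N) h +
    B (ntrees2 N) (ntrees1 N) h)).
  under eq_fun do rewrite /B -big_split/=.
  apply: bigOh_trunc => t tE.
  - by apply: bigOh_trunc => u uE; rewrite ?subrr; [under eq_fun do rewrite subrr; exact: bigOh0..|]; apply: Occ; rewrite tE uE.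
  - apply: bigOh_trunc1 => u uE; first by under eq_fun do rewrite subrr; exact: bigOh0.
    by apply: Occ; rewrite tE; lia.
  - apply: bigOh_sum => u _; apply: Occ; have := tpos u; lia.
have O3 : bigOh 4 (fun h => S3 h -
  B3 h).
  rewrite /B3; apply: bigOh_trunc1 => t tE; last first.
    apply: bigOh_sum => u _; apply: bigOh_sum => w _; apply: Occc.
    by have := tpos u; have := tpos w; lia.
  apply: bigOh_trunc1 => u uE; last first.
    by apply: bigOh_sum => w _; apply: Occc; have := tpos w; lia.
  apply: bigOh_trunc1 => w wE; first by under eq_fun do rewrite subrr; exact: bigOh0.
  by apply: Occc; lia.
apply: (@bigOh_eq _ _ (fun h => (g (y + v h) 0 k - T h 0 k) +
   (2^-1 * (S2 h -
  (B (ntrees1 N) (ntrees1 N) h + B (ntrees1 N) (ntrees2 N) h +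
    B (ntrees2 N) (ntrees1 N) h))
  + 6^-1 * (S3 h -
  B3 h)))); last first.
  apply: bigOhD => //; apply: bigOhD; apply: bigOhMl => //; exact: bigOh_cst.
move=> h; rewrite TE big_forests_upto3.
have pw0 t : (planar_weight t)%:R != 0 :> R.
  by rewrite pnatr_eq0 -lt0n planar_weight_gt0.
have -> : forest_coef alpha [::] h * D [::] = g y 0 k.
  by rewrite /forest_coef/= expr0 invr1 !mul1r.
have -> : \sum_(t <- ntrees_upto3 N) forest_coef alpha [:: t] h * D [:: t] = S1 h.
  apply: eq_bigr => t _; congr (_ * _); rewrite /forest_coef /forest_order /forest_weight /c.
  by rewrite /tree_coef /= addn0 mulr1 muln1 mul1n.
have f2 l1 l2 : \sum_(t <- l1) \sum_(u <- l2) forest_coef alpha [:: t; u] h * D [:: t; u]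
    = 2^-1 * B l1 l2 h.
  rewrite mulr_sumr; apply: eq_bigr => t _; rewrite mulr_sumr; apply: eq_bigr => u _.
  rewrite /forest_coef /forest_order /forest_weight /c /tree_coef/=.
  rewrite addn0 exprD mulr1 muln1 !natrM/=.
  by field; rewrite !pw0.
have -> : \sum_(t <- ntrees1 N) \sum_(u <- ntrees1 N) \sum_(w <- ntrees1 N)
     forest_coef alpha [:: t; u; w] h * D [:: t; u; w] =
  6^-1 * B3 h.
  rewrite mulr_sumr; apply: eq_bigr => t _; rewrite mulr_sumr; apply: eq_bigr => u _.
  rewrite mulr_sumr; apply: eq_bigr => w _.
  rewrite /forest_coef /forest_order /forest_weight /c /tree_coef/=.
  rewrite addn0 !exprD mulr1 muln1 !natrM/=.
  by field; rewrite !pw0.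
rewrite (f2 (ntrees1 N) (ntrees1 N)) (f2 (ntrees1 N) (ntrees2 N)) (f2 (ntrees2 N) (ntrees1 N)).
by move: (B _ _ _) (B _ _ _) (B _ _ _) (B3 h) (S1 h) (S2 h) (S3 h) => *; ring.

Unshelve. all: by end_near. Qed.

End Composition.

Section PDSExpansion.
Variables (R : realType) (N : nat) (P : pds R N) (y : 'rV[R]_N).
Hypothesis y_gt0 : pos_orthant y.

Lemma open_pos_orthant : open (@pos_orthant R N).
Proof.
rewrite openE => z zA.
have H (k : 'I_N) : \forall w \near z, 0 < (w : 'rV[R]_N) 0 k.
  exact: (cvgr_gt _ (@coord_continuous R 1 N 0 k z) _ (zA k)).
exact: (filter_forall _ H).
Qed.

Lemma pos_nneg_orthant (z : 'rV[R]_N) : pos_orthant z -> nneg_orthant z.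
Proof. by move=> zA k; apply: ltW; exact: zA. Qed.

(** The bound that the notation for Lipschitz functions hides. *)
Lemma fsplit_lipschitz nu : exists L : R, forall z z' : 'rV[R]_N,
  nneg_orthant z -> nneg_orthant z' ->
  `|fsplit P nu z - fsplit P nu z'| <= L * `|z - z'|.
Proof.
have [M [Mr HM]] := @pds_lipschitz R N P nu.
exists (M + 1) => z z' z0 z'0; have := HM (M + 1) (ltr_pwDr ltr01 (lexx _)).
by move=> /(_ (z, z')); apply.
Qed.

Lemma cvg_pos_orthant (T : Type) (G : set_system T) (FG : Filter G) (u : T -> 'rV[R]_N) :
  u h @[h --> G] --> (0 : 'rV[R]_N) -> \forall h \near G, pos_orthant (y + u h).
Proof.
move=> u0; have Ay := near_open open_pos_orthant y_gt0.
exact: u0 _ ((nbhs0P _ _).1 Ay).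
Qed.

Variable alpha : ntree N -> R -> R.
Hypothesis alpha_bounded : forall t, bigOh 0 (alpha t).

Let F := elementary_differential P y.

(** The Lipschitz condition replaces the increment by its B-series.  An error
    of order [m <= 4] in the increment survives as such, whence the use in
    the bootstrap for the exact solution. *)
Lemma fsplit_nb_series nu k m (u : R -> 'rV[R]_N) : (m <= 4)%N ->
  (forall j, bigOh m (fun h => u h 0 j - nb_series F alpha (ntrees_upto3 N) h 0 j)) ->
  (\forall h \near 0^'+, nneg_orthant (y + u h)) ->
  bigOh m (fun h => fsplit P nu (y + u h) 0 k -
    \sum_(ts <- forests_upto3 N) forest_coef alpha ts h * F (Node nu ts) 0 k).
Proof.
move=> m4 Ou unneg; set v := nb_series _ _ _ in Ou.
have [L HL] := fsplit_lipschitz nu.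
apply: (@bigOh_eq _ _ (fun h => (fsplit P nu (y + u h) 0 k - fsplit P nu (y + v h) 0 k)
  + (fsplit P nu (y + v h) 0 k -
    \sum_(ts <- forests_upto3 N) forest_coef alpha ts h * F (Node nu ts) 0 k))).
  by move=> h; rewrite subrKA.
apply: bigOhD; last first.
  apply: bigOhS m4 _.
  exact: (taylor_nb_series F alpha_bounded k open_pos_orthant y_gt0
    (classCS (@pds_C5 R N P nu))).
apply: (@bigOh_le _ _ _ (fun h => `|L| * \sum_j `|u h 0 j - v h 0 j|)); last first.
  apply: bigOhMl; first exact: bigOh_cst.
  by apply: bigOh_sum => j _; exact: bigOh_norm.
have vpos := cvg_pos_orthant _ (nb_series_cvg0 F alpha_bounded (ntrees_upto3 N)).
near=> h.
have uh : nneg_orthant (y + u h) by near: h.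
have vh : nneg_orthant (y + v h).
  have vh' : pos_orthant (y + v h) by near: h; exact: vpos.
  exact: pos_nneg_orthant.
have -> : fsplit P nu (y + u h) 0 k - fsplit P nu (y + v h) 0 k =
  (fsplit P nu (y + u h) - fsplit P nu (y + v h)) 0 k by rewrite !mxE.
apply: le_trans (normr_coord _ k) _; apply: le_trans (HL _ _ uh vh) _.
rewrite [leRHS]ger0_norm ?mulr_ge0 ?sumr_ge0//.
apply: le_trans (ler_wpM2r (normr_ge0 _) (ler_norm L)) _; rewrite ler_wpM2l//.
apply: le_trans (normr_le_sum_coord _) _; apply: ler_sum => j _.
by rewrite !mxE opprD addrACA subrr add0r.
Unshelve. all: by end_near. Qed.

End PDSExpansion.

(** * Schemes of Runge-Kutta form *)

Section Antiderivative.
Variable R : realType.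

(** By the mean value theorem on [[0, h]]. *)
Lemma bigOh_antiderivative m (psi dpsi : R -> R) :
  psi 0 = 0 -> (\forall t \near (0 : R), is_derive (t : R) (1 : R) psi (dpsi t)) ->
  bigOh m dpsi -> bigOh m.+1 psi.
Proof.
move=> psi0 /nbhs_norm0P[r /= r0 Hr] [C OC].
have [e e0 He] : exists2 e : R, 0 < e & forall t, 0 < t < e -> `|dpsi t| <= C * t ^+ m.
  move: OC; rewrite near_withinE => /nbhs_norm0P[e /= e0 He].
  exists e => // t /andP[t0 te]; apply: He => //=; by rewrite ger0_norm// ltW.
exists `|C|; near=> h.
have h0 : 0 < h by near: h; exact: near0_gt0.
have hr : h < r by near: h; exact: near0_lt.
have he : h < e by near: h; exact: near0_lt.
have D (t : R) : 0 <= t <= h -> is_derive t 1 psi (dpsi t).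
  move=> /andP[t0 th]; apply: Hr => /=; rewrite ger0_norm//.
  exact: le_lt_trans hr.
have [c] : exists2 c, c \in `]0, h[%R & psi h - psi 0 = dpsi c * (h - 0).
  apply: (@MVT R psi dpsi 0 h h0).
    move=> t; rewrite in_itv/= => /andP[t0 th]; apply: D; by rewrite !ltW.
  apply: derivable_within_continuous => t; rewrite in_itv/= => t0h.
  by have [] := D t t0h.
rewrite in_itv/= => /andP[c0 ch]; rewrite psi0 !subr0 => ->.
rewrite normrM (ger0_norm (ltW h0)) exprSr mulrA ler_wpM2r// ?(ltW h0)//.
apply: le_trans (He c _) _; first by rewrite c0 (lt_trans ch).
apply: le_trans (ler_wpM2r (exprn_ge0 _ (ltW c0)) (ler_norm C)) _.
by rewrite ler_wpM2l// lerXn2r// ?nnegrE ?ltW.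
Unshelve. all: by end_near. Qed.

End Antiderivative.

Section Expansions.
Variables (R : realType) (N : nat) (P : pds R N) (y : 'rV[R]_N).
Hypothesis y_gt0 : pos_orthant y.
Let F := elementary_differential P y.

Lemma nb_series_upto4E alpha h k :
  nb_series F alpha (ntrees_upto4 N) h 0 k =
  \sum_(nu < N) \sum_(ts <- forests_upto3 N)
     tree_coef alpha (Node nu ts) h * F (Node nu ts) 0 k.
Proof.
rewrite /nb_series big_ntrees_upto4 summxE; apply: eq_bigr => nu _.
by rewrite summxE; apply: eq_bigr => ts _; rewrite mxE.
Qed.

Lemma nb_series_upto43 alpha k : (forall t, bigOh 0 (alpha t)) ->
  bigOh 4 (fun h => nb_series F alpha (ntrees_upto4 N) h 0 k -
                    nb_series F alpha (ntrees_upto3 N) h 0 k).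
Proof.
move=> Oalpha.
apply: (@bigOh_eq _ _ (fun h => \sum_(t <- ntrees4 N) tree_coef alpha t h * F t 0 k)).
  move=> h; have -> : ntrees_upto4 N = ntrees_upto3 N ++ ntrees4 N.
    by rewrite /ntrees_upto3 -(catA (ntrees1 N) _ (ntrees4 N)) -(catA (ntrees2 N)).
  rewrite /nb_series [in X in X - _]big_cat/= [in RHS]mxE [RHS]addrC addKr summxE.
  by apply: eq_bigr => t _; rewrite mxE.
apply: bigOh_sum_all (all_ntrees4 N) _ => t /eqP tE.
apply: bigOhMr; last exact: bigOh_cst.
by rewrite -tE; exact: bigOh_tree_coef.
Qed.

(** One row of a scheme of Runge-Kutta form.  The factor [h] in front of the
    right-hand side turns forests into trees and gains one order. *)
Lemma bigOh_rk_row (s : nat) (a : 'I_s -> R) (w : R -> 'I_N -> R)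
    (u : 'I_s -> R -> 'rV[R]_N) (z : R -> 'rV[R]_N)
    (alpha : 'I_s -> ntree N -> R -> R) (beta : ntree N -> R -> R) :
  (forall nu, bigOh 0 (fun h => w h nu)) ->
  (forall j t, bigOh 0 (alpha j t)) ->
  (forall j, a j != 0 -> forall k,
    bigOh 4 (fun h => u j h 0 k - nb_series F (alpha j) (ntrees_upto4 N) h 0 k)) ->
  (forall j, \forall h \near 0^'+, nneg_orthant (y + u j h)) ->
  (\forall h \near 0^'+, forall k, z h 0 k = h *
     \sum_(j < s) a j * \sum_(nu < N) w h nu * fsplit P nu (y + u j h) 0 k) ->
  (forall nu ts h, beta (Node nu ts) h =
     \sum_(j < s) a j * w h nu * foldr *%R 1 [seq alpha j t h | t <- ts]) ->
  forall k,
  bigOh 5 (fun h => z h 0 k - nb_series F beta (ntrees_upto4 N) h 0 k).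
Proof.
move=> Ow Oalpha Ou unneg zE betaE k.
apply: (@bigOh_near _ _ (fun h => h * \sum_(j < s) a j * \sum_(nu < N) w h nu *
  (fsplit P nu (y + u j h) 0 k -
    \sum_(ts <- forests_upto3 N) forest_coef (alpha j) ts h * F (Node nu ts) 0 k))).
  near=> h.
  have -> : z h 0 k = h *
     \sum_(j < s) a j * \sum_(nu < N) w h nu * fsplit P nu (y + u j h) 0 k.
    by move: (k); near: h.
  rewrite nb_series_upto4E.
  under eq_bigr do under eq_bigr do rewrite mulrBr.
  under eq_bigr do rewrite sumrB mulrBr.
  rewrite sumrB mulrBr; congr (_ - _).
  under eq_bigr do rewrite mulr_sumr.
  rewrite exchange_big/= mulr_sumr; apply: eq_bigr => nu _.
  under eq_bigr do rewrite mulr_sumr mulr_sumr.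
  rewrite exchange_big/= mulr_sumr; apply: eq_bigr => ts _.
  rewrite /tree_coef betaE /forest_coef -[planar_weight _]/(forest_weight ts).
  rewrite -[tree_order _]/(forest_order ts).+1 exprS.
  rewrite [LHS]mulr_sumr [in RHS]mulr_sumr !mulr_suml; apply: eq_bigr => j _; ring.
apply: (bigOhM (k := 1) (l := 4)); first exact: bigOh_id.
apply: bigOh_sum => j _.
have [->|aj] := eqVneq (a j) 0.
  by under eq_fun do rewrite mul0r; exact: bigOh0.
apply: bigOhMl; first exact: bigOh_cst.
apply: bigOh_sum => nu _; apply: bigOhMl => //.
apply: fsplit_nb_series => // i.
apply: (bigOh_eq _ (bigOhD (Ou j aj i) (nb_series_upto43 i (Oalpha j)))).
by move=> h; rewrite addrA subrK.
Unshelve. all: by end_near. Qed.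

Section Stages.
Variables (s : nat) (A : 'M[R]_s) (w : R -> 'I_s -> 'I_N -> R).
Hypothesis A_explicit : explicit_rk A.
Hypothesis w_bounded : forall i nu, bigOh 0 (fun h => w h i nu).

Lemma bigOh_foldr_mul (alpha : ntree N -> R -> R) ts :
  (forall t, bigOh 0 (alpha t)) ->
  bigOh 0 (fun h => foldr *%R 1 [seq alpha t h | t <- ts]).
Proof.
move=> Oalpha; elim: ts => [|t ts IH] /=; first exact: bigOh_cst.
exact: bigOhMr.
Qed.

Lemma stage_coef_bounded t i : bigOh 0 (fun h => stage_coef A (w h) t i).
Proof.
move: t i; fix IH 1; case=> nu ts i /=; apply: bigOh_sum => j _.
apply: bigOhMr; first by apply: bigOhMl => //; exact: bigOh_cst.
elim: ts => [|t ts IHts] /=; first exact: bigOh_cst.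
by apply: bigOhMr; [exact: IH|exact: IHts].
Qed.

Variable u : 'I_s -> R -> 'rV[R]_N.
Hypothesis u_nneg : forall j, \forall h \near 0^'+, nneg_orthant (y + u j h).
Hypothesis uE : forall i, \forall h \near 0^'+, forall k, u i h 0 k = h *
  \sum_(j < s) A i j * \sum_(nu < N) w h i nu * fsplit P nu (y + u j h) 0 k.

(** By induction on the stage: the row [i] of [A] only refers to the stages
    before it. *)
Lemma stage_expansion i k :
  bigOh 5 (fun h => u i h 0 k -
    nb_series F (fun t h => stage_coef A (w h) t i) (ntrees_upto4 N) h 0 k).
Proof.
have [n] := ubnP i; elim: n i k => // n IH i k; rewrite ltnS => ni.
apply: (bigOh_rk_row (a := A i) (w := fun h => w h i) (u := u)
  (alpha := fun j t h => stage_coef A (w h) t j)) => //.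
- by move=> j t; exact: stage_coef_bounded.
- move=> j Aij k'; apply: bigOhS (IH j k' _) => //; apply: leq_trans ni.
  by rewrite ltnNge; apply: contra Aij => ij; rewrite A_explicit.
Qed.

Lemma step_expansion (b : 'rV[R]_s) (w1 : R -> 'I_N -> R) (z : R -> 'rV[R]_N) k :
  (forall nu, bigOh 0 (fun h => w1 h nu)) ->
  (\forall h \near 0^'+, forall k, z h 0 k = h *
     \sum_(j < s) b 0 j * \sum_(nu < N) w1 h nu * fsplit P nu (y + u j h) 0 k) ->
  bigOh 5 (fun h => z h 0 k -
    nb_series F (fun t h => step_coef A b (w h) (w1 h) t) (ntrees_upto4 N) h 0 k).
Proof.
move=> Ow1 zE.
apply: (bigOh_rk_row (a := b 0) (w := w1) (u := u)
  (alpha := fun j t h => stage_coef A (w h) t j)) => //.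
- by move=> j t; exact: stage_coef_bounded.
- by move=> j _ k'; apply: bigOhS (stage_expansion j k').
Qed.

End Stages.
End Expansions.

(** * The exact solution *)

Section ExactSolution.
Variables (R : realType) (N : nat) (P : pds R N) (y : 'rV[R]_N).
Hypothesis y_gt0 : pos_orthant y.
Let F := elementary_differential P y.

Lemma is_derive_sum_seq (I : Type) (r : seq I) (f : I -> R -> R) (df : I -> R) (t : R) :
  (forall i, is_derive t (1 : R) (f i) (df i)) ->
  is_derive t (1 : R) (fun h => \sum_(i <- r) f i h) (\sum_(i <- r) df i).
Proof.
move=> D; elim: r => [|i r IH].
  by rewrite big_nil; under eq_fun do rewrite big_nil; exact: is_derive_cst.
by rewrite big_cons; under eq_fun do rewrite big_cons; exact: is_deriveD.
Qed.

Lemma rhsE z k : rhs P z 0 k = \sum_(nu < N) fsplit P nu z 0 k.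
Proof. by rewrite /rhs summxE. Qed.

Definition exact_coef (t : ntree N) (h : R) : R := (density t)%:R^-1.

Lemma exact_coef_bounded t : bigOh 0 (exact_coef t).
Proof. exact: bigOh_cst. Qed.

Lemma is_derive_tree_coef nu ts (t : R) : is_derive t (1 : R)
  (tree_coef exact_coef (Node nu ts)) (forest_coef exact_coef ts t).
Proof.
pose g : R := (foldr muln 1%N [seq density u | u <- ts])%:R^-1.
have gE : foldr *%R 1 [seq exact_coef u t | u <- ts] = g.
  by rewrite /g; elim: (ts) => [|u us IH] /=; rewrite ?invr1// natrM invfM IH.
have -> : tree_coef exact_coef (Node nu ts) = (((forest_order ts).+1%:R^-1 * g
    / (forest_weight ts)%:R) *: (fun h : R => h ^+ (forest_order ts).+1)).
  apply/funext => h; rewrite /tree_coef -mulrA mulrC; congr (_ / _ * _).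
  by rewrite /exact_coef [density _]/= natrM invfM.
have dX : is_derive t 1 (fun s : R => s ^+ (forest_order ts).+1)
    ((forest_order ts).+1%:R * t ^+ forest_order ts).
  apply: DeriveDef; first exact: exprn_derivable.
  by rewrite exp_derive /GRing.scale/= mulr1.
apply: is_derive_eq; rewrite /GRing.scale /forest_coef gE.
have n0 : (forest_order ts).+1%:R != 0 :> R by rewrite pnatr_eq0.
have fw0 : (forest_weight ts)%:R != 0 :> R.
  by rewrite pnatr_eq0 -lt0n (planar_weight_gt0 (Node nu ts)).
move: (forest_order ts).+1%:R n0 => n n0 /=.
by move: g {gE} => g; field; rewrite n0 fw0.
Qed.

Lemma exact_expansion (phi : R -> 'rV[R]_N) k :
  ivp_solution (rhs P) y phi ->
  bigOh 5 (fun h => phi h 0 k - y 0 k -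
    nb_series F exact_coef (ntrees_upto4 N) h 0 k).
Proof.
move=> [phi0 dphi]; pose u h := phi h - y.
have cphi : phi h @[h --> 0^'+] --> y.
  have [d0 _] := nbhs_singleton dphi; rewrite -phi0.
  exact/cvg_at_right_filter/differentiable_continuous/derivable1_diffP.
have cu : u h @[h --> 0^'+] --> (0 : 'rV[R]_N).
  by rewrite -(subrr y); apply: cvgB => //; exact: cvg_cst.
have unneg : \forall h \near 0^'+, nneg_orthant (y + u h).
  near=> h; apply: pos_nneg_orthant; near: h.
  exact: (cvg_pos_orthant y_gt0 _ cu).
(* a passage through the differential equation gains one order *)
have step m : (m <= 4)%N ->
    (forall k, bigOh m (fun h => u h 0 k - nb_series F exact_coef (ntrees_upto3 N) h 0 k)) ->
    forall k, bigOh m.+1 (fun h => u h 0 k - nb_series F exact_coef (ntrees_upto4 N) h 0 k).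
  move=> m4 Ou i; apply: (bigOh_antiderivative (dpsi := fun h =>
    \sum_(nu < N) (fsplit P nu (y + u h) 0 i -
      \sum_(ts <- forests_upto3 N) forest_coef exact_coef ts h * F (Node nu ts) 0 i))).
  - rewrite nb_series_upto4E /u phi0 subrr mxE sub0r big1 ?oppr0// => nu _.
    by rewrite big1// => ts _; rewrite /tree_coef/= expr0n/= !mul0r.
  - near=> t.
    have D : is_derive (t : R) (1 : R) phi (rhs P (phi t)) by near: t.
    under eq_fun do rewrite nb_series_upto4E; rewrite sumrB.
    apply: is_deriveB.
      have -> : \sum_nu fsplit P nu (y + u t) 0 i = rhs P (phi t) 0 i.
        by rewrite rhsE /u addrC subrK.
      under eq_fun do rewrite !mxE.
      rewrite -[X in is_derive _ _ _ X]subr0; apply: is_deriveB.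
        exact: is_derive_row_coord.
      exact: is_derive_cst.
    apply: is_derive_sum_seq => nu; apply: is_derive_sum_seq => ts.
    have -> : (fun h => tree_coef exact_coef (Node nu ts) h * F (Node nu ts) 0 i) =
        F (Node nu ts) 0 i *: tree_coef exact_coef (Node nu ts).
      by apply/funext => h; rewrite mulrC.
    rewrite mulrC; apply: is_deriveZ; exact: is_derive_tree_coef.
  - by apply: bigOh_sum => nu _; apply: fsplit_nb_series => // t; exact: exact_coef_bounded.
(* the trees of order 4 are within the error allowed at the next passage *)
have lower m : (m <= 4)%N ->
    (forall k, bigOh m (fun h => u h 0 k - nb_series F exact_coef (ntrees_upto4 N) h 0 k)) ->
    (forall k, bigOh m (fun h => u h 0 k - nb_series F exact_coef (ntrees_upto3 N) h 0 k)).
  move=> m4 Ou i.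
  apply: (bigOh_eq _ (bigOhD (Ou i) (bigOhS m4 (@nb_series_upto43 _ _ P y _ i exact_coef_bounded)))).
  by move=> h; rewrite addrA subrK.
have H m : (m <= 4)%N -> 
    forall k, bigOh m.+1 (fun h => u h 0 k - nb_series F exact_coef (ntrees_upto4 N) h 0 k).
  elim: m => [_|m IH m4]; apply: step => //; last by apply: lower => //; apply: IH; exact: ltnW.
  move=> i; apply: bigOhB.
    apply: (@bigOh_le _ _ _ (fun h => `|u h|)).
      by near=> h; rewrite normr_id; exact: normr_coord.
    by apply: (@cvg_bigOh0 _ _ `|0 : 'rV[R]_N|); exact: cvg_norm.
  apply: (@bigOh_le _ _ _ (fun h => `|nb_series F exact_coef (ntrees_upto3 N) h|)).
    by near=> h; rewrite normr_id; exact: normr_coord.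
  exact: bigOhS (bigOh_nb_series F exact_coef_bounded (ntrees_upto3 N)).
apply: (bigOh_eq _ (H 4 isT k)) => h.
by rewrite /u !mxE.
Unshelve. all: by end_near. Qed.

End ExactSolution.

(** * Patankar-weighted exchanges *)

Section Patankar.
Variables (R : realType) (N : nat).

(** A Patankar-weighted exchange keeps positivity: summed over the set where
    [y] is not positive, the internal exchanges cancel and the exchanges with
    the outside can only increase the sum. *)
Lemma exchange_gt0 (y0 y r : 'I_N -> R) (d : 'I_N -> 'I_N -> R) :
  (forall k, 0 < y0 k) -> (forall k nu, 0 <= d k nu) ->
  (forall k, (0 < r k) = (0 < y k)) ->
  (forall k, y k = y0 k + \sum_nu (d nu k * r nu - d k nu * r k)) ->
  forall k, 0 < y k.
Proof.
move=> y0_gt0 d_ge0 ry yE k; rewrite ltNge; apply/negP => yk.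
have S_le0 : \sum_(i | y i <= 0) y i <= 0 by apply: sumr_le0.
suff : 0 < \sum_(i | y i <= 0) y i by rewrite ltNge S_le0.
under eq_bigr do rewrite yE.
rewrite big_split/= ltr_pwDl//.
  by rewrite (bigD1 k)//= ltr_pwDl// sumr_ge0// => i _; rewrite ltW.
under eq_bigr do rewrite (bigID (fun nu => y nu <= 0))/=.
rewrite big_split/=.
have -> : \sum_(i | y i <= 0) \sum_(nu | y nu <= 0) (d nu i * r nu - d i nu * r i) = 0.
  under eq_bigr do rewrite sumrB.
  by rewrite sumrB exchange_big/= subrr.
rewrite add0r; apply: sumr_ge0 => i yi; apply: sumr_ge0 => nu; rewrite -ltNge => ynu.
rewrite subr_ge0 (@le_trans _ _ 0)//.
  by rewrite mulr_ge0_le0// leNgt ry -leNgt.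
by rewrite mulr_ge0// ltW// ry.
Qed.

Lemma exchange_sum (y0 y r : 'I_N -> R) (d : 'I_N -> 'I_N -> R) :
  (forall k, y k = y0 k + \sum_nu (d nu k * r nu - d k nu * r k)) ->
  \sum_k y k = \sum_k y0 k.
Proof.
move=> yE; under eq_bigr do rewrite yE; rewrite big_split/=.
under [X in _ + X]eq_bigr do rewrite sumrB.
by rewrite sumrB exchange_big/= subrr addr0.
Qed.

Variables (P : pds R N) (s : nat).

(** Thus the Patankar weights multiply the columns of the splitting, as the
    colours of the nodes do in the B-series. *)
Lemma patankarE (z y w : 'rV[R]_N) k : nneg_orthant z ->
  patankar P z y w k = \sum_(nu < N) (y 0 nu / w 0 nu) * fsplit P nu z 0 k.
Proof.
move=> z0; rewrite /patankar sumrB -mulr_suml.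
rewrite [RHS](bigD1 k)//= [X in X - _](bigD1 k)//= production_diag// mul0r add0r.
rewrite /fsplit /pd_split mxE eqxx mulrN addrC mulrC; congr (_ + _).
by apply: eq_bigr => nu nuk; rewrite mxE eq_sym (negbTE nuk) mulrC.
Qed.

(** Each stage, and the step, is an exchange between the species that starts
    from [y0]; positivity and conservation of mass follow. *)
Lemma patankar_row (Q : pred 'I_s) (a : 'I_s -> R) (z : 'I_s -> 'rV[R]_N)
    (h : R) (y0 y w : 'rV[R]_N) :
  0 <= h -> (forall j, 0 <= a j) -> (forall j, Q j -> nneg_orthant (z j)) ->
  pos_orthant y0 -> pos_orthant w ->
  (forall k, y 0 k = y0 0 k + h * \sum_(j | Q j) a j * patankar P (z j) y w k) ->
  pos_orthant y /\ \sum_k y 0 k = \sum_k y0 0 k.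
Proof.
move=> h0 a0 z0 y0_gt0 w_gt0 yE.
pose d k nu := h * \sum_(j | Q j) a j * destruction P (z j) k nu.
pose r nu := y 0 nu / w 0 nu.
have d_ge0 k nu : 0 <= d k nu.
  rewrite mulr_ge0// sumr_ge0// => j Qj; rewrite mulr_ge0// destruction_ge0//.
  exact: z0.
have {}yE k : y 0 k = y0 0 k + \sum_nu (d nu k * r nu - d k nu * r k).
  rewrite yE; congr (_ + _); rewrite mulr_sumr.
  under [RHS]eq_bigr => nu _ do rewrite -!mulrA !mulr_suml -mulrBr -sumrB mulr_sumr.
  rewrite exchange_big/=; apply: eq_bigr => j Qj.
  rewrite /patankar !mulr_sumr; apply: eq_bigr => nu _.
  rewrite pds_conservative; last exact: z0.
  by rewrite /r; ring.
split; last exact: exchange_sum yE.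
move=> k; apply: (exchange_gt0 _ d_ge0 _ yE) => i; first exact: y0_gt0.
by rewrite /r pmulr_lgt0// invr_gt0; exact: w_gt0.
Qed.

End Patankar.

Section Topology.
Variable R : realType.

Lemma within_continuous_cvg (T U : topologicalType) (D : set T) (f : T -> U)
    (c : R -> T) (x : T) :
  {within D, continuous f} -> D x -> c h @[h --> 0^'+] --> x ->
  (\forall h \near 0^'+, D (c h)) -> f (c h) @[h --> 0^'+] --> f x.
Proof.
move=> /subspace_continuousP cf Dx cx cD.
apply: cvg_comp (cf x Dx) => B wB.
have cB : \forall h \near 0^'+, D (c h) -> B (c h) := cx _ wB.
by apply: filterS2 cD cB => h Dch; exact.
Qed.

Lemma cvg_mx_entries m n (M : R -> 'M[R]_(m, n)) (M0 : 'M[R]_(m, n)) :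
  (forall i j, M h i j @[h --> 0^'+] --> M0 i j) -> M h @[h --> 0^'+] --> M0.
Proof.
move=> Mij; apply/cvgrPdist_le => e e0.
have H : \forall h \near 0^'+, forall ij : 'I_m * 'I_n,
    `|M0 ij.1 ij.2 - M h ij.1 ij.2| <= e.
  by apply: filter_forall => ij; move/cvgrPdist_le : (Mij ij.1 ij.2); exact.
near=> h; have Hh : forall ij : 'I_m * 'I_n, `|M0 ij.1 ij.2 - M h ij.1 ij.2| <= e.
  by near: h.
rewrite [leLHS]/Num.Def.normr/= mx_normrE; apply: bigmax_le; first exact: ltW.
by move=> ij _; rewrite !mxE.
Unshelve. all: by end_near. Qed.

End Topology.

(** * One step of the scheme *)

Section Scheme.
Variables (R : realType) (N s : nat) (P : pds R N).
Variables (A : 'M[R]_s) (b : 'rV[R]_s).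
Variables (pi : 'I_s -> denominator R N s) (sigma : denominator R N s).
Variables (yn : 'rV[R]_N) (Y : R -> 'M[R]_(s, N)) (y1 : R -> 'rV[R]_N).
Hypotheses (A_ge0 : forall i j, 0 <= A i j) (b_ge0 : forall j, 0 <= b 0 j).
Hypothesis A_explicit : explicit_rk A.
Hypotheses (pi_admissible : forall i, admissible (pi i))
  (sigma_admissible : admissible sigma).
Hypothesis pi_stages : forall i, uses_stages_below i (pi i).
Hypothesis yn_gt0 : pos_orthant yn.
Hypothesis mprk : forall h, 0 <= h -> mprk_step A b pi sigma P h yn (Y h) (y1 h).

Let dpi i h : 'rV[R]_N := pi i (h, yn, Y h).
Let dsigma h : 'rV[R]_N := sigma (h, yn, Y h).

(** The denominator of the stage [i] takes the same value at this matrix, all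
    rows of which are positive as soon as the stages before [i] are. *)
Let below i h : 'M[R]_(s, N) :=
  \matrix_(j, k) if (j < i)%N then Y h j k else yn 0 k.

Lemma dpi_below i h : dpi i h = pi i (h, yn, below i h).
Proof. by apply: pi_stages => j ji; apply/rowP => k; rewrite !mxE ji. Qed.

Lemma below_domain i h : 0 <= h ->
  (forall j : 'I_s, (j < i)%N -> pos_orthant (row j (Y h))) ->
  denominator_domain (h, yn, below i h).
Proof.
move=> h0 Ypos; split=> // j k; rewrite !mxE; case: ifP => ji; last exact: yn_gt0.
by have := Ypos j ji k; rewrite mxE.
Qed.

Lemma stage_mass h i : 0 <= h ->
  pos_orthant (row i (Y h)) /\ \sum_k row i (Y h) 0 k = \sum_k yn 0 k.
Proof.
move=> h0; have [n] := ubnP i; elim: n i => // n IH i; rewrite ltnS => ni.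
have Ypos (j : 'I_s) : (j < i)%N -> pos_orthant (row j (Y h)).
  by move=> ji; apply: (IH j _).1; exact: leq_trans ni.
apply: (patankar_row (P := P) (Q := fun j : 'I_s => (j < i)%N) (a := A i)
  (z := fun j => row j (Y h)) (w := dpi i h) h0 (A_ge0 i)) => //.
- by move=> j /Ypos; exact: pos_nneg_orthant.
- by rewrite dpi_below; apply: (pi_admissible i).1; exact: below_domain.
- by move=> k; rewrite mxE; have [-> _] := mprk h0.
Qed.

Lemma stage_gt0 h i : 0 <= h -> pos_orthant (row i (Y h)).
Proof. by move=> /(stage_mass i)[]. Qed.

Lemma stages_domain h : 0 <= h -> denominator_domain (h, yn, Y h).
Proof. by move=> h0; split=> // i; exact: stage_gt0. Qed.

Lemma dsigma_gt0 h : 0 <= h -> pos_orthant (dsigma h).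
Proof. by move=> h0; apply: sigma_admissible.1; exact: stages_domain. Qed.

Lemma step_mass h : 0 <= h ->
  pos_orthant (y1 h) /\ \sum_k y1 h 0 k = \sum_k yn 0 k.
Proof.
move=> h0.
apply: (patankar_row (P := P) (Q := xpredT) (a := b 0)
  (z := fun j => row j (Y h)) (w := dsigma h) h0 b_ge0) => //.
- by move=> j _; apply: pos_nneg_orthant; exact: stage_gt0.
- exact: dsigma_gt0.
- by move=> k; have [_ ->] := mprk h0.
Qed.

Definition stage_weight h i nu : R := Y h i nu / dpi i h 0 nu.
Definition step_weight h nu : R := y1 h 0 nu / dsigma h 0 nu.

Let u i h : 'rV[R]_N := row i (Y h) - yn.

Lemma add_uE h i : yn + u i h = row i (Y h).
Proof. by rewrite /u addrC subrK. Qed.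

Lemma stage_rkE h i k : 0 <= h -> u i h 0 k = h *
  \sum_(j < s) A i j * \sum_(nu < N) stage_weight h i nu * fsplit P nu (yn + u j h) 0 k.
Proof.
move=> h0; rewrite /u !mxE; have [-> _] := mprk h0; rewrite addrAC subrr add0r.
congr (h * _); rewrite [RHS](bigID (fun j : 'I_s => (j < i)%N))/= [X in _ = _ + X]big1.
  rewrite addr0; apply: eq_bigr => j ji; congr (_ * _).
  rewrite add_uE patankarE; last by apply: pos_nneg_orthant; exact: stage_gt0.
  by apply: eq_bigr => nu _; rewrite [row i _ _ _]mxE.
by move=> j; rewrite -leqNgt => ij; rewrite A_explicit// mul0r.
Qed.

Lemma step_rkE h k : 0 <= h -> (y1 h - yn) 0 k = h *
  \sum_(j < s) b 0 j * \sum_(nu < N) step_weight h nu * fsplit P nu (yn + u j h) 0 k.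
Proof.
move=> h0; rewrite !mxE; have [_ ->] := mprk h0; rewrite addrAC subrr add0r.
congr (h * _); apply: eq_bigr => j _; congr (_ * _).
by rewrite add_uE patankarE//; apply: pos_nneg_orthant; exact: stage_gt0.
Qed.

(** A positive vector is bounded by its mass. *)
Lemma mass_bounded (z : R -> 'rV[R]_N) k :
  (forall h, 0 <= h -> pos_orthant (z h) /\ \sum_k z h 0 k = \sum_k yn 0 k) ->
  bigOh 0 (fun h => z h 0 k).
Proof.
move=> zP; exists (\sum_k yn 0 k); near=> h; rewrite expr0 mulr1.
have h0 : 0 <= h by apply: ltW; near: h; exact: near0_gt0.
have [z0 <-] := zP h h0; rewrite ger0_norm; last by apply: ltW; exact: z0.
by rewrite (bigD1 k)//= lerDl sumr_ge0// => i _; apply: ltW; exact: z0.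
Unshelve. all: by end_near. Qed.

Lemma stage_bounded i k : bigOh 0 (fun h => Y h i k).
Proof.
apply: (bigOh_eq _ (mass_bounded k (fun h => @stage_mass h i))) => h.
by rewrite mxE.
Qed.

Lemma step_bounded k : bigOh 0 (fun h => y1 h 0 k).
Proof. exact: mass_bounded step_mass. Qed.

Lemma u_nneg j : \forall h \near 0^'+, nneg_orthant (yn + u j h).
Proof.
near=> h; have h0 : 0 <= h by apply: ltW; near: h; exact: near0_gt0.
by rewrite add_uE; apply: pos_nneg_orthant; exact: stage_gt0.
Unshelve. all: by end_near. Qed.

Lemma fsplit_bounded j nu k : bigOh 0 (fun h => fsplit P nu (yn + u j h) 0 k).
Proof.
have [L HL] := fsplit_lipschitz P nu.
apply: (@bigOh_le _ _ _ (fun h => `|L| * (\sum_i `|Y h j i - yn 0 i|) + `|fsplit P nu yn|)).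
  near=> h; rewrite [leRHS]ger0_norm ?addr_ge0 ?mulr_ge0 ?sumr_ge0//.
  have uh : nneg_orthant (yn + u j h) by near: h; exact: u_nneg.
  apply: le_trans (normr_coord _ k) _.
  rewrite -lerBlDr; apply: le_trans (lerB_dist _ _) _.
  apply: le_trans (HL _ _ uh (pos_nneg_orthant yn_gt0)) _.
  apply: le_trans (ler_wpM2r (normr_ge0 _) (ler_norm L)) _; rewrite ler_wpM2l//.
  apply: le_trans (normr_le_sum_coord _) _; apply: ler_sum => i _.
  by rewrite !mxE addrC addKr.
apply: bigOhD; last exact: bigOh_cst.
apply: bigOhMl; first exact: bigOh_cst.
apply: bigOh_sum => i _; apply: bigOh_norm; apply: bigOhB; last exact: bigOh_cst.
exact: stage_bounded.
Unshelve. all: by end_near. Qed.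

Let pi0 i : 'rV[R]_N := pi i (0, yn, \matrix_(j, k) yn 0 k).
Let sigma0 : 'rV[R]_N := sigma (0, yn, \matrix_(j, k) yn 0 k).

Lemma const_domain : denominator_domain (0, yn, \matrix_(j < s, k < N) yn 0 k).
Proof. by split=> //= i k; rewrite !mxE; exact: yn_gt0. Qed.

Lemma bigOh_rk (a : 'I_s -> R) (w : R -> 'I_N -> R) k :
  (forall nu, bigOh 0 (fun h => w h nu)) ->
  bigOh 1 (fun h => h * \sum_(j < s) a j *
    \sum_(nu < N) w h nu * fsplit P nu (yn + u j h) 0 k).
Proof.
move=> Ow; apply: bigOhMr; first exact: bigOh_id.
apply: bigOh_sum => j _; apply: bigOhMl; first exact: bigOh_cst.
by apply: bigOh_sum => nu _; apply: bigOhMr => //; exact: fsplit_bounded.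
Qed.

Lemma bigOh_quotient (z w : R -> R) (l : R) : 0 < l ->
  bigOh 0 z -> w h @[h --> 0^'+] --> l -> bigOh 0 (fun h => z h / w h).
Proof.
move=> l0 Oz wl; apply: bigOhMr => //; apply: cvg_bigOh0.
exact: cvgV (lt0r_neq0 l0) wl.
Qed.

Lemma denominator_cvg (g : denominator R N s) (M : R -> 'M[R]_(s, N)) k :
  admissible g ->
  (\forall h \near 0^'+, denominator_domain (h, yn, M h)) ->
  (forall i k, M h i k @[h --> 0^'+] --> yn 0 k) ->
  g (h, yn, M h) 0 k @[h --> 0^'+] --> g (0, yn, \matrix_(i, k) yn 0 k) 0 k.
Proof.
move=> [_ cg] MD Mcvg.
apply: (@cvg_comp _ _ _ (fun h => g (h, yn, M h)) (fun v => v 0 k)); last first.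
  exact: coord_continuous.
apply: (within_continuous_cvg cg const_domain) => //.
have c1 : h @[h --> 0^'+] --> (0 : R) by exact: cvg_at_right_filter.
have c2 : yn @[h --> (0 : R)^'+] --> yn by exact: cvg_cst.
have c3 : M h @[h --> 0^'+] --> (\matrix_(i, k) yn 0 k : 'M[R]_(s, N)).
  by apply: cvg_mx_entries => i j; rewrite mxE.
exact: (cvg_pair (cvg_pair c1 c2) c3).
Qed.

(** Both parts are proved together, by induction on the stage: the stages
    before [i] converge to [yn], so that the denominator converges to a
    positive limit by continuity, hence the weights of the stage [i] are
    bounded and the stage differs from [yn] by O(h). *)
Lemma stage_cvg i :
  (forall k, dpi i h 0 k @[h --> 0^'+] --> pi0 i 0 k) /\
  (forall k, bigOh 1 (fun h => Y h i k - yn 0 k)).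
Proof.
have [n] := ubnP i; elim: n i => // n IH i; rewrite ltnS => ni.
have cpi k : dpi i h 0 k @[h --> 0^'+] --> pi0 i 0 k.
  have -> : (fun h => dpi i h 0 k) = (fun h => pi i (h, yn, below i h) 0 k).
    by apply/funext => h; rewrite dpi_below.
  apply: denominator_cvg => //.
    near=> h; apply: below_domain => [|j _]; last apply: stage_gt0;
      by apply: ltW; near: h; exact: near0_gt0.
  move=> j l; have [ji|ij] := ltnP j i.
    apply: (bigOhB_cvg (ltn0Sn 0)).
    apply: (bigOh_eq _ ((IH j (leq_trans ji ni)).2 l)) => h.
    by rewrite mxE ji.
  under eq_fun do rewrite mxE ltnNge ij/=.
  exact: cvg_cst.
split=> // k.
apply: (@bigOh_near _ _ (fun h => h * \sum_(j < s) A i j *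
    \sum_(nu < N) stage_weight h i nu * fsplit P nu (yn + u j h) 0 k)).
  near=> h; have h0 : 0 <= h by apply: ltW; near: h; exact: near0_gt0.
  by rewrite -stage_rkE// !mxE.
apply: bigOh_rk => nu; apply: bigOh_quotient (cpi nu); last exact: stage_bounded.
apply: (pi_admissible i).1; exact: const_domain.
Unshelve. all: by end_near. Qed.

Lemma dpi_cvg i k : dpi i h 0 k @[h --> 0^'+] --> pi0 i 0 k.
Proof. exact: (stage_cvg i).1. Qed.

Lemma stage_O1 i k : bigOh 1 (fun h => Y h i k - yn 0 k).
Proof. exact: (stage_cvg i).2. Qed.

Lemma pi0_gt0 i k : 0 < pi0 i 0 k.
Proof. apply: (pi_admissible i).1; exact: const_domain. Qed.

Lemma sigma0_gt0 k : 0 < sigma0 0 k.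
Proof. apply: sigma_admissible.1; exact: const_domain. Qed.

Lemma dsigma_cvg k : dsigma h 0 k @[h --> 0^'+] --> sigma0 0 k.
Proof.
apply: denominator_cvg => //.
  near=> h; apply: stages_domain; apply: ltW; near: h; exact: near0_gt0.
by move=> i l; apply: (bigOhB_cvg (ltn0Sn 0)); exact: stage_O1.
Unshelve. all: by end_near. Qed.

Lemma stage_weight_bounded i nu : bigOh 0 (fun h => stage_weight h i nu).
Proof.
exact: (bigOh_quotient (pi0_gt0 i nu) (stage_bounded i nu) (@dpi_cvg i nu)).
Qed.

Lemma step_weight_bounded nu : bigOh 0 (fun h => step_weight h nu).
Proof.
exact: (bigOh_quotient (sigma0_gt0 nu) (step_bounded nu) (@dsigma_cvg nu)).
Qed.

Lemma step_O1 k : bigOh 1 (fun h => y1 h 0 k - yn 0 k).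
Proof.
apply: (@bigOh_near _ _ (fun h => h * \sum_(j < s) b 0 j *
    \sum_(nu < N) step_weight h nu * fsplit P nu (yn + u j h) 0 k)).
  near=> h; have h0 : 0 <= h by apply: ltW; near: h; exact: near0_gt0.
  by rewrite -step_rkE// !mxE.
by apply: bigOh_rk => nu; exact: step_weight_bounded.
Unshelve. all: by end_near. Qed.

Let F := elementary_differential P yn.

Lemma stage_nb_series i k : bigOh 5 (fun h => Y h i k - yn 0 k -
  nb_series F (fun t h => stage_coef A (stage_weight h) t i) (ntrees_upto4 N) h 0 k).
Proof.
apply: (bigOh_eq _ (stage_expansion yn_gt0 A_explicit stage_weight_bounded u_nneg _ i k)).
  by move=> h; rewrite /u !mxE.
move=> j; near=> h => l; apply: stage_rkE; apply: ltW; near: h; exact: near0_gt0.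
Unshelve. all: by end_near. Qed.

Lemma step_nb_series k : bigOh 5 (fun h => y1 h 0 k - yn 0 k -
  nb_series F (fun t h => step_coef A b (stage_weight h) (step_weight h) t)
    (ntrees_upto4 N) h 0 k).
Proof.
apply: (bigOh_eq _ (step_expansion yn_gt0 A_explicit stage_weight_bounded u_nneg _
  k step_weight_bounded (z := fun h => y1 h - yn) _)).
- by move=> h; rewrite !mxE.
- move=> j; near=> h => l; apply: stage_rkE; apply: ltW; near: h; exact: near0_gt0.
- near=> h => l; apply: step_rkE; apply: ltW; near: h; exact: near0_gt0.
Unshelve. all: by end_near. Qed.

End Scheme.

(** * The order conditions of a Runge-Kutta scheme *)

Section OrderConditions.
Variable R : realType.

Definition order4_conditions (s : nat) (A : 'M[R]_s) (b : 'rV[R]_s) : Prop :=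
  let c i := \sum_(j < s) A i j in
  [/\ \sum_(i < s) b 0 i = 1, \sum_(i < s) b 0 i * c i = 2^-1,
      \sum_(i < s) b 0 i * c i ^+ 2 = 3^-1 &
      \sum_(i < s) b 0 i * (\sum_(j < s) A i j * c j) = 6^-1] /\
  [/\ \sum_(i < s) b 0 i * c i ^+ 3 = 4^-1,
      \sum_(i < s) b 0 i * (c i * \sum_(j < s) A i j * c j) = 8^-1,
      \sum_(i < s) b 0 i * (\sum_(j < s) A i j * c j ^+ 2) = 12^-1 &
      \sum_(i < s) b 0 i * (\sum_(j < s) A i j * \sum_(l < s) A j l * c l) = 24^-1].

Section PolynomialFunctions.
Variable d : nat.

(** A class of functions that is stable under directional derivatives, which
    makes its members smooth. *)
Inductive polyfun : ('rV[R]_d -> R) -> Prop :=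
| polyfun_cst a : polyfun (fun=> a)
| polyfun_coord i : polyfun (fun x => x 0 i)
| polyfun_add f g : polyfun f -> polyfun g -> polyfun (fun x => f x + g x)
| polyfun_mul f g : polyfun f -> polyfun g -> polyfun (fun x => f x * g x).

Lemma polyfun_differentiable f x : polyfun f -> differentiable f x.
Proof.
elim=> {f} [a|i|f g _ df _ dg|f g _ df _ dg].
- exact: differentiable_cst.
- exact: differentiable_coord.
- exact: differentiableD.
- exact: differentiableM.
Qed.

Lemma polyfun_derive f v : polyfun f -> polyfun (fun x => 'D_v f x).
Proof.
elim=> {f} [a|i|f g pf IHf pg IHg|f g pf IHf pg IHg].
- under eq_fun do rewrite derive_cst; exact: polyfun_cst.
- have -> : (fun x : 'rV[R]_d => 'D_v (fun x : 'rV[R]_d => x 0 i : R) x) = (fun=> v 0 i).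
    apply/funext => x.
    have did : derivable (id : 'rV[R]_d -> 'rV[R]_d) x v by exact: derivable_id.
    have /(congr1 (fun M : 'rV[R]_d => M 0 i)) := derive_mx did.
    by rewrite (derive_id x v) [in RHS]mxE => ->.
  exact: polyfun_cst.
- have -> : (fun x => 'D_v (fun x => f x + g x) x) = (fun x => 'D_v f x + 'D_v g x).
    by apply/funext => x; rewrite deriveD//; apply: diff_derivable;
      exact: polyfun_differentiable.
  exact: polyfun_add.
- have -> : (fun x => 'D_v (fun x => f x * g x) x) =
      (fun x => f x * 'D_v g x + g x * 'D_v f x).
    by apply/funext => x; rewrite deriveM//; apply: diff_derivable;
      exact: polyfun_differentiable.
  by apply: polyfun_add; exact: polyfun_mul.
Qed.

Lemma polyfun_classC m n (f : 'rV[R]_d -> 'rV[R]_m) :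
  (forall k, polyfun (fun x => f x 0 k)) -> classC n setT f.
Proof.
have df (g : 'rV[R]_d -> 'rV[R]_m) x :
    (forall k, polyfun (fun x => g x 0 k)) -> differentiable g x.
  move=> pg; have -> : g = \sum_(k < m) (fun x => g x 0 k *: delta_mx 0 k).
    by apply/funext => z; rewrite {1}(row_sum_delta (g z)) fct_sumE.
  apply: differentiable_sum => k; apply: differentiableZl.
  exact: polyfun_differentiable.
elim: n f => [|n IH] f pf.
  by move=> x _; apply: differentiable_continuous; exact: df.
split=> [x _|v]; first exact: df.
apply: IH => k.
have -> : (fun x => 'D_v f x 0 k) = (fun x => 'D_v (fun z => f z 0 k) x).
  apply/funext => x; rewrite derive_mx ?mxE//.
  by apply: diff_derivable; exact: df.
exact: polyfun_derive.
Qed.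

End PolynomialFunctions.

(** The components of the following system, started at 0, are proportional to
    the powers of the time, and one component probes each tree of order at
    most 4. *)
Definition probe_seq (x : nat -> R) : seq R :=
  [:: 1; x 0%N; x 0%N * x 0%N; x 1%N; x 0%N * (x 0%N * x 0%N); x 0%N * x 1%N;
      x 2%N; x 3%N].

Definition probe (x : 'rV[R]_8) : 'rV[R]_8 :=
  \row_k nth 0 (probe_seq (fun i => x 0 (inord i))) k.

Definition probe_solution_seq (t : R) : seq R :=
  [:: t; t ^+ 2 / 2; t ^+ 3 / 3; t ^+ 3 / 6; t ^+ 4 / 4; t ^+ 4 / 8;
      t ^+ 4 / 12; t ^+ 4 / 24].

Definition probe_solution (t : R) : 'rV[R]_8 := \row_k nth 0 (probe_solution_seq t) k.

Lemma probe_classC n : classC n setT probe.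
Proof.
apply: polyfun_classC => k.
have -> : (fun x => probe x 0 k) =
    (fun x => nth 0 (probe_seq (fun i => x 0 (inord i))) k).
  by apply/funext => x; rewrite mxE.
have pX i : polyfun (fun x : 'rV[R]_8 => x 0 (inord i)) by exact: polyfun_coord.
case: k => -[|[|[|[|[|[|[|[|//]]]]]]]] _ /=; first exact: polyfun_cst.
all: by repeat apply: polyfun_mul.
Qed.

Lemma probe_solutionP : ivp_solution probe 0 probe_solution.
Proof.
split.
  apply/rowP => -[k hk]; rewrite !mxE/=.
  by move: k hk => [|[|[|[|[|[|[|[|//]]]]]]]] _ /=; rewrite ?expr0n/= ?mul0r.
near=> t.
have dX n (a : R) : is_derive t (1 : R) (fun s : R => s ^+ n.+1 / a) (n.+1%:R * t ^+ n / a).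
  have -> : (fun s : R => s ^+ n.+1 / a) = a^-1 *: (fun s : R => s ^+ n.+1).
    by apply/funext => s; rewrite mulrC.
  have dX : is_derive t 1 (fun s : R => s ^+ n.+1) (n.+1%:R * t ^+ n).
    apply: DeriveDef; first exact: exprn_derivable.
    by rewrite exp_derive /GRing.scale/= mulr1.
  by apply: is_derive_eq; rewrite /GRing.scale/= mulrC.
have d1 : is_derive t (1 : R) (fun s : R => s) 1 by exact: is_derive_id.
have D k : is_derive t (1 : R) (fun s => probe_solution s 0 k) (probe (probe_solution t) 0 k).
  have -> : (fun s => probe_solution s 0 k) = (fun s => nth 0 (probe_solution_seq s) k).
    by apply/funext => s; rewrite mxE.
  rewrite mxE /probe_seq; do 4 rewrite [probe_solution t 0 _]mxE inordK//.
  case: k => -[|[|[|[|[|[|[|[|//]]]]]]]] _ /=; rewrite ?nth0/= //;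
   by apply: is_derive_eq; field.
apply: DeriveDef; first by apply/derivable_mxP => i j; rewrite ord1; case: (D j).
rewrite derive_mx; last by apply/derivable_mxP => i j; rewrite ord1; case: (D j).
by apply/rowP => k; rewrite mxE; have [_ ->] := D k.
Unshelve. all: by end_near. Qed.

Lemma bigOh_cst_eq0 k (a : R) : (0 < k)%N -> bigOh k (fun=> a) -> a = 0.
Proof. by move=> k0 Oa; apply: (bigOh_cvg0B k0 Oa); exact: cvg_cst. Qed.

Lemma order4_conditionsP (s : nat) (A : 'M[R]_s) (b : 'rV[R]_s) :
  rk_order_at_least 4 A b -> order4_conditions A b.
Proof.
move=> rk4; pose c i := \sum_(j < s) A i j.
pose Ac i := \sum_(j < s) A i j * c j.
pose Ac2 i := \sum_(j < s) A i j * c j ^+ 2.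
pose AAc i := \sum_(j < s) A i j * Ac j.
pose Xseq h i := [:: h * c i; h ^+ 2 * Ac i; h ^+ 3 * Ac2 i; h ^+ 3 * AAc i;
   h ^+ 4 * \sum_(j < s) A i j * c j ^+ 3;
   h ^+ 4 * \sum_(j < s) A i j * (c j * Ac j);
   h ^+ 4 * \sum_(j < s) A i j * Ac2 j; h ^+ 4 * \sum_(j < s) A i j * AAc j].
pose X h i : 'rV[R]_8 := \row_k nth 0 (Xseq h i) k.
have fX h j k : probe (X h j) 0 k = nth 0 [:: 1; h * c j; (h * c j) * (h * c j);
    h ^+ 2 * Ac j; (h * c j) * ((h * c j) * (h * c j)); (h * c j) * (h ^+ 2 * Ac j); h ^+ 3 * Ac2 j;
    h ^+ 3 * AAc j] k.
  by rewrite mxE /probe_seq; do 4 rewrite [X h j 0 _]mxE inordK//.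
have XE h i : X h i = 0 + h *: \sum_(j < s) A i j *: probe (X h j).
  apply/rowP => k; rewrite add0r !mxE summxE.
  under eq_bigr do rewrite mxE fX.
  rewrite mulr_sumr; case: k => -[|[|[|[|[|[|[|[|//]]]]]]]] _ /=;
   rewrite mulr_sumr; apply: eq_bigr => j _; ring.
pose err (k : 'I_8) h := (0 + h *: \sum_(j < s) b 0 j *: probe (X h j)) 0 k
    - probe_solution h 0 k.
have errE k h : err k h = h * (\sum_(j < s) b 0 j * nth 0 [:: 1; h * c j;
    (h * c j) * (h * c j); h ^+ 2 * Ac j; (h * c j) * ((h * c j) * (h * c j));
    (h * c j) * (h ^+ 2 * Ac j); h ^+ 3 * Ac2 j; h ^+ 3 * AAc j] k)
    - nth 0 (probe_solution_seq h) k.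
  rewrite /err add0r !mxE summxE; congr (_ * _ - _); apply: eq_bigr => j _.
  by rewrite mxE fX.
(* the error of a component is a constant times [h ^+ m] with [m <= 4], so
   that O(h^5) forces the constant to vanish *)
have fin (k : 'I_8) m n S (a : R) :
    (0 < n)%N -> (m + n)%N = 5%N -> (forall h, err k h = h ^+ m * (S - a)) -> S = a.
  move=> n0 mn errk; apply/eqP; rewrite -subr_eq0; apply/eqP.
  apply: (bigOh_cst_eq0 n0); apply: (@bigOh_expM_inv _ n m); rewrite mn.
  apply: (bigOh_eq errk); apply/bigOhP.
  exact: (rk4 8 probe 0 probe_solution X (probe_classC _) probe_solutionP XE).
have pull m (G : 'I_s -> R) (h : R) : \sum_(j < s) b 0 j * (h ^+ m * G j) =
    h ^+ m * \sum_(j < s) b 0 j * G j.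
  by rewrite mulr_sumr; apply: eq_bigr => j _; ring.
split; split.
- apply: (fin (@Ordinal 8 0 isT) 1%N 4%N) => // h; rewrite errE/=.
  by under eq_bigr do rewrite mulr1; ring.
- apply: (fin (@Ordinal 8 1 isT) 2%N 3%N) => // h; rewrite errE/=.
  have -> : \sum_(j < s) b 0 j * (h * c j) = h ^+ 1 * \sum_(j < s) b 0 j * c j.
    by rewrite -pull expr1.
  by field.
- apply: (fin (@Ordinal 8 2 isT) 3%N 2%N) => // h; rewrite errE/=.
  have -> : \sum_(j < s) b 0 j * (h * c j * (h * c j)) = h ^+ 2 * \sum_(j < s) b 0 j * c j ^+ 2.
    by rewrite -pull; apply: eq_bigr => j _; ring.
  by field.
- apply: (fin (@Ordinal 8 3 isT) 3%N 2%N) => // h; rewrite errE/= pull.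
  by rewrite /Ac; field.
- apply: (fin (@Ordinal 8 4 isT) 4%N 1%N) => // h; rewrite errE/=.
  have -> : \sum_(j < s) b 0 j * (h * c j * (h * c j * (h * c j))) =
      h ^+ 3 * \sum_(j < s) b 0 j * c j ^+ 3.
    by rewrite -pull; apply: eq_bigr => j _; ring.
  by field.
- apply: (fin (@Ordinal 8 5 isT) 4%N 1%N) => // h; rewrite errE/=.
  have -> : \sum_(j < s) b 0 j * (h * c j * (h ^+ 2 * Ac j)) =
      h ^+ 3 * \sum_(j < s) b 0 j * (c j * Ac j).
    by rewrite -pull; apply: eq_bigr => j _; ring.
  by rewrite /Ac; field.
- apply: (fin (@Ordinal 8 6 isT) 4%N 1%N) => // h; rewrite errE/= pull.
  by rewrite /Ac2; field.
- apply: (fin (@Ordinal 8 7 isT) 4%N 1%N) => // h; rewrite errE/= pull.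
  by rewrite /AAc /Ac; field.
Qed.

End OrderConditions.

(** * Explicit schemes with four stages *)

Section Butcher.
Variable R : realType.

Record kutta := Kutta {
  b1 : R; b2 : R; b3 : R; b4 : R;
  a21 : R; a31 : R; a32 : R; a41 : R; a42 : R; a43 : R }.

Definition c2 K := a21 K.
Definition c3 K := a31 K + a32 K.
Definition c4 K := a41 K + a42 K + a43 K.
(** [z_i] is the sum over [j] of [a_ij c_j]. *)
Definition z3 K := a32 K * c2 K.
Definition z4 K := a42 K * c2 K + a43 K * c3 K.

Record kutta_order4 (K : kutta) : Prop := KuttaOrder4 {
  cond1 : b1 K + b2 K + b3 K + b4 K = 1;
  cond21 : b2 K * c2 K + b3 K * c3 K + b4 K * c4 K = 2^-1;
  cond31 : b2 K * c2 K ^+ 2 + b3 K * c3 K ^+ 2 + b4 K * c4 K ^+ 2 = 3^-1;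
  cond32 : b3 K * z3 K + b4 K * z4 K = 6^-1;
  cond41 : b2 K * c2 K ^+ 3 + b3 K * c3 K ^+ 3 + b4 K * c4 K ^+ 3 = 4^-1;
  cond42 : b3 K * c3 K * z3 K + b4 K * c4 K * z4 K = 8^-1;
  cond43 : b3 K * (a32 K * c2 K ^+ 2) +
           b4 K * (a42 K * c2 K ^+ 2 + a43 K * c3 K ^+ 2) = 12^-1;
  cond44 : b4 K * (a43 K * z3 K) = 24^-1 }.

(** The determinant of the matrix with rows (c_i, c_i^2, z_i), i = 2, 3, 4. *)
Definition kutta_det K : R :=
  c2 K * (c3 K ^+ 2 * z4 K - c4 K ^+ 2 * z3 K)
  - c2 K ^+ 2 * (c3 K * z4 K - c4 K * z3 K).

(** Multiplied on the left by the rows (b_i), (b_i c_i) and (1, 0, 0), the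
    matrix becomes one whose entries the order conditions prescribe, and whose
    determinant is - c_2^2 / 144. *)
Lemma kutta_det_neq0 K : kutta_order4 K -> kutta_det K != 0.
Proof.
move=> [_ e21 e31 e32 e41 e42 _ e44].
have c20 : c2 K != 0.
  apply/eqP => c20; move/eqP: e44; rewrite /z3 c20 !mulr0 eq_sym invr_eq0.
  by rewrite pnatr_eq0.

have : b3 K * b4 K * (c4 K - c3 K) * kutta_det K =
  - (b2 K * c2 K + b3 K * c3 K + b4 K * c4 K) *
    ((b3 K * c3 K * z3 K + b4 K * c4 K * z4 K) * c2 K ^+ 2)
  + (b2 K * c2 K ^+ 2 + b3 K * c3 K ^+ 2 + b4 K * c4 K ^+ 2) *
    ((b3 K * c3 K * z3 K + b4 K * c4 K * z4 K) * c2 K)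
  + (b3 K * z3 K + b4 K * z4 K) *
    ((b2 K * c2 K ^+ 2 + b3 K * c3 K ^+ 2 + b4 K * c4 K ^+ 2) * c2 K ^+ 2
     - (b2 K * c2 K ^+ 3 + b3 K * c3 K ^+ 3 + b4 K * c4 K ^+ 3) * c2 K).
  rewrite /kutta_det; ring.
rewrite e21 e31 e32 e41 e42 => E; apply/eqP => d0; move: E; rewrite d0 mulr0.
move=> /esym/eqP; apply/negP.
have -> : - 2^-1 * (8^-1 * c2 K ^+ 2) + 3^-1 * (8^-1 * c2 K)
    + 6^-1 * (3^-1 * c2 K ^+ 2 - 4^-1 * c2 K) = - (144^-1 * c2 K ^+ 2) by field.
by rewrite oppr_eq0 mulf_eq0 invr_eq0 pnatr_eq0 expf_eq0.
Qed.

(** Cramer's rule: the linear forms given by the columns of the matrix, times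
    its cofactors. *)
Lemma kutta_cramer K x2 x3 x4 :
  let l1 := x2 * c2 K + x3 * c3 K + x4 * c4 K in
  let l2 := x2 * c2 K ^+ 2 + x3 * c3 K ^+ 2 + x4 * c4 K ^+ 2 in
  let l3 := x3 * z3 K + x4 * z4 K in
  [/\ kutta_det K * x2 = l1 * (c3 K ^+ 2 * z4 K - c4 K ^+ 2 * z3 K)
        - l2 * (c3 K * z4 K - c4 K * z3 K)
        + l3 * (c3 K * c4 K ^+ 2 - c3 K ^+ 2 * c4 K),
      kutta_det K * x3 = - l1 * (c2 K ^+ 2 * z4 K) + l2 * (c2 K * z4 K)
        - l3 * (c2 K * c4 K ^+ 2 - c2 K ^+ 2 * c4 K) &
      kutta_det K * x4 = l1 * (c2 K ^+ 2 * z3 K) - l2 * (c2 K * z3 K)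
        + l3 * (c2 K * c3 K ^+ 2 - c2 K ^+ 2 * c3 K)].
Proof. by rewrite /kutta_det; split; ring. Qed.

(** The simplifying assumption D(1).  The order conditions say that its
    residual, as a row vector, annihilates the three columns of the matrix of
    determinant [kutta_det]. *)
Lemma kutta_D1 K : kutta_order4 K ->
  [/\ b3 K * a32 K + b4 K * a42 K = b2 K * (1 - c2 K),
      b4 K * a43 K = b3 K * (1 - c3 K) & b4 K * (1 - c4 K) = 0].
Proof.
move=> ordK; have d0 := kutta_det_neq0 ordK.
case: ordK => e1 e21 e31 e32 e41 e42 e43 e44.
set x2 := b3 K * a32 K + b4 K * a42 K - b2 K * (1 - c2 K).
set x3 := b4 K * a43 K - b3 K * (1 - c3 K).
set x4 := - (b4 K * (1 - c4 K)).
have [] := kutta_cramer K x2 x3 x4.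
have -> : x2 * c2 K + x3 * c3 K + x4 * c4 K = 0.
  transitivity ((b3 K * z3 K + b4 K * z4 K)
    - (b2 K * c2 K + b3 K * c3 K + b4 K * c4 K)
    + (b2 K * c2 K ^+ 2 + b3 K * c3 K ^+ 2 + b4 K * c4 K ^+ 2)).
    by rewrite /x2 /x3 /x4 /z3 /z4; ring.
  by rewrite e21 e31 e32; field.
have -> : x2 * c2 K ^+ 2 + x3 * c3 K ^+ 2 + x4 * c4 K ^+ 2 = 0.
  transitivity ((b3 K * (a32 K * c2 K ^+ 2) +
      b4 K * (a42 K * c2 K ^+ 2 + a43 K * c3 K ^+ 2))
    - (b2 K * c2 K ^+ 2 + b3 K * c3 K ^+ 2 + b4 K * c4 K ^+ 2)
    + (b2 K * c2 K ^+ 3 + b3 K * c3 K ^+ 3 + b4 K * c4 K ^+ 3)).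
    by rewrite /x2 /x3 /x4; ring.
  by rewrite e43 e31 e41; field.
have -> : x3 * z3 K + x4 * z4 K = 0.
  transitivity (b4 K * (a43 K * z3 K) - (b3 K * z3 K + b4 K * z4 K)
    + (b3 K * c3 K * z3 K + b4 K * c4 K * z4 K)).
    by rewrite /x3 /x4; ring.
  by rewrite e44 e32 e42; field.
rewrite oppr0 !mul0r subrr !addr0 subr0 => /eqP + /eqP + /eqP.
rewrite !mulf_eq0 (negbTE d0)/= => /eqP x20 /eqP x30 /eqP x40.
split; [exact: subr0_eq x20|exact: subr0_eq x30|].
by apply/eqP; rewrite -oppr_eq0; apply/eqP.
Qed.

Definition kutta_ge0 K : Prop :=
  [/\ 0 <= b2 K, 0 <= b3 K & 0 <= b4 K] /\
  [/\ 0 <= a21 K, 0 <= a31 K, 0 <= a32 K, 0 <= a42 K & 0 <= a43 K].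

(** The condition of the tallest tree makes [b4], [a43], [a32] and [c2]
    nonzero; D(1) propagates positivity to the other coefficients. *)
Lemma kutta_gt0 K : kutta_order4 K -> kutta_ge0 K ->
  [/\ 0 < b2 K, 0 < b3 K, 0 < b4 K, 0 < c2 K & 0 < c3 K] /\ c4 K = 1.
Proof.
move=> ordK [[b2_ge0 b3_ge0 b4_ge0] [a21_ge0 a31_ge0 a32_ge0 a42_ge0 a43_ge0]].
have [D2 D3 D4] := kutta_D1 ordK.
have e44 := cond44 ordK.
have : b4 K * (a43 K * (a32 K * c2 K)) != 0.
  by rewrite -/(z3 K) e44 invr_eq0 pnatr_eq0.
rewrite !mulf_eq0 !negb_or => /and4P[b4n a43n a32n c2n].
have b4_gt0 : 0 < b4 K by rewrite lt0r b4n.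
have a43_gt0 : 0 < a43 K by rewrite lt0r a43n.
have a32_gt0 : 0 < a32 K by rewrite lt0r a32n.
have c2_gt0 : 0 < c2 K by rewrite lt0r c2n.
have c3_gt0 : 0 < c3 K by rewrite /c3 ltr_wpDl.
have b3_gt0 : 0 < b3 K.
  rewrite lt0r b3_ge0 andbT; apply/eqP => b30.
  by move: D3; rewrite b30 mul0r => /eqP; rewrite mulf_eq0 (negbTE b4n) (negbTE a43n).
have b2_gt0 : 0 < b2 K.
  rewrite lt0r b2_ge0 andbT; apply/eqP => b20.
  move: D2; rewrite b20 mul0r => /eqP; apply/negP; rewrite gt_eqF//.
  by rewrite ltr_pwDl ?mulr_gt0// mulr_ge0.
split=> //; apply/eqP; rewrite eq_sym -subr_eq0.
by move/eqP: D4; rewrite mulf_eq0 (negbTE b4n).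
Qed.

(** Row [i] of the matrix is multiplied by [w_i]; the weights [b] are kept. *)
Definition kutta_scale K w2 w3 w4 : kutta :=
  Kutta (b1 K) (b2 K) (b3 K) (b4 K) (a21 K * w2) (a31 K * w3) (a32 K * w3)
    (a41 K * w4) (a42 K * w4) (a43 K * w4).

(** D(1) determines the rows of [A], from the last one upwards, in terms of
    the weights [b]; so no nontrivial scaling preserves the order 4. *)
Lemma kutta_scale_eq1 K w2 w3 w4 : kutta_order4 K -> kutta_ge0 K ->
  kutta_order4 (kutta_scale K w2 w3 w4) -> [/\ w2 = 1, w3 = 1 & w4 = 1].
Proof.
move=> ordK K0 ordKw; have [[b20 b30 b40 c20 c30] c41] := kutta_gt0 ordK K0.
have [D2 D3 _] := kutta_D1 ordK.
have [] := kutta_D1 ordKw.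
have -> : c2 (kutta_scale K w2 w3 w4) = c2 K * w2 by [].
have -> : c3 (kutta_scale K w2 w3 w4) = c3 K * w3 by rewrite /c3/= -mulrDl.
have -> : c4 (kutta_scale K w2 w3 w4) = c4 K * w4 by rewrite /c4/= -!mulrDl.
rewrite /= c41 mul1r => D2w D3w /eqP.
rewrite mulf_eq0 gt_eqF//= subr_eq0 => /eqP w41; subst w4.
have w31 : w3 = 1.
  have : b3 K * c3 K * (w3 - 1) = 0.
    transitivity (b4 K * a43 K - b3 K * (1 - c3 K * w3)); first by rewrite D3; ring.
    by rewrite -D3w mulr1 subrr.
  by move/eqP; rewrite !mulf_eq0 (gt_eqF b30) (gt_eqF c30)/= subr_eq0 => /eqP.
subst w3; split=> //.
have : b2 K * c2 K * (w2 - 1) = 0.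
  transitivity (b3 K * a32 K + b4 K * a42 K - b2 K * (1 - c2 K * w2)).
    by rewrite D2; ring.
  by rewrite -D2w !mulr1 subrr.
by move/eqP; rewrite !mulf_eq0 (gt_eqF b20) (gt_eqF c20)/= subr_eq0 => /eqP.
Qed.

Lemma le_quadratic (x2 x3 x4 k22 k33 k44 k32 k42 k43 : R) :
  `|k22 * x2 ^+ 2 + k33 * x3 ^+ 2 + k44 * x4 ^+ 2 + k32 * (x3 * x2)
    + k42 * (x4 * x2) + k43 * (x4 * x3)| <=
  (`|k22| + `|k33| + `|k44| + `|k32| + `|k42| + `|k43|) *
  (`|x2| + `|x3| + `|x4|) ^+ 2.
Proof.
set S := `|x2| + `|x3| + `|x4|.
have := normr_ge0 x2; have := normr_ge0 x3; have := normr_ge0 x4 => x4_ge0 x3_ge0 x2_ge0.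
have S2 : `|x2| <= S by rewrite /S; lra.
have S3 : `|x3| <= S by rewrite /S; lra.
have S4 : `|x4| <= S by rewrite /S; lra.
have SX x : `|x| <= S -> `|x ^+ 2| <= S ^+ 2.
  by move=> xS; rewrite normrX lerXn2r// nnegrE; exact: le_trans xS.
have SM x z : `|x| <= S -> `|z| <= S -> `|x * z| <= S ^+ 2.
  by move=> xS zS; rewrite normrM expr2 ler_pM.
have kM k x : `|x| <= S ^+ 2 -> `|k * x| <= `|k| * S ^+ 2.
  by move=> xS; rewrite normrM ler_wpM2l.
rewrite !mulrDl.
do 5 (apply: le_trans (ler_normD _ _) _; apply: lerD; last by apply: kM; auto).
by apply: kM; auto.
Qed.

(** Near w = 1 the order conditions of order 2 and 3 determine w up to
    second order: their linearization is the system of determinant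
    [kutta_det], and the quadratic remainder is absorbed. *)
Lemma kutta_scale_rate K (w2 w3 w4 : R -> R) :
  kutta_order4 K -> kutta_ge0 K ->
  w2 h @[h --> 0^'+] --> (1 : R) -> w3 h @[h --> 0^'+] --> (1 : R) ->
  w4 h @[h --> 0^'+] --> (1 : R) ->
  bigOh 2 (fun h => b2 K * (c2 K * w2 h) + b3 K * (c3 K * w3 h)
    + b4 K * (c4 K * w4 h) - 2^-1) ->
  bigOh 2 (fun h => b2 K * (c2 K * w2 h) ^+ 2 + b3 K * (c3 K * w3 h) ^+ 2
    + b4 K * (c4 K * w4 h) ^+ 2 - 3^-1) ->
  bigOh 2 (fun h => b3 K * w3 h * (a32 K * (c2 K * w2 h))
    + b4 K * w4 h * (a42 K * (c2 K * w2 h) + a43 K * (c3 K * w3 h)) - 6^-1) ->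
  [/\ bigOh 2 (fun h => w2 h - 1), bigOh 2 (fun h => w3 h - 1) &
      bigOh 2 (fun h => w4 h - 1)].
Proof.
move=> ordK K0 w21 w31 w41; set r1 := fun h => _ - 2^-1.
set r2 := fun h => _ - 3^-1; set r3 := fun h => _ - 6^-1 => O1 O2 O3.
have [[b20 b30 b40 c20 c30] c41] := kutta_gt0 ordK K0.
have det0 := kutta_det_neq0 ordK.
have [D2 D3 _] := kutta_D1 ordK.
case: ordK => _ e21 e31 e32 _ _ _ _.
pose x2 h := w2 h - 1; pose x3 h := w3 h - 1; pose x4 h := w4 h - 1.
(* the quadratic parts of the conditions, as functions of w - 1 *)
pose q2 h := (b2 K * c2 K ^+ 2 * x2 h ^+ 2 + b3 K * c3 K ^+ 2 * x3 h ^+ 2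
  + b4 K * c4 K ^+ 2 * x4 h ^+ 2) / 2.
pose q3 h := b3 K * a32 K * c2 K * (x3 h * x2 h) + b4 K * a42 K * c2 K * (x4 h * x2 h)
  + b4 K * a43 K * c3 K * (x4 h * x3 h).
have L1 h : b2 K * x2 h * c2 K + b3 K * x3 h * c3 K + b4 K * x4 h * c4 K = r1 h.
  by rewrite /r1 -e21 /x2 /x3 /x4; ring.
have L2 h : b2 K * x2 h * c2 K ^+ 2 + b3 K * x3 h * c3 K ^+ 2
    + b4 K * x4 h * c4 K ^+ 2 = r2 h / 2 - q2 h.
  by rewrite /r2 -e31 /q2 /x2 /x3 /x4; field.
have L3 h : b3 K * x3 h * z3 K + b4 K * x4 h * z4 K = r3 h - r1 h + r2 h / 2 - q2 h - q3 h.
  transitivity (r3 h - q3 h - ((b3 K * a32 K + b4 K * a42 K) * c2 K * x2 h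
    + b4 K * a43 K * c3 K * x3 h)).
    by rewrite /r3 -e32 /q3 /z3 /z4 /x2 /x3 /x4; ring.
  rewrite D2 D3.
  transitivity (r3 h - q3 h - (b2 K * x2 h * c2 K + b3 K * x3 h * c3 K + b4 K * x4 h * c4 K)
    + (b2 K * x2 h * c2 K ^+ 2 + b3 K * x3 h * c3 K ^+ 2 + b4 K * x4 h * c4 K ^+ 2)).
    by rewrite c41; ring.
  by rewrite L1 L2; ring.
pose g h := `|x2 h| + `|x3 h| + `|x4 h|.
have Q k2 k3 : exists C : R, forall h, `|k2 * q2 h + k3 * q3 h| <= C * g h ^+ 2.
  have := le_quadratic _ _ _ (k2 * (b2 K * c2 K ^+ 2) / 2) (k2 * (b3 K * c3 K ^+ 2) / 2)
    (k2 * (b4 K * c4 K ^+ 2) / 2) (k3 * (b3 K * a32 K * c2 K))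
    (k3 * (b4 K * a42 K * c2 K)) (k3 * (b4 K * a43 K * c3 K)).
  set C := (_ + _ + _ + _ + _ + _) => H; exists C => h.
  apply: le_trans (H (x2 h) (x3 h) (x4 h)); rewrite le_eqVlt; apply/orP; left.
  by apply/eqP; congr `|_|; rewrite /q2 /q3; field.
have lin (x : R -> R) (bb k1 k2 k3 : R) : bb != 0 ->
    (forall h, kutta_det K * (bb * x h) = r1 h * k1 + (r2 h / 2 - q2 h) * k2 +
      (r3 h - r1 h + r2 h / 2 - q2 h - q3 h) * k3) ->
    exists f C, bigOh 2 f /\ forall h, `|x h| <= f h + C * g h ^+ 2.
  move=> bb0 xE.
  pose m := (kutta_det K * bb)^-1.
  have [C HC] := Q (- m * (k2 + k3)) (- m * k3).
  pose rho h := m * (r1 h * k1 + r2 h / 2 * k2 + (r3 h - r1 h + r2 h / 2) * k3).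
  exists (fun h => `|rho h|), C; split.
    apply: bigOh_norm; apply: bigOhMl; first exact: bigOh_cst.
    have Or2 : bigOh 2 (fun h => r2 h / 2) by apply: bigOhMr => //; exact: bigOh_cst.
    apply: bigOhD; first apply: bigOhD; apply: bigOhMr; try exact: bigOh_cst => //.
    - exact: O1.
    - exact: Or2.
    - by apply: bigOhD => //; apply: bigOhB.
  move=> h; have -> : x h = rho h + (- m * (k2 + k3) * q2 h + - m * k3 * q3 h).
    have : x h = m * (kutta_det K * (bb * x h)).
      by rewrite /m [kutta_det K * (bb * _)]mulrA mulKf// mulf_neq0.
    by move=> ->; rewrite xE /rho; ring.
  by apply: le_trans (ler_normD _ _) _; rewrite lerD2l.
have Ccr h := kutta_cramer K (b2 K * x2 h) (b3 K * x3 h) (b4 K * x4 h).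
have [f2 [C2 [Of2 Hf2]]] := lin x2 (b2 K) (c3 K ^+ 2 * z4 K - c4 K ^+ 2 * z3 K)
  (- (c3 K * z4 K - c4 K * z3 K)) (c3 K * c4 K ^+ 2 - c3 K ^+ 2 * c4 K)
  (lt0r_neq0 b20) ltac:(by move=> h; have [-> _ _] := Ccr h; rewrite L1 L2 L3; ring).
have [f3 [C3 [Of3 Hf3]]] := lin x3 (b3 K) (- (c2 K ^+ 2 * z4 K)) (c2 K * z4 K)
  (- (c2 K * c4 K ^+ 2 - c2 K ^+ 2 * c4 K))
  (lt0r_neq0 b30) ltac:(by move=> h; have [_ -> _] := Ccr h; rewrite L1 L2 L3; ring).
have [f4 [C4 [Of4 Hf4]]] := lin x4 (b4 K) (c2 K ^+ 2 * z3 K) (- (c2 K * z3 K))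
  (c2 K * c3 K ^+ 2 - c2 K ^+ 2 * c3 K)
  (lt0r_neq0 b40) ltac:(by move=> h; have [_ _ ->] := Ccr h; rewrite L1 L2 L3; ring).
have Og : bigOh 2 g.
  apply: (@bigOh_absorb _ _ _ (C2 + C3 + C4)).
  - by move=> h; rewrite /g !addr_ge0.
  - have to0 (w : R -> R) : w h @[h --> 0^'+] --> (1 : R) ->
        `|w h - 1| @[h --> 0^'+] --> (0 : R).
      move=> w1; rewrite -[X in _ --> X](@normr0 _ R) -[X in `|X|](subrr (1 : R)).
      by apply: cvg_norm; apply: cvgB => //; exact: cvg_cst.
    rewrite -[X in _ --> X]addr0 -[X in _ --> X + _]addr0.
    by apply: cvgD; first apply: cvgD; exact: to0.
  - exists (fun h => f2 h + f3 h + f4 h); split; first by apply: bigOhD => //; apply: bigOhD.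
    near=> h; have -> : f2 h + f3 h + f4 h + (C2 + C3 + C4) * g h ^+ 2 =
      (f2 h + C2 * g h ^+ 2) + (f3 h + C3 * g h ^+ 2) + (f4 h + C4 * g h ^+ 2) by ring.
    by rewrite {1}/g; do 2 apply: lerD => //.
have g_ge0 h : 0 <= g h by rewrite /g !addr_ge0.
split; apply: bigOh_le Og; near=> h; rewrite [leRHS]ger0_norm//.
- by rewrite /g -addrA lerDl addr_ge0.
- by rewrite /g addrAC lerDr addr_ge0.
- by rewrite /g lerDr addr_ge0.
Unshelve. all: by end_near. Qed.

End Butcher.

(** * Restriction to trees of a single colour *)

Section FourStages.
Variable R : realType.

Definition stage1 : 'I_4 := @Ordinal 4 0 isT.
Definition stage2 : 'I_4 := @Ordinal 4 1 isT.
Definition stage3 : 'I_4 := @Ordinal 4 2 isT.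
Definition stage4 : 'I_4 := @Ordinal 4 3 isT.

Lemma sum4 (G : 'I_4 -> R) :
  \sum_(j < 4) G j = G stage1 + G stage2 + G stage3 + G stage4.
Proof.
rewrite !big_ord_recr big_ord0/= add0r.
by congr (G _ + G _ + G _ + G _); exact: val_inj.
Qed.

Lemma stageP (Q : 'I_4 -> Prop) :
  Q stage1 -> Q stage2 -> Q stage3 -> Q stage4 -> forall i, Q i.
Proof.
move=> Q1 Q2 Q3 Q4 [[|[|[|[|//]]]] i4].
- by rewrite (_ : Ordinal i4 = stage1)//; exact: val_inj.
- by rewrite (_ : Ordinal i4 = stage2)//; exact: val_inj.
- by rewrite (_ : Ordinal i4 = stage3)//; exact: val_inj.
- by rewrite (_ : Ordinal i4 = stage4)//; exact: val_inj.
Qed.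

Definition kutta_of (A : 'M[R]_4) (b : 'rV[R]_4) : kutta R :=
  Kutta (b 0 stage1) (b 0 stage2) (b 0 stage3) (b 0 stage4)
    (A stage2 stage1) (A stage3 stage1) (A stage3 stage2)
    (A stage4 stage1) (A stage4 stage2) (A stage4 stage3).

Variables (A : 'M[R]_4) (b : 'rV[R]_4).
Hypothesis A_explicit : explicit_rk A.
Let K := kutta_of A b.

Lemma explicit_rows (x : 'I_4 -> R) :
  [/\ \sum_(j < 4) A stage1 j * x j = 0,
      \sum_(j < 4) A stage2 j * x j = a21 K * x stage1,
      \sum_(j < 4) A stage3 j * x j = a31 K * x stage1 + a32 K * x stage2 &
      \sum_(j < 4) A stage4 j * x j =
        a41 K * x stage1 + a42 K * x stage2 + a43 K * x stage3].
Proof.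
have z (i j : 'I_4) : (i <= j)%N -> A i j = 0 by exact: A_explicit.
split; rewrite sum4.
- by rewrite (z stage1 stage1)// (z stage1 stage2)// (z stage1 stage3)//
    (z stage1 stage4)//; ring.
- by rewrite (z stage2 stage2)// (z stage2 stage3)// (z stage2 stage4)// /=; ring.
- by rewrite (z stage3 stage3)// (z stage3 stage4)// /=; ring.
- by rewrite (z stage4 stage4)// /=; ring.
Qed.

Lemma explicit_row_sums : [/\ \sum_(j < 4) A stage1 j = 0,
  \sum_(j < 4) A stage2 j = c2 K, \sum_(j < 4) A stage3 j = c3 K &
  \sum_(j < 4) A stage4 j = c4 K].
Proof.
have E i : \sum_(j < 4) A i j = \sum_(j < 4) A i j * 1.
  by apply: eq_bigr => j _; rewrite mulr1.
have [r1 r2 r3 r4] := explicit_rows (fun=> 1).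
by rewrite !E r1 r2 r3 r4 /c2 /c3 /c4 !mulr1.
Qed.

Lemma kutta_of_order4 : order4_conditions A b -> kutta_order4 K.
Proof.
move=> [[e1 e2 e31 e32] [e41 e42 e43 e44]].
have [s1 s2 s3 s4] := explicit_row_sums.
split.
- by rewrite -e1 sum4.
- by rewrite -e2 sum4 s1 s2 s3 s4 mulr0 add0r.
- by rewrite -e31 sum4 s1 s2 s3 s4 expr0n/= mulr0 add0r.
- rewrite -e32 sum4.
  have [-> -> -> ->] := explicit_rows (fun j => \sum_l A j l).
  by rewrite s1 s2 s3 /z3 /z4/=; ring.
- by rewrite -e41 sum4 s1 s2 s3 s4 expr0n/= mulr0 add0r.
- rewrite -e42 sum4.
  have [-> -> -> ->] := explicit_rows (fun j => \sum_l A j l).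
  by rewrite s1 s2 s3 s4 /z3 /z4/=; ring.
- rewrite -e43 sum4.
  have [-> -> -> ->] := explicit_rows (fun j => (\sum_l A j l) ^+ 2).
  by rewrite s1 s2 s3 expr0n/=; ring.
- rewrite -e44 sum4.
  have [-> -> -> ->] := explicit_rows (fun j => \sum_l A j l * \sum_m A l m).
  have [-> -> -> _] := explicit_rows (fun j => \sum_l A j l).
  by rewrite s1 s2 /z3/=; ring.
Qed.

Section Monochromatic.
Variables (N : nat) (wY : 'I_4 -> 'I_N -> R) (w1 : 'I_N -> R) (nu : 'I_N).

Let leaf : ntree N := Node nu [::].
Let Kw := kutta_scale K (wY stage2 nu) (wY stage3 nu) (wY stage4 nu).
Let step := step_coef A b wY w1.

Lemma stage_coef_rows ts : let x j := foldr *%R 1 [seq stage_coef A wY u j | u <- ts] in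
  [/\ stage_coef A wY (Node nu ts) stage1 = 0,
      stage_coef A wY (Node nu ts) stage2 = a21 Kw * x stage1,
      stage_coef A wY (Node nu ts) stage3 = a31 Kw * x stage1 + a32 Kw * x stage2 &
      stage_coef A wY (Node nu ts) stage4 =
        a41 Kw * x stage1 + a42 Kw * x stage2 + a43 Kw * x stage3].
Proof.
move=> x; have E i : stage_coef A wY (Node nu ts) i = wY i nu * \sum_j A i j * x j.
  by rewrite /= mulr_sumr; apply: eq_bigr => j _; rewrite /x; ring.
have [r1 r2 r3 r4] := explicit_rows x.
by rewrite !E r1 r2 r3 r4; split=> /=; ring.
Qed.

Lemma step_coefE ts : let x j := foldr *%R 1 [seq stage_coef A wY u j | u <- ts] in
  step (Node nu ts) = w1 nu * (b1 Kw * x stage1 + b2 Kw * x stage2 +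
    b3 Kw * x stage3 + b4 Kw * x stage4).
Proof. by move=> x; rewrite /step/= sum4 -/(x _) -/(x _) -/(x _) -/(x _); ring. Qed.

Let leaf_coef : [/\ stage_coef A wY leaf stage1 = 0,
  stage_coef A wY leaf stage2 = c2 Kw, stage_coef A wY leaf stage3 = c3 Kw &
  stage_coef A wY leaf stage4 = c4 Kw].
Proof.
have [r1 r2 r3 r4] := stage_coef_rows [::].
by rewrite /leaf r1 r2 r3 r4 /= !mulr1.
Qed.

(** On the trees with a single colour the scheme acts as the Runge-Kutta
    scheme with rows scaled by the weights. *)
Lemma step_coef_monochromatic :
  [/\ step leaf = w1 nu * (b1 Kw + b2 Kw + b3 Kw + b4 Kw),
      step (Node nu [:: leaf]) =
        w1 nu * (b2 Kw * c2 Kw + b3 Kw * c3 Kw + b4 Kw * c4 Kw),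
      step (Node nu [:: leaf; leaf]) =
        w1 nu * (b2 Kw * c2 Kw ^+ 2 + b3 Kw * c3 Kw ^+ 2 + b4 Kw * c4 Kw ^+ 2) &
      step (Node nu [:: Node nu [:: leaf]]) =
        w1 nu * (b3 Kw * z3 Kw + b4 Kw * z4 Kw)] /\
  [/\ step (Node nu [:: leaf; leaf; leaf]) =
        w1 nu * (b2 Kw * c2 Kw ^+ 3 + b3 Kw * c3 Kw ^+ 3 + b4 Kw * c4 Kw ^+ 3),
      step (Node nu [:: leaf; Node nu [:: leaf]]) =
        w1 nu * (b3 Kw * c3 Kw * z3 Kw + b4 Kw * c4 Kw * z4 Kw),
      step (Node nu [:: Node nu [:: leaf; leaf]]) =
        w1 nu * (b3 Kw * (a32 Kw * c2 Kw ^+ 2) +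
                 b4 Kw * (a42 Kw * c2 Kw ^+ 2 + a43 Kw * c3 Kw ^+ 2)) &
      step (Node nu [:: Node nu [:: Node nu [:: leaf]]]) =
        w1 nu * (b4 Kw * (a43 Kw * z3 Kw))].
Proof.
have [l1 l2 l3 l4] := leaf_coef.
pose prod ts j : R := foldr *%R 1 [seq stage_coef A wY u j | u <- ts].
have P1 u j : prod [:: u] j = stage_coef A wY u j by rewrite -[RHS]mulr1.
have P2 u v j : prod [:: u; v] j = stage_coef A wY u j * stage_coef A wY v j.
  by rewrite -[in RHS](P1 v).
have P3 u v w j : prod [:: u; v; w] j =
    stage_coef A wY u j * (stage_coef A wY v j * stage_coef A wY w j).
  by rewrite -[in RHS](P2 v w).
have stepE ts : step (Node nu ts) = w1 nu * (b1 Kw * prod ts stage1 +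
    b2 Kw * prod ts stage2 + b3 Kw * prod ts stage3 + b4 Kw * prod ts stage4).
  exact: step_coefE.
have rows ts : [/\ stage_coef A wY (Node nu ts) stage1 = 0,
      stage_coef A wY (Node nu ts) stage2 = a21 Kw * prod ts stage1,
      stage_coef A wY (Node nu ts) stage3 =
        a31 Kw * prod ts stage1 + a32 Kw * prod ts stage2 &
      stage_coef A wY (Node nu ts) stage4 =
        a41 Kw * prod ts stage1 + a42 Kw * prod ts stage2 + a43 Kw * prod ts stage3].
  exact: stage_coef_rows.
have [t1 t2 t3 t4] := rows [:: leaf].
have [d1 d2 d3 d4] := rows [:: leaf; leaf].
have [h1 h2 h3 h4] := rows [:: Node nu [:: leaf]].
rewrite !P1 l1 ?mulr0 ?add0r in t2 t3 t4.
rewrite !P2 l1 ?mulr0 ?mul0r ?add0r in d2 d3 d4.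
rewrite !P1 t1 ?t2 ?mulr0 ?mul0r ?add0r in h2 h3 h4.
split; split; rewrite stepE.
- by rewrite /prod/= !mulr1.
- by rewrite !P1 l1 l2 l3 l4 mulr0 add0r.
- by rewrite !P2 l1 l2 l3 l4 mulr0 mulr0 add0r !expr2.
- by rewrite !P1 t1 t2 t3 t4 l2 l3 /z3 /z4; ring.
- by rewrite !P3 l1 l2 l3 l4; ring.
- by rewrite !P2 t1 t2 t3 t4 l1 l2 l3 l4 /z3 /z4; ring.
- by rewrite !P1 d1 d2 d3 d4 l2 l3; ring.
- by rewrite !P1 h1 h2 h3 h4 t3 l2 /z3; ring.
Qed.

End Monochromatic.
End FourStages.

(** * Elementary weights near those of the Runge-Kutta scheme *)

Section SmallTrees.
Variable N : nat.
Implicit Types t u : ntree N.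

(** The shapes of the trees of each order, up to colours. *)
Lemma tree_order1P t : tree_order t = 1%N -> exists nu, t = Node nu [::].
Proof.
case: t => nu [|u ts] /=; first by exists nu.
by have := tree_order_gt0 u; lia.
Qed.

Lemma tree_order2P t : tree_order t = 2%N ->
  exists nu u, t = Node nu [:: u] /\ tree_order u = 1%N.
Proof.
case: t => nu [|u [|v ts]] //=; first by exists nu, u; split => //; lia.
by have := tree_order_gt0 u; have := tree_order_gt0 v; lia.
Qed.

Lemma tree_order3P t : tree_order t = 3%N ->
  (exists nu u, t = Node nu [:: u] /\ tree_order u = 2%N) \/
  (exists nu u v, [/\ t = Node nu [:: u; v], tree_order u = 1%N & tree_order v = 1%N]).
Proof.
case: t => nu [|u [|v [|w ts]]] //=.
- by left; exists nu, u; split => //; lia.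
- move=> uv; right; exists nu, u, v; have := tree_order_gt0 u; have := tree_order_gt0 v.
  by split=> //; lia.
- have := tree_order_gt0 u; have := tree_order_gt0 v; have := tree_order_gt0 w; lia.
Qed.

Lemma tree_order4P t : tree_order t = 4%N ->
  [\/ exists nu u, t = Node nu [:: u] /\ tree_order u = 3%N,
      exists nu u v, [/\ t = Node nu [:: u; v], tree_order u = 1%N & tree_order v = 2%N],
      exists nu u v, [/\ t = Node nu [:: u; v], tree_order u = 2%N & tree_order v = 1%N] |
      exists nu u v w, t = Node nu [:: u; v; w] /\
        [/\ tree_order u = 1%N, tree_order v = 1%N & tree_order w = 1%N]].
Proof.
case: t => nu [|u [|v [|w [|x ts]]]] //=.
- by constructor 1; exists nu, u; split => //; lia.
- move=> uv; have := tree_order_gt0 u; have := tree_order_gt0 v => v0 u0.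
  have [u1|u1] := eqVneq (tree_order u) 1%N.
    by constructor 2; exists nu, u, v; split => //; lia.
  by constructor 3; exists nu, u, v; move/eqP: u1 => u1; split => //; lia.
- move=> uvw; constructor 4; exists nu, u, v, w.
  have := tree_order_gt0 u; have := tree_order_gt0 v; have := tree_order_gt0 w.
  by split=> //; split; lia.
- have := tree_order_gt0 u; have := tree_order_gt0 v; have := tree_order_gt0 w.
  by have := tree_order_gt0 x; lia.
Qed.

Variables (R : realType) (s : nat) (A : 'M[R]_s) (b : 'rV[R]_s).
Hypothesis ord4 : order4_conditions A b.

Definition rk_stage_coef t i := stage_coef A (fun _ _ => 1) t i.
Definition rk_step_coef t := step_coef A b (fun _ _ => 1) (fun=> 1) t.

Let c i := \sum_(j < s) A i j.
Let Ac i := \sum_(j < s) A i j * c j.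

Lemma rk_stage_coefE nu ts i : rk_stage_coef (Node nu ts) i =
  \sum_(j < s) A i j * foldr *%R 1 [seq rk_stage_coef u j | u <- ts].
Proof. by apply: eq_bigr => j _; rewrite mulr1. Qed.

Lemma rk_step_coefE nu ts : rk_step_coef (Node nu ts) =
  \sum_(j < s) b 0 j * foldr *%R 1 [seq rk_stage_coef u j | u <- ts].
Proof. by apply: eq_bigr => j _; rewrite mulr1. Qed.

Lemma foldr_mul1 (x : R) : foldr *%R 1 [:: x] = x.
Proof. exact: mulr1. Qed.

Lemma foldr_mul2 (x y : R) : foldr *%R 1 [:: x; y] = x * y.
Proof. by rewrite -[in RHS](mulr1 y). Qed.

Lemma foldr_mul3 (x y z : R) : foldr *%R 1 [:: x; y; z] = x * (y * z).
Proof. by rewrite -[in RHS](mulr1 z). Qed.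

Lemma rk_stage_coef_node1 nu u i : rk_stage_coef (Node nu [:: u]) i =
  \sum_(j < s) A i j * rk_stage_coef u j.
Proof. by rewrite rk_stage_coefE; apply: eq_bigr => j _; congr (_ * _); exact: foldr_mul1. Qed.

Lemma rk_stage_coef_node2 nu u v i : rk_stage_coef (Node nu [:: u; v]) i =
  \sum_(j < s) A i j * (rk_stage_coef u j * rk_stage_coef v j).
Proof. by rewrite rk_stage_coefE; apply: eq_bigr => j _; congr (_ * _); exact: foldr_mul2. Qed.

Lemma rk_step_coef_node1 nu u : rk_step_coef (Node nu [:: u]) =
  \sum_(j < s) b 0 j * rk_stage_coef u j.
Proof. by rewrite rk_step_coefE; apply: eq_bigr => j _; congr (_ * _); exact: foldr_mul1. Qed.

Lemma rk_step_coef_node2 nu u v : rk_step_coef (Node nu [:: u; v]) =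
  \sum_(j < s) b 0 j * (rk_stage_coef u j * rk_stage_coef v j).
Proof. by rewrite rk_step_coefE; apply: eq_bigr => j _; congr (_ * _); exact: foldr_mul2. Qed.

Lemma rk_step_coef_node3 nu u v w : rk_step_coef (Node nu [:: u; v; w]) =
  \sum_(j < s) b 0 j * (rk_stage_coef u j * (rk_stage_coef v j * rk_stage_coef w j)).
Proof. by rewrite rk_step_coefE; apply: eq_bigr => j _; congr (_ * _); exact: foldr_mul3. Qed.

Lemma rk_stage_coef1 t i : tree_order t = 1%N -> rk_stage_coef t i = c i.
Proof.
move=> /tree_order1P[nu ->]; rewrite rk_stage_coefE.
by apply: eq_bigr => j _; rewrite mulr1.
Qed.

Lemma rk_stage_coef2 t i : tree_order t = 2%N -> rk_stage_coef t i = Ac i.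
Proof.
move=> /tree_order2P[nu [u [-> u1]]]; rewrite rk_stage_coef_node1.
by apply: eq_bigr => j _; rewrite rk_stage_coef1.
Qed.

Lemma density_node1 nu u :
  density (Node nu [:: u]) = ((tree_order u).+1 * density u)%N.
Proof. by rewrite -[in RHS](addn0 (tree_order u)) -[in RHS](muln1 (density u)). Qed.

Lemma density_node2 nu u v : density (Node nu [:: u; v]) =
  ((tree_order u + tree_order v).+1 * (density u * density v))%N.
Proof.
by rewrite -[in RHS](addn0 (tree_order v)) -[in RHS](muln1 (density v)).
Qed.

Lemma density_node3 nu u v w : density (Node nu [:: u; v; w]) =
  ((tree_order u + (tree_order v + tree_order w)).+1 *
   (density u * (density v * density w)))%N.
Proof.
by rewrite -[in RHS](addn0 (tree_order w)) -[in RHS](muln1 (density w)).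
Qed.

Lemma density1 t : tree_order t = 1%N -> density t = 1%N.
Proof. by move=> /tree_order1P[nu ->]. Qed.

Lemma density2 t : tree_order t = 2%N -> density t = 2%N.
Proof.
by move=> /tree_order2P[nu [u [-> u1]]]; rewrite density_node1 density1 ?u1.
Qed.

(** The order conditions do not see the colours, hence they give the
    elementary weights of all coloured trees. *)
Lemma rk_step_coefP t : (tree_order t <= 4)%N -> rk_step_coef t = (density t)%:R^-1.
Proof.
case: ord4 => [[e1 e2 e31 e32] [e41 e42 e43 e44]].
rewrite leq_eqVlt => /predU1P[|].
  move=> /tree_order4P[[nu [u [-> /tree_order3P[]]]]|||].
  - move=> [mu [v [-> v2]]]; rewrite rk_step_coef_node1 !density_node1 density2//.
    rewrite [tree_order _]/= v2 [(_ * _)%N](_ : _ = 24%N)// -e44.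
    apply: eq_bigr => j _; rewrite rk_stage_coef_node1; congr (_ * _).
    by apply: eq_bigr => l _; rewrite rk_stage_coef2.
  - move=> [mu [v [w [-> v1 w1]]]].
    rewrite rk_step_coef_node1 density_node1 density_node2 !density1//.
    rewrite [tree_order (Node _ _)]/= v1 w1 [(_ * _)%N](_ : _ = 12%N)// -e43.
    apply: eq_bigr => j _; rewrite rk_stage_coef_node2; congr (_ * _).
    by apply: eq_bigr => l _; rewrite !rk_stage_coef1// expr2.
  - move=> [nu [u [v [-> u1 v2]]]].
    rewrite rk_step_coef_node2 density_node2 u1 v2 density1// density2//.
    rewrite [(_ * _)%N](_ : _ = 8%N)// -e42; apply: eq_bigr => j _.
    by rewrite rk_stage_coef1// rk_stage_coef2.
  - move=> [nu [u [v [-> u2 v1]]]].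
    rewrite rk_step_coef_node2 density_node2 u2 v1 (density1 v1) density2//.
    rewrite [(_ * _)%N](_ : _ = 8%N)// -e42; apply: eq_bigr => j _.
    by rewrite (rk_stage_coef1 _ v1) rk_stage_coef2// [X in _ * X]mulrC.
  - move=> [nu [u [v [w [-> [u1 v1 w1]]]]]].
    rewrite rk_step_coef_node3 density_node3 u1 v1 w1 !density1//.
    rewrite [(_ * _)%N](_ : _ = 4%N)// -e41; apply: eq_bigr => j _.
    by rewrite !rk_stage_coef1// exprS expr2.
rewrite ltnS leq_eqVlt => /predU1P[/tree_order3P[]|].
- move=> [nu [u [-> u2]]]; rewrite rk_step_coef_node1 density_node1 u2 density2//.
  rewrite [(_ * _)%N](_ : _ = 6%N)// -e32; apply: eq_bigr => j _.
  by rewrite rk_stage_coef2.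
- move=> [nu [u [v [-> u1 v1]]]].
  rewrite rk_step_coef_node2 density_node2 u1 v1 !density1//.
  rewrite [(_ * _)%N](_ : _ = 3%N)// -e31; apply: eq_bigr => j _.
  by rewrite !rk_stage_coef1// expr2.
rewrite ltnS leq_eqVlt => /predU1P[/[dup] t2 /tree_order2P[nu [u [tE u1]]]|].
  rewrite density2// -e2 tE rk_step_coef_node1; apply: eq_bigr => j _.
  by rewrite rk_stage_coef1.
rewrite ltnS leq_eqVlt ltnNge tree_order_gt0 orbF => /eqP t1.
have [nu tE] := tree_order1P t1; rewrite density1// invr1 -e1 tE rk_step_coefE.
by apply: eq_bigr => j _; rewrite mulr1.
Qed.

End SmallTrees.

Section Perturbation.
Variables (R : realType) (N s : nat) (A : 'M[R]_s) (b : 'rV[R]_s).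
Variables (w : R -> 'I_s -> 'I_N -> R) (w1 : R -> 'I_N -> R).
Hypothesis A_explicit : explicit_rk A.
Hypothesis w_bounded : forall i nu, bigOh 0 (fun h => w h i nu).
Hypothesis w1_bounded : forall nu, bigOh 0 (fun h => w1 h nu).

Lemma bigOh_foldr_mulB k (al be : ntree N -> R -> R) ts :
  (forall t, bigOh 0 (al t)) -> (forall t, bigOh 0 (be t)) ->
  (forall t, bigOh k (fun h => al t h - be t h)) ->
  bigOh k (fun h => foldr *%R 1 [seq al t h | t <- ts] -
                    foldr *%R 1 [seq be t h | t <- ts]).
Proof.
move=> Oal Obe Oalbe; elim: ts => [|t ts IH] /=.
  by under eq_fun do rewrite subrr; exact: bigOh0.
apply: (@bigOh_eq _ _ (fun h => (al t h - be t h) * foldr *%R 1 [seq al t h | t <- ts] +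
   be t h * (foldr *%R 1 [seq al t h | t <- ts] - foldr *%R 1 [seq be t h | t <- ts]))).
  by move=> h; ring.
apply: bigOhD; last exact: bigOhMl.
by apply: bigOhMr => //; exact: bigOh_foldr_mul.
Qed.

(** The first row of an explicit scheme vanishes, so that only the weights of
    the other stages enter the elementary weights. *)
Lemma stage_coefB k t i :
  (forall (i : 'I_s) nu, (0 < i)%N -> bigOh k (fun h => w h i nu - 1)) ->
  bigOh k (fun h => stage_coef A (w h) t i - rk_stage_coef A t i).
Proof.
move=> Ow; move: t i; fix IH 1; case=> nu ts i.
have Ots j : bigOh k (fun h => foldr *%R 1 [seq stage_coef A (w h) u j | u <- ts] -
    foldr *%R 1 [seq rk_stage_coef A u j | u <- ts]).
  elim: ts => [|u ts IHts] /=.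
    by under eq_fun do rewrite subrr; exact: bigOh0.
  apply: (@bigOh_eq _ _ (fun h => (stage_coef A (w h) u j - rk_stage_coef A u j) *
      foldr *%R 1 [seq stage_coef A (w h) v j | v <- ts] +
    rk_stage_coef A u j * (foldr *%R 1 [seq stage_coef A (w h) v j | v <- ts] -
      foldr *%R 1 [seq rk_stage_coef A v j | v <- ts]))).
    by move=> h; ring.
  apply: bigOhD; last by apply: bigOhMl; [exact: bigOh_cst|exact: IHts].
  apply: bigOhMr; first exact: IH.
  apply: (bigOh_foldr_mul (alpha := fun v h => stage_coef A (w h) v j)) => v.
  exact: stage_coef_bounded.
apply: (@bigOh_eq _ _ (fun h => \sum_(j < s) A i j * ((w h i nu - 1) *
    foldr *%R 1 [seq stage_coef A (w h) u j | u <- ts] +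
    (foldr *%R 1 [seq stage_coef A (w h) u j | u <- ts] -
     foldr *%R 1 [seq rk_stage_coef A u j | u <- ts])))).
  by move=> h; rewrite rk_stage_coefE /= -sumrB; apply: eq_bigr => j _; ring.
apply: bigOh_sum => j _; have [i0|i0] := leqP i 0.
  rewrite A_explicit; last exact: leq_trans i0 _.
  by under eq_fun do rewrite mul0r; exact: bigOh0.
apply: bigOhMl; first exact: bigOh_cst.
apply: bigOhD => //; apply: bigOhMr; first exact: Ow.
apply: (bigOh_foldr_mul (alpha := fun v h => stage_coef A (w h) v j)) => v.
exact: stage_coef_bounded.
Qed.

Lemma step_coefB k t :
  (forall (i : 'I_s) nu, (0 < i)%N -> bigOh k (fun h => w h i nu - 1)) ->
  (forall nu, bigOh k (fun h => w1 h nu - 1)) ->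
  bigOh k (fun h => step_coef A b (w h) (w1 h) t - rk_step_coef A b t).
Proof.
case: t => nu ts Ow Ow1.
apply: (@bigOh_eq _ _ (fun h => \sum_(j < s) b 0 j * ((w1 h nu - 1) *
    foldr *%R 1 [seq stage_coef A (w h) u j | u <- ts] +
    (foldr *%R 1 [seq stage_coef A (w h) u j | u <- ts] -
     foldr *%R 1 [seq rk_stage_coef A u j | u <- ts])))).
  by move=> h; rewrite rk_step_coefE /= -sumrB; apply: eq_bigr => j _; ring.
apply: bigOh_sum => j _; apply: bigOhMl; first exact: bigOh_cst.
apply: bigOhD.
  apply: bigOhMr; first exact: Ow1.
  apply: (bigOh_foldr_mul (alpha := fun v h => stage_coef A (w h) v j)) => v.
  exact: stage_coef_bounded.
apply: (bigOh_foldr_mulB (al := fun v h => stage_coef A (w h) v j)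
   (be := fun v h => rk_stage_coef A v j)) => v.
- exact: stage_coef_bounded.
- exact: bigOh_cst.
- exact: stage_coefB.
Qed.

End Perturbation.

(** * Elementary differentials of the whole right-hand side *)

Section ElementarySums.
Variables (R : realType) (N : nat) (P : pds R N) (y : 'rV[R]_N).
Hypothesis y_gt0 : pos_orthant y.
Let F := elementary_differential P y.
Let f := rhs P y.

(** Together with linearity in the directions, this turns sums over the colours
    of the nodes into derivatives of the whole right-hand side. *)
Lemma iter_derive_rhs vs : (size vs <= 5)%N ->
  iter_derive vs (rhs P) y = \sum_nu iter_derive vs (fsplit P nu) y.
Proof.
move=> sz; exact: (iter_derive_sum (@open_pos_orthant R N) (g := fsplit P)
  (fun nu => classC_le sz (@pds_C5 R N P nu)) y_gt0).
Qed.

Lemma sum_ntrees1 : \sum_(t <- ntrees1 N) F t = f.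
Proof. by rewrite big_ntrees1. Qed.

Lemma sum_node1 (l : seq (ntree N)) :
  \sum_nu \sum_(t <- l) F (Node nu [:: t]) = Drhs P y (\sum_(t <- l) F t).
Proof.
rewrite -[RHS]/(iter_derive [:: _] (rhs P) y) iter_derive_rhs//.
apply: eq_bigr => nu _.
have := @iter_derive_slot_sum _ _ _ _ (@open_pos_orthant R N) [::] [::] _ l (fun=> 1) F
  (fsplit P nu) y (classC_le (isT : (1 <= 5)%N) (@pds_C5 R N P nu)) y_gt0.
rewrite /=; under eq_bigr do rewrite scale1r; move=> ->.
by apply: eq_bigr => t _; rewrite scale1r.
Qed.

Lemma sum_node2 (l l' : seq (ntree N)) :
  \sum_nu \sum_(t <- l) \sum_(u <- l') F (Node nu [:: t; u]) =
  D2rhs P y (\sum_(t <- l) F t) (\sum_(u <- l') F u).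
Proof.
rewrite -[RHS]/(iter_derive [:: _; _] (rhs P) y) iter_derive_rhs//.
apply: eq_bigr => nu _.
have C2 : classC 2 (@pos_orthant R N) (fsplit P nu).
  exact: classC_le (isT : (2 <= 5)%N) (@pds_C5 R N P nu).
have slot1 v := @iter_derive_slot_sum _ _ _ _ (@open_pos_orthant R N) [::] [:: v] _ l (fun=> 1) F
  (fsplit P nu) y C2 y_gt0.
have slot2 t := @iter_derive_slot_sum _ _ _ _ (@open_pos_orthant R N) [:: F t] [::] _ l' (fun=> 1) F
  (fsplit P nu) y C2 y_gt0.
have -> : \sum_(t <- l) F t = \sum_(t <- l) 1 *: F t.
  by apply: eq_bigr => t _; rewrite scale1r.
have -> : \sum_(t <- l') F t = \sum_(t <- l') 1 *: F t.
  by apply: eq_bigr => t _; rewrite scale1r.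
rewrite [RHS]slot1; apply: eq_bigr => t _; rewrite scale1r [RHS]slot2.
by apply: eq_bigr => u _; rewrite scale1r.
Qed.

Lemma sum_ntrees2 : \sum_(t <- ntrees2 N) F t = Drhs P y f.
Proof. by rewrite big_ntrees2 sum_node1 sum_ntrees1. Qed.

Lemma nb_seriesE alpha l h k :
  nb_series F alpha l h 0 k = \sum_(t <- l) tree_coef alpha t h * F t 0 k.
Proof. by rewrite /nb_series summxE; apply: eq_bigr => t _; rewrite mxE. Qed.

Lemma bigOh_order_sum alpha l n k : (forall t, bigOh 0 (alpha t)) ->
  all (fun t => tree_order t == n) l ->
  bigOh n (fun h => \sum_(t <- l) tree_coef alpha t h * F t 0 k).
Proof.
move=> Oalpha al; apply: bigOh_sum_all al _ => t /eqP tn.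
by apply: bigOhMr; [rewrite -tn; exact: bigOh_tree_coef|exact: bigOh_cst].
Qed.

Lemma nb_series_order2 (al : ntree N -> R -> R) (a1 a2 : R) h k :
  (forall t, tree_order t = 1%N -> al t h = a1) ->
  (forall t, tree_order t = 2%N -> al t h = a2) ->
  \sum_(t <- ntrees1 N) tree_coef al t h * F t 0 k +
  \sum_(t <- ntrees2 N) tree_coef al t h * F t 0 k =
  h * a1 * f 0 k + h ^+ 2 * a2 * Drhs P y f 0 k.
Proof.
move=> E1 E2; rewrite -sum_ntrees2 -[in RHS]sum_ntrees1 !summxE !mulr_sumr.
congr (_ + _).
  rewrite !big_ntrees1; apply: eq_bigr => nu _.
  by rewrite /tree_coef E1//= expr1 invr1 mulr1.
rewrite !big_ntrees2; apply: eq_bigr => nu _; rewrite !big_ntrees1.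
by apply: eq_bigr => mu _; rewrite /tree_coef E2//= invr1 mulr1.
Qed.

Lemma nb_series_rk_stage (s : nat) (A : 'M[R]_s) i k :
  bigOh 3 (fun h =>
    nb_series F (fun t _ => rk_stage_coef A t i) (ntrees_upto4 N) h 0 k -
    (h * (\sum_j A i j) * f 0 k +
     h ^+ 2 * (\sum_j A i j * \sum_l A j l) * Drhs P y f 0 k)).
Proof.
pose al (t : ntree N) (_ : R) := rk_stage_coef A t i.
have Oal t : bigOh 0 (al t) by exact: bigOh_cst.
apply: (@bigOh_eq _ _ (fun h => \sum_(t <- ntrees3 N) tree_coef al t h * F t 0 k +
    \sum_(t <- ntrees4 N) tree_coef al t h * F t 0 k)).
  move=> h; rewrite nb_seriesE big_ntrees_upto4_orders.
  rewrite (@nb_series_order2 al (\sum_j A i j) (\sum_j A i j * \sum_l A j l)).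
  - by rewrite [RHS]addrC -[X in _ = _ + X]addrA addKr.
  - by move=> t t1; rewrite /al rk_stage_coef1.
  - by move=> t t2; rewrite /al rk_stage_coef2.
apply: bigOhD; first exact: bigOh_order_sum (all_ntrees3 N).
by apply: bigOhS (bigOh_order_sum _ Oal (all_ntrees4 N)).
Qed.

Lemma taylor3_coord (v1 v2 v3 v3' : 'rV[R]_N) (h : R) k :
  h * 1 * v1 0 k + h ^+ 2 * 2^-1 * v2 0 k + h ^+ 3 / 6 * (v3 0 k + v3' 0 k) =
  (h *: v1 + (h ^+ 2 / 2) *: v2 + (h ^+ 3 / 6) *: (v3 + v3')) 0 k.
Proof. by rewrite !mxE; ring. Qed.

Lemma nb_series_exact k :
  bigOh 4 (fun h => nb_series F (@exact_coef R N) (ntrees_upto4 N) h 0 k -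
    (h *: f + (h ^+ 2 / 2) *: Drhs P y f +
     (h ^+ 3 / 6) *: (D2rhs P y f f + Drhs P y (Drhs P y f))) 0 k).
Proof.
apply: (@bigOh_eq _ _ (fun h =>
    \sum_(t <- ntrees4 N) tree_coef (@exact_coef R N) t h * F t 0 k)).
  move=> h; rewrite nb_seriesE big_ntrees_upto4_orders.
  set S4 := (X in _ = _ + X - _); set X := (X in _ = X + S4 - _).
  rewrite [RHS]addrAC; suff -> : X = (h *: f + (h ^+ 2 / 2) *: Drhs P y f +
     (h ^+ 3 / 6) *: (D2rhs P y f f + Drhs P y (Drhs P y f))) 0 k.
    by rewrite subrr add0r.
  rewrite {}/X {S4} (@nb_series_order2 _ 1 2^-1); last 2 first.
  - by move=> t t1; rewrite /exact_coef density1// invr1.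
  - by move=> t t2; rewrite /exact_coef density2.
  have -> : \sum_(t <- ntrees3 N) tree_coef (@exact_coef R N) t h * F t 0 k =
      h ^+ 3 / 6 * (D2rhs P y f f 0 k + Drhs P y (Drhs P y f) 0 k).
    rewrite -[X in D2rhs _ _ X]sum_ntrees1 -[X in D2rhs _ _ _ X]sum_ntrees1 -sum_node2.
    rewrite -[X in Drhs _ _ X]sum_ntrees2 -sum_node1 addrC !summxE -big_split/=.
    rewrite big_ntrees3 mulr_sumr; apply: eq_bigr => nu _.
    rewrite !summxE mulrDr !mulr_sumr; congr (_ + _).
      rewrite !big_ntrees2; apply: eq_bigr => mu _; rewrite !big_ntrees1.
      by apply: eq_bigr => ka _; rewrite /tree_coef /exact_coef/= invr1 mulr1.
    rewrite !big_ntrees1; apply: eq_bigr => mu _.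
    rewrite summxE mulr_sumr !big_ntrees1; apply: eq_bigr => ka _.
    rewrite /tree_coef /exact_coef; congr (_ * _).
    rewrite [tree_order _](_ : _ = 3%N)// [density _](_ : _ = 3%N)//.
    by rewrite [planar_weight _](_ : _ = 2%N)//; field.
  exact: taylor3_coord.
exact: bigOh_order_sum (@exact_coef_bounded R N) (all_ntrees4 N).
Qed.

(** Every tree has a root, which contributes one factor [h]. *)
Lemma nb_seriesB (al be : ntree N -> R -> R) m k :
  (forall t, bigOh m (fun h => al t h - be t h)) ->
  bigOh m.+1 (fun h => nb_series F al (ntrees_upto4 N) h 0 k -
                       nb_series F be (ntrees_upto4 N) h 0 k).
Proof.
move=> O; apply: (@bigOh_eq _ _ (fun h => \sum_(t <- ntrees_upto4 N)
   h ^+ tree_order t * (al t h - be t h) * ((planar_weight t)%:R^-1 * F t 0 k))).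
  move=> h; rewrite !nb_seriesE -sumrB; apply: eq_bigr => t _.
  by rewrite /tree_coef; ring.
apply: bigOh_sum => t _; apply: bigOhMr; last exact: bigOh_cst.
apply: (bigOhS _ (bigOh_expM (tree_order t) (O t))).
by have := tree_order_gt0 t; lia.
Qed.

End ElementarySums.

(** * Necessity and sufficiency for one initial value problem *)

Lemma sum_pos_stages (R : realType) (G : 'I_4 -> R) :
  \sum_(i < 4 | (0 < i)%N) G i = G stage2 + G stage3 + G stage4.
Proof. by rewrite big_mkcond sum4/= add0r. Qed.

Section Quotients.
Variable R : realType.
Implicit Types (z g : R -> R) (l : R).

(** The weights are quotients; they are close to 1 when numerator and
    denominator are close to each other, and conversely. *)
Lemma bigOh_quotientB1 m z g l : 0 < l -> g h @[h --> 0^'+] --> l ->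
  bigOh m (fun h => z h - g h) -> bigOh m (fun h => z h / g h - 1).
Proof.
move=> l0 gl Ozg.
apply: (@bigOh_near _ _ (fun h => (z h - g h) / g h)).
  near=> h; rewrite mulrBl divff// gt_eqF//; near: h; exact: cvgr_gt gl _ l0.
by apply: bigOhMr => //; apply: cvg_bigOh0; exact: cvgV (lt0r_neq0 l0) gl.
Unshelve. all: by end_near. Qed.

Lemma bigOh_quotientB1_inv m z g l : 0 < l -> g h @[h --> 0^'+] --> l ->
  bigOh m (fun h => z h / g h - 1) -> bigOh m (fun h => g h - z h).
Proof.
move=> l0 gl Ozg.
apply: (@bigOh_near _ _ (fun h => - ((z h / g h - 1) * g h))).
  near=> h; rewrite mulrBl mulfVK ?mul1r ?opprB// gt_eqF//; near: h.
  exact: cvgr_gt gl _ l0.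
by apply: bigOhN; apply: bigOhMr => //; exact: cvg_bigOh0 gl.
Unshelve. all: by end_near. Qed.

End Quotients.

Section OneProblem.
Variables (R : realType) (N : nat) (P : pds R N) (yn : 'rV[R]_N).
Variables (A : 'M[R]_4) (b : 'rV[R]_4).
Variables (Y : R -> 'M[R]_(4, N)) (y1 phi : R -> 'rV[R]_N).
Variables (dpi : 'I_4 -> R -> 'rV[R]_N) (dsigma : R -> 'rV[R]_N).
Variables (pi0 : 'I_4 -> 'rV[R]_N) (sigma0 : 'rV[R]_N).
Hypothesis yn_gt0 : pos_orthant yn.
Hypothesis A_explicit : explicit_rk A.
Hypothesis ord4 : order4_conditions A b.
Let K := kutta_of A b.
Hypothesis K_ge0 : kutta_ge0 K.
Hypotheses (pi0_gt0 : forall i k, 0 < pi0 i 0 k) (sigma0_gt0 : forall k, 0 < sigma0 0 k).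
Hypothesis dpi_cvg : forall i k, dpi i h 0 k @[h --> 0^'+] --> pi0 i 0 k.
Hypothesis dsigma_cvg : forall k, dsigma h 0 k @[h --> 0^'+] --> sigma0 0 k.
Hypothesis Y_O1 : forall i k, bigOh 1 (fun h => Y h i k - yn 0 k).
Hypothesis y1_O1 : forall k, bigOh 1 (fun h => y1 h 0 k - yn 0 k).

Let F := elementary_differential P yn.
Let f := rhs P yn.
Let Dff := Drhs P yn f.
Let c i := \sum_(j < 4) A i j.
Let w h i nu : R := Y h i nu / dpi i h 0 nu.
Let w1 h nu : R := y1 h 0 nu / dsigma h 0 nu.

Hypothesis Y_nb : forall i k, bigOh 5 (fun h => Y h i k - yn 0 k -
  nb_series F (fun t h => stage_coef A (w h) t i) (ntrees_upto4 N) h 0 k).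
Hypothesis y1_nb : forall k, bigOh 5 (fun h => y1 h 0 k - yn 0 k -
  nb_series F (fun t h => step_coef A b (w h) (w1 h) t) (ntrees_upto4 N) h 0 k).
Hypothesis phi_nb : forall k, bigOh 5 (fun h => phi h 0 k - yn 0 k -
  nb_series F (@exact_coef R N) (ntrees_upto4 N) h 0 k).

Let taylor3 h : 'rV[R]_N := yn + h *: f + (h ^+ 2 / 2) *: Dff +
  (h ^+ 3 / 6) *: (D2rhs P yn f f + Drhs P yn Dff).
Let defect t h : R := step_coef A b (w h) (w1 h) t - (density t)%:R^-1.
Let stage_taylor2 h i nu : R := yn 0 nu + h * c i * f 0 nu +
  h ^+ 2 * (\sum_(k < 4) A i k * c k) * Dff 0 nu.

Let bounded_of_O1 (z : R -> R) (a : R) : bigOh 1 (fun h => z h - a) -> bigOh 0 z.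
Proof. by move=> /(bigOhB_cvg (ltn0Sn 0)); exact: cvg_bigOh0. Qed.

Let w_bounded i nu : bigOh 0 (fun h => w h i nu).
Proof. exact: bigOh_quotient (pi0_gt0 i nu) (bounded_of_O1 (Y_O1 i nu)) (@dpi_cvg i nu). Qed.

Let w1_bounded nu : bigOh 0 (fun h => w1 h nu).
Proof. exact: bigOh_quotient (sigma0_gt0 nu) (bounded_of_O1 (y1_O1 nu)) (@dsigma_cvg nu). Qed.

(** The error of one step, as the combination of elementary differentials
    whose coefficients independence bounds one by one. *)
Lemma step_exact_difference k : bigOh 5 (fun h => (y1 h 0 k - phi h 0 k) -
  \sum_(t <- ntrees_upto4 N) h ^+ tree_order t / (planar_weight t)%:R *
    defect t h * F t 0 k).
Proof.
apply: (bigOh_eq _ (bigOhB (y1_nb k) (phi_nb k))) => h.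
set S := \sum_(t <- _) _.
have -> : S = nb_series F (fun t h => step_coef A b (w h) (w1 h) t) (ntrees_upto4 N) h 0 k
    - nb_series F (@exact_coef R N) (ntrees_upto4 N) h 0 k.
  rewrite !nb_seriesE -sumrB; apply: eq_bigr => t _.
  by rewrite /tree_coef /exact_coef /defect; ring.
by move: (nb_series _ _ _ _ 0 k) (nb_series _ _ _ _ 0 k) => x x'; ring.
Qed.

(** The weights enter the stages through the factor [h], so that an error
    O(h^m) of the weights is an error O(h^(m+1)) of the stages; with exact
    weights the stages are those of the Runge-Kutta scheme. *)
Lemma stage_taylor m i nu : (m <= 2)%N ->
  (forall (i : 'I_4) nu, (0 < i)%N -> bigOh m (fun h => w h i nu - 1)) ->
  bigOh m.+1 (fun h => Y h i nu - stage_taylor2 h i nu).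
Proof.
move=> m2 Ow.
have O1 := bigOhS (_ : m.+1 <= 5)%N (Y_nb i nu).
have O2 := @nb_seriesB _ _ P yn (fun t h => stage_coef A (w h) t i)
  (fun t _ => rk_stage_coef A t i) m nu
  (fun t => stage_coefB A_explicit w_bounded t i Ow).
have O3 := bigOhS (_ : m.+1 <= 3)%N (nb_series_rk_stage P yn_gt0 A i nu).
apply: (bigOh_eq _ (bigOhD (bigOhD (O1 _) O2) (O3 _))); try by lia.
by move=> h; rewrite !addrA !subrK /stage_taylor2 opprD addrA !opprD !addrA.
Qed.

Lemma phi_taylor k : bigOh 4 (fun h => phi h 0 k - taylor3 h 0 k).
Proof.
apply: (bigOh_eq _ (bigOhD (bigOhS (isT : (4 <= 5)%N) (phi_nb k))
  (nb_series_exact P yn_gt0 k))) => h.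
have -> : taylor3 h 0 k = yn 0 k + (h *: f + (h ^+ 2 / 2) *: Dff +
    (h ^+ 3 / 6) *: (D2rhs P yn f f + Drhs P yn Dff)) 0 k.
  by rewrite /taylor3 -!addrA [LHS]mxE.
by rewrite addrA subrK opprD addrA.
Qed.

Section Necessity.
Hypothesis defect_small : forall t, (tree_order t <= 4)%N ->
  bigOh 5 (fun h => h ^+ tree_order t * defect t h).
Hypothesis order4 : forall k, bigOh 5 (fun h => y1 h 0 k - phi h 0 k).

Let defect_bigOh t n : (0 < n)%N -> (tree_order t + n)%N = 5%N -> bigOh n (defect t).
Proof.
move=> n0 tn; apply: (@bigOh_expM_inv _ n (tree_order t)); rewrite tn.
by apply: defect_small; lia.
Qed.

Section OneColour.
Variable nu : 'I_N.
Let leaf : ntree N := Node nu [::].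
Let Kw h := kutta_scale K (w h stage2 nu) (w h stage3 nu) (w h stage4 nu).
Let mono h := step_coef_monochromatic b A_explicit (w h) (w1 h) nu.

Lemma step_weight_near1 : bigOh 4 (fun h => w1 h nu - 1).
Proof.
apply: (bigOh_eq _ (@defect_bigOh leaf 4 isT (erefl _))) => h.
rewrite /defect; have [[-> _ _ _] _] := mono h.
by rewrite /= (cond1 (kutta_of_order4 A_explicit ord4)) mulr1 invr1.
Qed.

Let w10 i : R := yn 0 nu / pi0 i 0 nu.

Let w_cvg i : w h i nu @[h --> 0^'+] --> w10 i.
Proof.
apply: cvgM; last exact: cvgV (lt0r_neq0 (pi0_gt0 i nu)) (@dpi_cvg i nu).
exact: bigOhB_cvg (ltn0Sn 0) (Y_O1 i nu).
Qed.

(* A condition on a tree passes to the scaled Runge-Kutta scheme, and then to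
   its limit. *)
Let pass t n (L : R -> R) (L0 g : R) : (0 < n <= 4)%N ->
  (tree_order t + n)%N = 5%N -> (density t)%:R^-1 = g ->
  (forall h, step_coef A b (w h) (w1 h) t = w1 h nu * L h) ->
  L h @[h --> 0^'+] --> L0 -> bigOh n (fun h => L h - g) /\ L0 = g.
Proof.
move=> /andP[n0 n4] tn tg tL LL0.
have O : bigOh n (fun h => L h - g).
  apply: (@bigOh_eq _ _ (fun h => defect t h - (w1 h nu - 1) * L h)).
    by move=> h; rewrite /defect tL tg; ring.
  apply: bigOhB; first exact: defect_bigOh.
  by apply: bigOhMr (cvg_bigOh0 LL0); apply: bigOhS n4 step_weight_near1.
split=> //; apply: (cvg_unique _ LL0 (bigOhB_cvg n0 O)); exact: norm_hausdorff.
Qed.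

(** The limits of the weights turn the scheme into another one of order 4 with
    the same [b], hence they are equal to 1; the conditions of order 2 and 3
    then give the rate. *)
Lemma stage_weight_near1 (i : 'I_4) : (0 < i)%N -> bigOh 2 (fun h => w h i nu - 1).
Proof.
have ordK := kutta_of_order4 A_explicit ord4.
pose K0 := kutta_scale K (w10 stage2) (w10 stage3) (w10 stage4).
have Ccst (a : R) : a @[h --> (0 : R)^'+] --> a by exact: cvg_cst.
have Ca21 : a21 (Kw h) @[h --> 0^'+] --> a21 K0.
  exact: (cvgM (Ccst (a21 K)) (@w_cvg stage2)).
have Ca31 : a31 (Kw h) @[h --> 0^'+] --> a31 K0.
  exact: (cvgM (Ccst (a31 K)) (@w_cvg stage3)).
have Ca32 : a32 (Kw h) @[h --> 0^'+] --> a32 K0.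
  exact: (cvgM (Ccst (a32 K)) (@w_cvg stage3)).
have Ca41 : a41 (Kw h) @[h --> 0^'+] --> a41 K0.
  exact: (cvgM (Ccst (a41 K)) (@w_cvg stage4)).
have Ca42 : a42 (Kw h) @[h --> 0^'+] --> a42 K0.
  exact: (cvgM (Ccst (a42 K)) (@w_cvg stage4)).
have Ca43 : a43 (Kw h) @[h --> 0^'+] --> a43 K0.
  exact: (cvgM (Ccst (a43 K)) (@w_cvg stage4)).
have Cb2 := Ccst (b2 K); have Cb3 := Ccst (b3 K); have Cb4 := Ccst (b4 K).
have Cc2 : c2 (Kw h) @[h --> 0^'+] --> c2 K0 by [].
have Cc3 : c3 (Kw h) @[h --> 0^'+] --> c3 K0 by exact: cvgD.
have Cc4 : c4 (Kw h) @[h --> 0^'+] --> c4 K0 by exact: (cvgD (cvgD Ca41 Ca42) Ca43).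
have Cz3 : z3 (Kw h) @[h --> 0^'+] --> z3 K0 by exact: cvgM.
have Cz4 : z4 (Kw h) @[h --> 0^'+] --> z4 K0 by apply: cvgD; exact: cvgM.
have CX n (u : R -> R) (u0 : R) : u h @[h --> 0^'+] --> u0 -> u h ^+ n @[h --> 0^'+] --> u0 ^+ n.
  by move=> uu0; apply: (cvg_comp _ _ uu0 (@exprn_continuous _ n u0)).
have [H21 E21] : bigOh 3 (fun h => b2 K * c2 (Kw h) + b3 K * c3 (Kw h) + b4 K * c4 (Kw h) - 2^-1)
    /\ b2 K * c2 K0 + b3 K * c3 K0 + b4 K * c4 K0 = 2^-1.
  apply: (@pass (Node nu [:: leaf])) => //; first by move=> h; have [[_ -> _ _] _] := mono h.
  exact: (cvgD (cvgD (cvgM Cb2 Cc2) (cvgM Cb3 Cc3)) (cvgM Cb4 Cc4)).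
have [H31 E31] : bigOh 2 (fun h => b2 K * c2 (Kw h) ^+ 2 + b3 K * c3 (Kw h) ^+ 2
      + b4 K * c4 (Kw h) ^+ 2 - 3^-1)
    /\ b2 K * c2 K0 ^+ 2 + b3 K * c3 K0 ^+ 2 + b4 K * c4 K0 ^+ 2 = 3^-1.
  apply: (@pass (Node nu [:: leaf; leaf])) => //.
    by move=> h; have [[_ _ -> _] _] := mono h.
  exact: (cvgD (cvgD (cvgM Cb2 (CX 2 _ _ Cc2)) (cvgM Cb3 (CX 2 _ _ Cc3)))
    (cvgM Cb4 (CX 2 _ _ Cc4))).
have [H32 E32] : bigOh 2 (fun h => b3 K * z3 (Kw h) + b4 K * z4 (Kw h) - 6^-1)
    /\ b3 K * z3 K0 + b4 K * z4 K0 = 6^-1.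
  apply: (@pass (Node nu [:: Node nu [:: leaf]])) => //.
    by move=> h; have [[_ _ _ ->] _] := mono h.
  exact: (cvgD (cvgM Cb3 Cz3) (cvgM Cb4 Cz4)).
have [_ E41] : bigOh 1 (fun h => b2 K * c2 (Kw h) ^+ 3 + b3 K * c3 (Kw h) ^+ 3
      + b4 K * c4 (Kw h) ^+ 3 - 4^-1)
    /\ b2 K * c2 K0 ^+ 3 + b3 K * c3 K0 ^+ 3 + b4 K * c4 K0 ^+ 3 = 4^-1.
  apply: (@pass (Node nu [:: leaf; leaf; leaf])) => //.
    by move=> h; have [_ [-> _ _ _]] := mono h.
  exact: (cvgD (cvgD (cvgM Cb2 (CX 3 _ _ Cc2)) (cvgM Cb3 (CX 3 _ _ Cc3)))
    (cvgM Cb4 (CX 3 _ _ Cc4))).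
have [_ E42] : bigOh 1 (fun h => b3 K * c3 (Kw h) * z3 (Kw h)
      + b4 K * c4 (Kw h) * z4 (Kw h) - 8^-1)
    /\ b3 K * c3 K0 * z3 K0 + b4 K * c4 K0 * z4 K0 = 8^-1.
  apply: (@pass (Node nu [:: leaf; Node nu [:: leaf]])) => //.
    by move=> h; have [_ [_ -> _ _]] := mono h.
  exact: (cvgD (cvgM (cvgM Cb3 Cc3) Cz3) (cvgM (cvgM Cb4 Cc4) Cz4)).
have [_ E43] : bigOh 1 (fun h => b3 K * (a32 (Kw h) * c2 (Kw h) ^+ 2)
      + b4 K * (a42 (Kw h) * c2 (Kw h) ^+ 2 + a43 (Kw h) * c3 (Kw h) ^+ 2) - 12^-1)
    /\ b3 K * (a32 K0 * c2 K0 ^+ 2)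
      + b4 K * (a42 K0 * c2 K0 ^+ 2 + a43 K0 * c3 K0 ^+ 2) = 12^-1.
  apply: (@pass (Node nu [:: Node nu [:: leaf; leaf]])) => //.
    by move=> h; have [_ [_ _ -> _]] := mono h.
  have Cc22 := CX 2 _ _ Cc2; have Cc32 := CX 2 _ _ Cc3.
  exact: (cvgD (cvgM Cb3 (cvgM Ca32 Cc22))
    (cvgM Cb4 (cvgD (cvgM Ca42 Cc22) (cvgM Ca43 Cc32)))).
have [_ E44] : bigOh 1 (fun h => b4 K * (a43 (Kw h) * z3 (Kw h)) - 24^-1)
    /\ b4 K * (a43 K0 * z3 K0) = 24^-1.
  apply: (@pass (Node nu [:: Node nu [:: Node nu [:: leaf]]])) => //.
    by move=> h; have [_ [_ _ _ ->]] := mono h.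
  exact: (cvgM Cb4 (cvgM Ca43 Cz3)).
have ordK0 : kutta_order4 K0 by split => //; exact: (cond1 ordK).
have [e2 e3 e4] := kutta_scale_eq1 ordK K_ge0 ordK0.
have [| | | | | |O2 O3 O4] := kutta_scale_rate ordK K_ge0 (w2 := fun h => w h stage2 nu)
    (w3 := fun h => w h stage3 nu) (w4 := fun h => w h stage4 nu).
- by rewrite -e2; exact: (@w_cvg stage2).
- by rewrite -e3; exact: (@w_cvg stage3).
- by rewrite -e4; exact: (@w_cvg stage4).
- apply: (bigOh_eq _ (bigOhS (isT : (2 <= 3)%N) H21)) => h.
  by rewrite /c2 /c3 /c4 /=; ring.
- by apply: (bigOh_eq _ H31) => h; rewrite /c2 /c3 /c4 /=; ring.
- by apply: (bigOh_eq _ H32) => h; rewrite /z3 /z4 /c2 /c3 /=; ring.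
by move: i; apply: stageP.
Qed.

Lemma quadrature_weights :
  bigOh 3 (fun h => \sum_(i < 4 | (0 < i)%N) b 0 i * c i * w h i nu - 2^-1).
Proof.
pose L h := \sum_(i < 4 | (0 < i)%N) b 0 i * c i * w h i nu.
have OL : bigOh 0 L.
  apply: bigOh_sum => i _; apply: bigOhMl (w_bounded i nu); exact: bigOh_cst.
apply: (@bigOh_eq _ _ (fun h => defect (Node nu [:: leaf]) h - (w1 h nu - 1) * L h)).
  move=> h; rewrite /defect; have [[_ -> _ _] _] := mono h.
  have -> : b2 (Kw h) * c2 (Kw h) + b3 (Kw h) * c3 (Kw h) + b4 (Kw h) * c4 (Kw h) = L h.
    rewrite /L sum_pos_stages /c; have [_ -> -> ->] := explicit_row_sums b A_explicit.
    by rewrite /c2 /c3 /c4/=; ring.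
  by rewrite (_ : density _ = 2)%N//; rewrite /L; move: (\sum_(i < 4 | _) _) => x; ring.
apply: bigOhB; first exact: (@defect_bigOh (Node nu [:: leaf]) 3 isT (erefl _)).
by apply: bigOhMr OL; apply: bigOhS (isT : (3 <= 4)%N) step_weight_near1.
Qed.

End OneColour.

Lemma necessity_sigma mu : bigOh 4 (fun h => dsigma h 0 mu - taylor3 h 0 mu).
Proof.
have O1 := bigOh_quotientB1_inv (sigma0_gt0 mu) (@dsigma_cvg mu) (step_weight_near1 mu).
apply: (bigOh_eq _ (bigOhD (bigOhD O1 (bigOhS (isT : (4 <= 5)%N) (order4 mu)))
  (phi_taylor mu))) => h.
by rewrite !subrKA.
Qed.

Lemma necessity_quadrature nu : bigOh 3 (fun h =>
  \sum_(i < 4 | (0 < i)%N) b 0 i * c i * (stage_taylor2 h i nu / dpi i h 0 nu) - 1 / 2).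
Proof.
have O2 i : bigOh 3 (fun h => Y h i nu - stage_taylor2 h i nu).
  by apply: stage_taylor => // j ka j0; exact: stage_weight_near1.
apply: (@bigOh_eq _ _ (fun h =>
    (\sum_(i < 4 | (0 < i)%N) b 0 i * c i * w h i nu - 2^-1) -
    \sum_(i < 4 | (0 < i)%N) b 0 i * c i *
      ((Y h i nu - stage_taylor2 h i nu) / dpi i h 0 nu))).
  move=> h; rewrite addrAC -sumrB div1r; congr (_ - _); apply: eq_bigr => i _.
  by rewrite /w; ring.
apply: bigOhB; first exact: quadrature_weights.
apply: bigOh_sum => i _; apply: bigOhMl; first exact: bigOh_cst.
apply: bigOhMr => //; apply: cvg_bigOh0.
exact: cvgV (lt0r_neq0 (pi0_gt0 i nu)) (@dpi_cvg i nu).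
Qed.

Lemma necessity_pi (i : 'I_4) nu : (0 < i)%N ->
  bigOh 2 (fun h => dpi i h 0 nu - (yn 0 nu + h * c i * f 0 nu)).
Proof.
move=> i0.
have O1 := bigOh_quotientB1_inv (pi0_gt0 i nu) (@dpi_cvg i nu) (stage_weight_near1 nu i0).
have O2 : bigOh 2 (fun h => Y h i nu - stage_taylor2 h i nu).
  by apply: stage_taylor => // j ka j0; exact: bigOhS (stage_weight_near1 ka j0).
have O3 : bigOh 2 (fun h => h ^+ 2 * ((\sum_(k < 4) A i k * c k) * Dff 0 nu)).
  by apply: bigOhMr; [exact: bigOh_exp|exact: bigOh_cst].
apply: (bigOh_eq _ (bigOhD (bigOhD O1 O2) O3)) => h.
by rewrite /stage_taylor2; ring.
Qed.

End Necessity.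

Section Sufficiency.
Hypothesis cond_sigma : forall mu, bigOh 4 (fun h => dsigma h 0 mu - taylor3 h 0 mu).
Hypothesis cond_quadrature : forall nu, bigOh 3 (fun h =>
  \sum_(i < 4 | (0 < i)%N) b 0 i * c i * (stage_taylor2 h i nu / dpi i h 0 nu) - 1 / 2).
Hypothesis cond_pi : forall (i : 'I_4) nu, (0 < i)%N ->
  bigOh 2 (fun h => dpi i h 0 nu - (yn 0 nu + h * c i * f 0 nu)).

Let weight_near1 m (i : 'I_4) nu : bigOh m (fun h => Y h i nu - dpi i h 0 nu) ->
  bigOh m (fun h => w h i nu - 1).
Proof. exact: bigOh_quotientB1 (pi0_gt0 i nu) (@dpi_cvg i nu). Qed.

Lemma sufficiency_weight1 (i : 'I_4) nu : (0 < i)%N -> bigOh 1 (fun h => w h i nu - 1).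
Proof.
move=> i0; apply: weight_near1.
have O3 : bigOh 1 (fun h => h * (c i * f 0 nu)).
  by apply: bigOhMr; [exact: bigOh_id|exact: bigOh_cst].
apply: (bigOh_eq _ (bigOhB (bigOhB (Y_O1 i nu) (bigOhS (isT : (1 <= 2)%N) (cond_pi nu i0)))
   O3)) => h.
by ring.
Qed.

Lemma sufficiency_weight2 (i : 'I_4) nu : (0 < i)%N -> bigOh 2 (fun h => w h i nu - 1).
Proof.
move=> i0; apply: weight_near1.
have O2 := @stage_taylor 1 i nu isT sufficiency_weight1.
have O3 : bigOh 2 (fun h => h ^+ 2 * ((\sum_(k < 4) A i k * c k) * Dff 0 nu)).
  by apply: bigOhMr; [exact: bigOh_exp|exact: bigOh_cst].
apply: (bigOh_eq _ (bigOhB (bigOhD O2 O3) (cond_pi nu i0))) => h.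
by rewrite /stage_taylor2; ring.
Qed.

Lemma sufficiency_quadrature nu :
  bigOh 3 (fun h => \sum_(i < 4) b 0 i * c i * w h i nu - 2^-1).
Proof.
have O2 i : bigOh 3 (fun h => Y h i nu - stage_taylor2 h i nu).
  exact: stage_taylor sufficiency_weight2.
apply: (@bigOh_eq _ _ (fun h =>
    (\sum_(i < 4 | (0 < i)%N) b 0 i * c i * (stage_taylor2 h i nu / dpi i h 0 nu) - 1 / 2) +
    \sum_(i < 4 | (0 < i)%N) b 0 i * c i *
      ((Y h i nu - stage_taylor2 h i nu) / dpi i h 0 nu))).
  move=> h; rewrite addrAC -big_split/= div1r; congr (_ - _).
  rewrite !sum_pos_stages sum4 {7}/c.
  have [-> _ _ _] := explicit_row_sums b A_explicit.
  by rewrite mulr0 mul0r add0r /w; congr (_ + _ + _); ring.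
apply: bigOhD; first exact: cond_quadrature.
apply: bigOh_sum => i _; apply: bigOhMl; first exact: bigOh_cst.
apply: bigOhMr => //; apply: cvg_bigOh0.
exact: cvgV (lt0r_neq0 (pi0_gt0 i nu)) (@dpi_cvg i nu).
Qed.

Lemma defect_order1 m t : (forall nu, bigOh m (fun h => w1 h nu - 1)) ->
  tree_order t = 1%N -> bigOh m (defect t).
Proof.
move=> Ow1 /tree_order1P[nu ->]; apply: (bigOh_eq _ (Ow1 nu)) => h.
rewrite /defect /step_coef [density _]/= invr1; congr (_ - _).
case: ord4 => -[e1 _ _ _] _; rewrite -[LHS]mul1r -[1 in LHS]e1 mulr_suml.
by apply: eq_bigr => j _; exact/esym/mulr1.
Qed.

Lemma defect_order2 m t : (m <= 3)%N -> (forall nu, bigOh m (fun h => w1 h nu - 1)) ->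
  tree_order t = 2%N -> bigOh m (defect t).
Proof.
move=> m3 Ow1 t2; have [nu [u [tE u1]]] := tree_order2P t2.
have [mu uE] := tree_order1P u1.
pose L h := \sum_(i < 4) b 0 i * c i * w h i mu.
have OL : bigOh 0 L.
  apply: bigOh_sum => i _; apply: bigOhMl (w_bounded i mu); exact: bigOh_cst.
apply: (@bigOh_eq _ _ (fun h => (w1 h nu - 1) * L h + (L h - 2^-1))).
  move=> h; rewrite /defect density2//.
  have -> : step_coef A b (w h) (w1 h) t = w1 h nu * L h.
    rewrite tE uE /L mulr_sumr; apply: eq_bigr => j _.
    have S : stage_coef A (w h) (Node mu [::]) j = c j * w h j mu.
      by rewrite /c mulr_suml; apply: eq_bigr => l _; exact: mulr1.
    transitivity (b 0 j * w1 h nu * stage_coef A (w h) (Node mu [::]) j).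
      by congr (_ * _); exact: mulr1.
    by rewrite S; ring.
  by move: (L h) => x; ring.
apply: bigOhD; first exact: bigOhMr (Ow1 nu) OL.
exact: bigOhS m3 (sufficiency_quadrature mu).
Qed.

Lemma defect_order34 m t : (m <= 2)%N -> (tree_order t <= 4)%N ->
  (forall nu, bigOh m (fun h => w1 h nu - 1)) -> bigOh m (defect t).
Proof.
move=> m2 t4 Ow1.
apply: (bigOh_eq _ (step_coefB b A_explicit w_bounded t
  (fun i nu i0 => bigOhS m2 (@sufficiency_weight2 i nu i0)) Ow1)) => h.
by rewrite /defect rk_step_coefP.
Qed.

(** A tree of order [n] carries the factor h^n.  Its coefficient is exact up
    to O(h^m) for n = 1, where only the step weight enters, up to
    O(h^min(m, 3)) for n = 2 by the quadrature condition, and up to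
    O(h^min(m, 2)) for n = 3, 4; in each case the product is O(h^(m+1)). *)
Lemma step_error m k : (0 < m <= 4)%N -> (forall nu, bigOh m (fun h => w1 h nu - 1)) ->
  bigOh m.+1 (fun h => y1 h 0 k - phi h 0 k).
Proof.
move=> /andP[m0 m4] Ow1.
pose T t h := h ^+ tree_order t / (planar_weight t)%:R * defect t h * F t 0 k.
have OT n t : tree_order t = n -> forall l, bigOh l (defect t) -> bigOh (n + l) (T t).
  move=> tn l Ol; apply: bigOhMr; last exact: bigOh_cst.
  apply: bigOhM => //; apply: bigOhMr; last exact: bigOh_cst.
  by rewrite -tn; exact: bigOh_exp.
apply: (bigOh_eq _ (bigOhD (bigOhS (_ : m.+1 <= 5)%N (step_exact_difference k))
  (_ : bigOh m.+1 (fun h => \sum_(t <- ntrees_upto4 N) T t h)))) => //.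
  by move=> h; rewrite subrK.
under eq_fun do rewrite big_ntrees_upto4_orders.
apply: bigOhD; first apply: bigOhD; first apply: bigOhD.
- apply: bigOh_sum_all (all_ntrees1 N) _ => t /eqP t1.
  exact: OT t1 _ (defect_order1 Ow1 t1).
- apply: bigOh_sum_all (all_ntrees2 N) _ => t /eqP t2.
  apply: (bigOhS _ (OT _ _ t2 (minn m 3) _)); first by lia.
  apply: defect_order2 t2; first by lia.
  by move=> nu; apply: bigOhS (Ow1 nu); lia.
- apply: bigOh_sum_all (all_ntrees3 N) _ => t /eqP t3.
  apply: (bigOhS _ (OT _ _ t3 (minn m 2) _)); first by lia.
  apply: defect_order34; [by lia|by rewrite t3|].
  by move=> nu; apply: bigOhS (Ow1 nu); lia.
- apply: bigOh_sum_all (all_ntrees4 N) _ => t /eqP t4.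
  apply: (bigOhS _ (OT _ _ t4 1%N _)); first by lia.
  apply: defect_order34; [by lia|by rewrite t4|].
  by move=> nu; apply: bigOhS (Ow1 nu); lia.
Qed.

Lemma step_weight_of_error m nu : (m <= 4)%N ->
  bigOh m (fun h => y1 h 0 nu - phi h 0 nu) -> bigOh m (fun h => w1 h nu - 1).
Proof.
move=> m4 O; apply: (bigOh_quotientB1 (sigma0_gt0 nu) (@dsigma_cvg nu)).
apply: (bigOh_eq _ (bigOhB (bigOhD O (bigOhS m4 (phi_taylor nu)))
   (bigOhS m4 (cond_sigma nu)))) => h.
by rewrite subrKA opprB subrKA.
Qed.

Lemma step_weight_O1 nu : bigOh 1 (fun h => w1 h nu - 1).
Proof.
apply: (bigOh_quotientB1 (sigma0_gt0 nu) (@dsigma_cvg nu)).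
have O3 : bigOh 1 (fun h => taylor3 h 0 nu - yn 0 nu).
  apply: (@bigOh_eq _ _ (fun h => h * (f 0 nu) + h ^+ 2 * (Dff 0 nu / 2) +
      h ^+ 3 * ((D2rhs P yn f f + Drhs P yn Dff) 0 nu / 6))).
    move=> h; rewrite /taylor3; move: (D2rhs P yn f f + Drhs P yn Dff) => x.
    by rewrite !(mxE, add0r); ring.
  have OX n (a : R) : bigOh 1 (fun h => h ^+ n.+1 * a).
    apply: bigOhMr; last exact: bigOh_cst.
    exact: bigOhS (bigOh_exp R n.+1).
  by apply: bigOhD; [apply: bigOhD; [exact: (OX 0%N)|exact: OX]|exact: OX].
apply: (bigOh_eq _ (bigOhB (y1_O1 nu) (bigOhD (bigOhS (isT : (1 <= 4)%N) (cond_sigma nu))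
   O3))) => h.
by ring.
Qed.

(** The error of the step and the step weight improve each other, by one order
    at a time, from the trivial estimate up to order 5. *)
Lemma sufficiency k : bigOh 5 (fun h => y1 h 0 k - phi h 0 k).
Proof.
suff H m : (m < 4)%N -> forall nu, bigOh m.+1 (fun h => w1 h nu - 1).
  by apply: (step_error (m := 4)) => //; exact: H.
elim: m => [_|m IH m4] nu; first exact: step_weight_O1.
by apply: step_weight_of_error => //; apply: step_error; [lia|apply: IH; lia].
Qed.

End Sufficiency.
End OneProblem.

(** * The theorem *)

Theorem theorem4p15 (R : realType) (N : nat)
    (A : 'M[R]_4) (b c : 'rV[R]_4)
    (A_ge0 : forall i j, 0 <= A i j) (b_ge0 : forall j, 0 <= b 0 j)
    (A_explicit : explicit_rk A)
    (A_row_sum : forall i, \sum_(j < 4) A i j = c 0 i)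
    (rk_order4 : rk_order_at_least 4 A b)
    (pi : pds R N -> 'I_4 -> denominator R N 4)
    (sigma : pds R N -> denominator R N 4)
    (pi_admissible : forall P i, admissible (pi P i))
    (sigma_admissible : forall P, admissible (sigma P))
    (pi_stages : forall P i, uses_stages_below i (pi P i))
    (Y : pds R N -> 'rV[R]_N -> R -> 'M[R]_(4, N))
    (y1 : pds R N -> 'rV[R]_N -> R -> 'rV[R]_N)
    (mprk : forall P yn h, pos_orthant yn -> 0 <= h ->
       mprk_step A b (pi P) (sigma P) P h yn (Y P yn h) (y1 P yn h))
    (phi : pds R N -> 'rV[R]_N -> R -> 'rV[R]_N)
    (exact : forall P yn, pos_orthant yn -> ivp_solution (rhs P) yn (phi P yn))
    (independent :
       independent_differentials (coef_defect A b pi sigma Y y1)) :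
  order_at_least 4 y1 phi <->
  forall (P : pds R N) (yn : 'rV[R]_N), pos_orthant yn ->
    let f := rhs P yn in
    let Df := Drhs P yn in
    let D2f := D2rhs P yn in
    [/\ forall mu : 'I_N,
          (fun h : R => sigma P (h, yn, Y P yn h) 0 mu
            - (yn + h *: f + (h ^+ 2 / 2) *: Df f
               + (h ^+ 3 / 6) *: (D2f f f + Df (Df f))) 0 mu) =O(dt^ 4),
        forall nu : 'I_N,
          (fun h : R => \sum_(i < 4 | (0 < i)%N) b 0 i * c 0 i *
             ((yn 0 nu + h * c 0 i * f 0 nu
               (* y^(i) = yn + h c_i f + h^2 (\sum_k a_ik c_k) Df f + O(h^3):
                  there is no factor 1/2 here *)
               + h ^+ 2 * (\sum_(k < 4) A i k * c 0 k) * Df f 0 nu)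
              / pi P i (h, yn, Y P yn h) 0 nu)
            - 1 / 2) =O(dt^ 3) &
        forall (i : 'I_4) (nu : 'I_N), (0 < i)%N ->
          (fun h : R => pi P i (h, yn, Y P yn h) 0 nu
             - (yn 0 nu + h * c 0 i * f 0 nu)) =O(dt^ 2)].
Proof.
have ord4 := order4_conditionsP rk_order4.
have K_ge0 : kutta_ge0 (kutta_of A b) by split; split; exact: A_ge0 || exact: b_ge0.
have AcE i : \sum_(k < 4) A i k * \sum_(l < 4) A k l = \sum_(k < 4) A i k * c 0 k.
  by apply: eq_bigr => k _; rewrite A_row_sum.
have step (P : pds R N) yn (yn_gt0 : pos_orthant yn) h (h_ge0 : 0 <= h) :=
  mprk P yn h yn_gt0 h_ge0.
have pi0_pos P yn (yn_gt0 : pos_orthant yn) := pi0_gt0 (pi_admissible P) yn_gt0.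
have sigma0_pos P yn (yn_gt0 : pos_orthant yn) := sigma0_gt0 (sigma_admissible P) yn_gt0.
have pi_cvg P yn (yn_gt0 : pos_orthant yn) := @dpi_cvg _ _ _ _ _ _ _ _ _ _ _ A_ge0
  A_explicit (pi_admissible P) (pi_stages P) yn_gt0 (step P yn yn_gt0).
have sigma_cvg P yn (yn_gt0 : pos_orthant yn) := @dsigma_cvg _ _ _ _ _ _ _ _ _ _ _ A_ge0
  A_explicit (pi_admissible P) (sigma_admissible P) (pi_stages P) yn_gt0 (step P yn yn_gt0).
have Y_O1 P yn (yn_gt0 : pos_orthant yn) := stage_O1 A_ge0
  A_explicit (pi_admissible P) (pi_stages P) yn_gt0 (step P yn yn_gt0).
have y1_O1 P yn (yn_gt0 : pos_orthant yn) := step_O1 A_ge0 b_ge0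
  A_explicit (pi_admissible P) (sigma_admissible P) (pi_stages P) yn_gt0 (step P yn yn_gt0).
have Y_nb P yn (yn_gt0 : pos_orthant yn) := stage_nb_series A_ge0
  A_explicit (pi_admissible P) (pi_stages P) yn_gt0 (step P yn yn_gt0).
have y1_nb P yn (yn_gt0 : pos_orthant yn) := step_nb_series A_ge0 b_ge0
  A_explicit (pi_admissible P) (sigma_admissible P) (pi_stages P) yn_gt0 (step P yn yn_gt0).
have phi_nb P yn (yn_gt0 : pos_orthant yn) k :=
  exact_expansion yn_gt0 k (exact P yn yn_gt0).
split=> [ord P yn yn_gt0 f Df D2f|cond P yn yn_gt0 k].
- have ordO P' yn' (yn'_gt0 : pos_orthant yn') k :
      bigOh 5 (fun h => y1 P' yn' h 0 k - phi P' yn' h 0 k).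
    by apply/bigOhP; exact: ord.
  have small t : (tree_order t <= 4)%N -> bigOh 5 (fun h => h ^+ tree_order t *
      coef_defect A b pi sigma Y y1 P yn t h).
    move=> t4; apply/bigOhP; apply: independent => // P' yn' yn'_gt0 k; apply/bigOhP.
    have D := step_exact_difference (y1_nb P' yn' yn'_gt0) (phi_nb P' yn' yn'_gt0) k.
    apply: (bigOh_eq _ (bigOhB (ordO P' yn' yn'_gt0 k) D)) => h.
    by rewrite opprB addrC subrK.
  split=> [mu|nu|i nu i0]; apply/bigOhP.
  + exact: (necessity_sigma yn_gt0 A_explicit ord4 (sigma0_pos P yn yn_gt0)
      (sigma_cvg P yn yn_gt0) (phi_nb P yn yn_gt0) small (ordO P yn yn_gt0) mu).
  + apply: (bigOh_eq _ (necessity_quadrature yn_gt0 A_explicit ord4 K_ge0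
      (pi0_pos P yn yn_gt0) (pi_cvg P yn yn_gt0) (Y_O1 P yn yn_gt0)
      (Y_nb P yn yn_gt0) small nu)) => h.
    by congr (_ - _); apply: eq_bigr => i _; rewrite AcE A_row_sum.
  + apply: (bigOh_eq _ (necessity_pi yn_gt0 A_explicit ord4 K_ge0
      (pi0_pos P yn yn_gt0) (pi_cvg P yn yn_gt0) (Y_O1 P yn yn_gt0)
      (Y_nb P yn yn_gt0) small nu i0)) => h.
    by rewrite A_row_sum.
- apply/bigOhP; have [c1 c2 c3] := cond P yn yn_gt0.
  apply: (sufficiency yn_gt0 A_explicit ord4 (pi0_pos P yn yn_gt0)
    (sigma0_pos P yn yn_gt0) (pi_cvg P yn yn_gt0) (sigma_cvg P yn yn_gt0)
    (Y_O1 P yn yn_gt0) (y1_O1 P yn yn_gt0) (Y_nb P yn yn_gt0) (y1_nb P yn yn_gt0)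
    (phi_nb P yn yn_gt0)).
  + by move=> mu; apply/bigOhP; exact: c1.
  + move=> nu; have /bigOhP O := c2 nu; apply: (bigOh_eq _ O) => h.
    by congr (_ - _); apply: eq_bigr => i _; rewrite AcE A_row_sum.
  + move=> i nu i0; have /bigOhP O := c3 i nu i0; apply: (bigOh_eq _ O) => h.
    by rewrite A_row_sum.
Qed.
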